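(* Let $p\ge 2$ and $m$ be positive integers. For $p>m$, the identity map of the round sphere $\mathbb{S}^m$ is a stable $p$-harmonic self-map of $\mathbb{S}^m$.
   Context: A smooth map $\phi:(M,g)\to(N,h)$ between closed Riemannian manifolds is $p$-harmonic if it is a critical point of the energy $E_p(\phi)=\frac1p\int_M|d\phi|^p\,dv_g$. A $p$-harmonic map is stable if and only if the Jacobi operator associated to the second variation of this energy has only positive eigenvalues. $\mathbb{S}^m$ is the $m$-dimensional unit sphere with the standard round metric.
   Formalization: ''Only positive eigenvalues'' fails, as Killing fields (rotations) are eigenfields of eigenvalue 0 of the Jacobi operator at the identity; stable is taken as: all eigenvalues are nonnegative, and it is also proved that every eigenvalue with a non-Killing eigenfield is positive. *)

(* Defs.v *)
From HB Require Import structures.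
From mathcomp Require Import all_boot all_order all_algebra.
From mathcomp Require Import all_classical all_reals all_analysis.

Set Implicit Arguments.
Unset Strict Implicit.
Unset Printing Implicit Defensive.

Import Order.TTheory GRing.Theory Num.Theory.
Import numFieldNormedType.Exports.

Local Open Scope classical_set_scope.
Local Open Scope ring_scope.

(* Lebesgue measure on R^n, carried by n-tuples: the image of the product of
   the one-dimensional Lebesgue measure with that of R^(n-1). *)
Section lebesgue_tuple.
Context (R : realType).

Section cons_step.
Variables (n : nat)
  (mu : {sigma_finite_measure set (n.-tuple (measurableTypeR R)) -> \bar R}).

Definition tuple_cons (z : measurableTypeR R * n.-tuple (measurableTypeR R)) :
    n.+1.-tuple (measurableTypeR R) :=
  [tuple of z.1 :: z.2].

Lemma measurable_tuple_cons : measurable_fun setT tuple_cons.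
Proof. by apply: measurable_cons. Qed.

Definition lebesgue_cons :
    set (n.+1.-tuple (measurableTypeR R)) -> \bar R :=
  pushforward (@lebesgue_measure R \x mu)%E tuple_cons.

Let lebesgue_cons0 : lebesgue_cons set0 = 0%E.
Proof. by rewrite /lebesgue_cons /pushforward preimage_set0 measure0. Qed.

Let lebesgue_cons_ge0 A : (0 <= lebesgue_cons A)%E.
Proof. by rewrite /lebesgue_cons /pushforward measure_ge0. Qed.

Let lebesgue_cons_sigma_additive : semi_sigma_additive lebesgue_cons.
Proof.
have mf := measurable_tuple_cons.
move=> F mF tF mUF; rewrite /lebesgue_cons /pushforward preimage_bigcup.
apply: measure_semi_sigma_additive.
- by move=> i; rewrite -[X in measurable X]setTI; exact: mf.
- apply/trivIsetP => /= i j _ _ ij; rewrite -preimage_setI.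
  by move/trivIsetP : tF => /(_ _ _ _ _ ij) ->//; rewrite preimage_set0.
- by rewrite -preimage_bigcup -[X in measurable X]setTI; exact: mf.
Qed.

HB.instance Definition _ := isMeasure.Build _ _ _ lebesgue_cons
  lebesgue_cons0 lebesgue_cons_ge0 lebesgue_cons_sigma_additive.

Let lebesgue_cons_sigma_finite : sigma_finite setT lebesgue_cons.
Proof.
have /sigma_finiteP[F [FT ndF Foo]] := sigma_finiteT (@lebesgue_measure R).
have /sigma_finiteP[G [GT ndG Goo]] := sigma_finiteT mu.
pose g (t : n.+1.-tuple (measurableTypeR R)) :
  measurableTypeR R * n.-tuple (measurableTypeR R) :=
  (thead t, [tuple of behead t]).
have mg : measurable_fun setT g.
  apply: measurable_fun_pair; first exact: (measurable_tnth ord0).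
  exact: measurable_behead.
have gK : cancel tuple_cons g.
  by move=> [x t]; congr pair; exact: val_inj.
exists (fun i => g @^-1` (F i `*` G i)) => [|i].
  apply/esym; rewrite -subTset => t _.
  have [j _ Fj] : (\bigcup_i F i) (g t).1 by rewrite -FT.
  have [k _ Gk] : (\bigcup_i G i) (g t).2 by rewrite -GT.
  exists (maxn j k) => //; split.
    by move: Fj; exact/subsetPset/ndF/leq_maxl.
  by move: Gk; exact/subsetPset/ndG/leq_maxr.
have [mF Fioo] := Foo i; have [mG Gioo] := Goo i; split.
  by rewrite -[X in measurable X]setTI; apply: mg => //; exact: measurableX.
rewrite /lebesgue_cons /pushforward.
have -> : tuple_cons @^-1` (g @^-1` (F i `*` G i)) = F i `*` G i.
  by rewrite -comp_preimage (_ : g \o _ = id) //; apply/funext => z; exact: gK.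
by rewrite product_measure1E// lte_mul_pinfty// ge0_fin_numE.
Qed.

HB.instance Definition _ := Measure_isSigmaFinite.Build _ _ _ lebesgue_cons
  lebesgue_cons_sigma_finite.

End cons_step.

Fixpoint lebesgue_tuple (n : nat) :
    {sigma_finite_measure set (n.-tuple (measurableTypeR R)) -> \bar R} :=
  match n with
  | 0 => dirac [tuple]
  | n'.+1 => lebesgue_cons (lebesgue_tuple n')
  end.

End lebesgue_tuple.

Fixpoint Ck (R : realType) (V W : normedModType R) (k : nat) (U : set V)
    (f : V -> W) : Prop :=
  match k with
  | 0 => forall x, U x -> {for x, continuous f}
  | k'.+1 => (forall x, U x -> differentiable f x) /\
             (forall v, Ck k' U (fun x => 'D_v f x))
  end.

Definition smooth_on (R : realType) (V W : normedModType R) (U : set V)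
    (f : V -> W) : Prop := forall k, Ck k U f.

Section sphere.
Context (R : realType) (m : nat).

Local Notation E := 'rV[R]_m.+1.

(* The library's norm `|x| on row vectors is the sup norm. *)
Definition dot (u v : E) : R := \sum_i u 0 i * v 0 i.

Definition enorm (u : E) : R := Num.sqrt (dot u u).

Definition sphere : set E := [set x | dot x x = 1].

Definition radial (x : E) : E := (enorm x)^-1 *: x.

(* Maps defined on the sphere are represented by functions on E whose values
   off the sphere are never used: they are always replaced by their degree 0
   homogeneous extension, which is smooth off the origin iff the map is smooth
   on the sphere.  Hence, for x on the sphere and v tangent at x,
   'D_v (hext f) x is the differential of f at x applied to v, and
   'D_x (hext f) x = 0. *)
Definition hext (F : Type) (f : E -> F) : E -> F := f \o radial.

Definition smooth_on_sphere (f : E -> E) : Prop :=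
  smooth_on [set x | x != 0] (hext f).

Definition smooth_self_map (phi : E -> E) : Prop :=
  smooth_on_sphere phi /\ forall x, sphere x -> sphere (phi x).

(* Integral for the Riemannian volume of the round metric: the area of a Borel
   subset A of the sphere is m + 1 times the Lebesgue measure of the cone
   { r x | x in A, 0 < r <= 1 }. *)
Definition sphere_int (f : E -> R) : R :=
  m.+1%:R * \int[lebesgue_tuple R m.+1]_(t in
    [set t : m.+1.-tuple (measurableTypeR R) | \sum_i tnth t i ^+ 2 <= 1])
      hext f (\row_i tnth t i).

(* Hilbert-Schmidt norm of the differential of phi at x in the sphere.  Summing
   over the standard basis of E gives the same value as summing over an
   orthonormal basis of the tangent space, since 'D_x (hext phi) x = 0. *)
Definition diff_norm (phi : E -> E) (x : E) : R :=
  Num.sqrt (\sum_(i < m.+1) dot ('D_(delta_mx 0 i) (hext phi) x)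
                                ('D_(delta_mx 0 i) (hext phi) x)).

Definition p_energy (p : nat) (phi : E -> E) : R :=
  p%:R^-1 * sphere_int (fun x => diff_norm phi x ^+ p).

Definition smooth_variation (T : normedModType R) (phi : E -> E)
    (Phi : T -> E -> E) : Prop :=
  exists e : R, [/\ 0 < e,
    smooth_on [set u : T * E | `|u.1| < e /\ u.2 != 0]
      (fun u => hext (Phi u.1) u.2),
    forall t x, `|t| < e -> sphere x -> sphere (Phi t x) &
    forall x, sphere x -> Phi 0 x = phi x].

Definition p_harmonic (p : nat) (phi : E -> E) : Prop :=
  smooth_self_map phi /\
  forall Phi : R^o -> E -> E, smooth_variation phi Phi ->
    is_derive (0 : R^o) (1 : R^o) (fun t => p_energy p (Phi t) : R^o) 0.

(* Smooth sections of the pull-back by phi of the tangent bundle. *)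
Definition field_along (phi V : E -> E) : Prop :=
  smooth_on_sphere V /\ forall x, sphere x -> dot (phi x) (V x) = 0.

(* Z is the image of V under the Jacobi operator of the p-harmonic map phi,
   that is the operator J with
   d^2/dsdt E_p(Phi_(s,t)) at (0,0) = \int <J V, W> for every two-parameter
   variation of phi with d/ds Phi = V and d/dt Phi = W at (0,0). *)
Definition jacobi (p : nat) (phi V Z : E -> E) : Prop :=
  [/\ field_along phi V, field_along phi Z &
   forall (W : E -> E) (Phi : (R^o * R^o)%type -> E -> E),
     field_along phi W -> smooth_variation phi Phi ->
     (forall x, sphere x ->
        'D_(1 : R^o) (fun s : R^o => Phi (s, 0) x) 0 = V x /\
        'D_(1 : R^o) (fun t : R^o => Phi (0, t) x) 0 = W x) ->
     'D_(1 : R^o) (fun s : R^o =>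
        'D_(1 : R^o) (fun t : R^o => p_energy p (Phi (s, t)) : R^o) 0) 0
     = sphere_int (fun x => dot (Z x) (W x))].

Definition jacobi_eigenfield (p : nat) (phi : E -> E) (lambda : R)
    (V : E -> E) : Prop :=
  (exists x, sphere x /\ V x != 0) /\
  jacobi p phi V (fun x => lambda *: V x).

(* "Only positive eigenvalues" cannot be meant in the strict sense for a map
   into the sphere: the isometries of the target preserve the energy, so each
   nonzero X \o phi with X a Killing field is an eigenfield for 0. *)
Definition stable (p : nat) (phi : E -> E) : Prop :=
  forall (lambda : R) (V : E -> E),
    jacobi_eigenfield p phi lambda V -> 0 <= lambda.

(* The Lie derivative of the round metric along V vanishes. *)
Definition killing (V : E -> E) : Prop :=
  field_along id V /\
  forall x u w, sphere x -> dot x u = 0 -> dot x w = 0 ->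
    dot ('D_u (hext V) x) w + dot ('D_w (hext V) x) u = 0.

End sphere.

(* Main.v *)
Require Import Defs.
From HB Require Import structures.
From mathcomp Require Import all_boot all_order all_algebra.
From mathcomp Require Import all_classical all_reals all_analysis.
From mathcomp Require Import measurable_realfun ring lra.

(* For the identity, |d id|^2 = m, and along the variation of a tangent field V
   the second derivative of the p-energy at 0 is, up to a positive factor, the
   integral of (p - 2)/m (div V)^2 + |DV|^2 - m |V|^2, where D and div are taken
   in the ambient space for the degree 0 homogeneous extension of V.  Yano's
   formula says that tr (DV)^2 - (div V)^2 + (m - 1) |V|^2 has integral 0; adding
   it turns the integrand into 1/2 |T|^2 + (p/m - 1) (div V)^2, with T the
   conformal Killing operator of V (the Lie derivative of the metric minus its
   trace part).  For p > m this is nonnegative, and it vanishes only if T and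
   div V do, that is for Killing fields.  The eigenvalue equation is tested
   against V itself on the two-parameter variation phi_(s+t), where phi_r(x) is
   the normalization of x + r V(x).

   Integrals over the sphere are integrals over the ball of homogeneous
   functions, and the divergence theorem comes from rotation invariance alone:
   differentiating it along the rotations in the plane of the coordinates i and
   j shows that x_i D_j g - x_j D_i g has integral 0, and one takes g = x_i A_j
   and sums over i and j.  Rotations preserve Lebesgue measure because they are
   products of three shears. *)

Set Implicit Arguments.
Unset Strict Implicit.
Unset Printing Implicit Defensive.
Import Order.TTheory GRing.Theory Num.Theory.
Import numFieldNormedType.Exports.
Local Open Scope classical_set_scope.
Local Open Scope ring_scope.

(** * Differential calculus *)

Section differentiation.
Context {R : realType}.
Implicit Types V W : normedModType R.

(** No chart, connection or curvature tensor occurs: curvature comes out of the normal components of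
    ambient derivatives. A variation has an acceleration z besides its velocity V. Differentiating
    |phi_t|^2 = 1 twice gives <x, z> = - |V|^2, and the divergence theorem trades div z for m <x,
    z>; this is the origin of the term - m |V|^2. Since the ambient |DV|^2 exceeds the intrinsic one
    by |V|^2, what results is the Ricci term - (m - 1) |V|^2 of the classical formula. The
    coefficient (p - 2)/m of (div V)^2 appears when the power p/2 of the energy density is
    differentiated twice at its value m. The obstacle is that the p-th power of a norm need not be
    smooth where the differential vanishes. For the identity the density is the constant m > 0, and
    compactness of the sphere keeps it positive for all small times at once; only then can the
    energy be differentiated twice under the integral. Exchanging time and space derivatives there,
    and the second derivatives in Yano's formula, is what Schwarz's theorem is for. *)

Lemma derive_comp_linear V V' W (L : {linear V -> V'}) (f : V' -> W) x v :
  'D_v (f \o L) x = 'D_(L v) f (L x).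
Proof.
suff E : (fun h => h^-1 *: (((f \o L) \o shift x) (h *: v) - (f \o L) x)) =
    (fun h => h^-1 *: ((f \o shift (L x)) (h *: L v) - f (L x))) :> (R -> W).
  by rewrite /derive E.
by apply/funext => h /=; rewrite linearP.
Qed.

Lemma near_eq_open V (T : Type) (U : set V) (f g : V -> T) x :
  open U -> U x -> (forall y, U y -> f y = g y) -> \forall y \near x, f y = g y.
Proof.
move=> oU Ux fg; have : nbhs x U by exact: open_nbhs_nbhs.
by apply: filterS => y; exact: fg.
Qed.

Lemma derive_eq_open V W (U : set V) (f g : V -> W) x v :
  open U -> U x -> (forall y, U y -> f y = g y) -> 'D_v f x = 'D_v g x.
Proof. by move=> oU Ux fg; exact: (near_eq_derive v (near_eq_open oU Ux fg)). Qed.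

(** This transfers differentiability between functions that agree near a point: their difference
    vanishes there, so it has the null map as differential, with an error that is eventually 0. *)
Lemma differentiable_near0 V W (h : V -> W) x :
  (\forall y \near x, h y = 0) -> differentiable h x.
Proof.
move=> h0; have hx : h x = 0 := nbhs_singleton h0.
have H : h \o shift x = cst (h x) + (\0 : V -> W) +o_ 0 id.
  apply/eqaddoP => e e0.
  have : \forall y \near (0 : V), h (y + x) = 0.
    by rewrite (near_shift x) sub0r; near=> y; rewrite /= subrK; near: y.
  apply: filterS => y hy.
  by rewrite !fctE /= hy hx addr0 subrr normr0 mulr_ge0// ltW.
apply/diff_locallyP; have cz : continuous (\0 : V -> W) by move=> ?; exact: cvg_cst.
by rewrite (diff_unique (df := [the {linear V -> W} of \0]) cz H).
Unshelve. all: by end_near. Qed.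

Lemma differentiable_eq_open V W (U : set V) (f g : V -> W) x :
  open U -> U x -> (forall y, U y -> f y = g y) ->
  differentiable f x -> differentiable g x.
Proof.
move=> oU Ux fg df; rewrite (_ : g = f + (g - f)); last by rewrite addrC subrK.
apply: differentiableD => //; apply: differentiable_near0.
apply: (@near_eq_open _ _ _ (g - f) (cst 0) x oU Ux) => y Uy.
by rewrite !fctE fg// subrr.
Qed.

Lemma derive_linear_comp V W W' (L : {linear W -> W'}) (f : V -> W) x v :
  continuous L -> differentiable f x -> 'D_v (L \o f) x = L ('D_v f x).
Proof.
move=> cL df; have dL := linear_differentiable (f x) cL.
rewrite !deriveE//; last exact: differentiable_comp.
by rewrite diff_comp// diff_lin.
Qed.

(** [Ck] differentiates functions defined on the whole space, while the product and chain rules give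
    equalities on U only. As U is open, derivatives at its points do not see the difference; the
    inductive closure properties below rest on this. *)
Lemma Ck_eq V W k (U : set V) (f g : V -> W) :
  open U -> (forall y, U y -> f y = g y) -> Ck k U f -> Ck k U g.
Proof.
move=> oU; elim: k f g => [|k IH] f g fg /=.
  move=> cf x Ux; rewrite /prop_for /continuous_at -fg//.
  by apply: cvg_trans (cf x Ux); apply: near_eq_cvg; exact: near_eq_open fg.
move=> [df Df]; split=> [x Ux|v].
  exact: differentiable_eq_open fg (df x Ux).
by apply: IH (Df v) => x Ux; exact: derive_eq_open fg.
Qed.

Lemma Ck_pred V W k (U : set V) (f : V -> W) : Ck k.+1 U f -> Ck k U f.
Proof.
elim: k f => [|k IH] f /= [df Df].
  by move=> x Ux; apply: differentiable_continuous; exact: df.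
by split=> // v; apply: IH; exact: Df.
Qed.

Lemma Ck_continuous V W k (U : set V) (f : V -> W) :
  Ck k U f -> forall x, U x -> {for x, continuous f}.
Proof. by elim: k f => [//|k IH] f /Ck_pred; exact: IH. Qed.

Lemma Ck_sub V W k (U U' : set V) (f : V -> W) :
  U' `<=` U -> Ck k U f -> Ck k U' f.
Proof.
move=> UU; elim: k f => [|k IH] f /=; first by move=> cf x /UU; exact: cf.
by move=> [df Df]; split=> [x /UU|v]; [exact: df|exact: IH].
Qed.

Lemma Ck_cst V W k (U : set V) (c : W) : Ck k U (fun=> c).
Proof.
elim: k c => [|k IH] c /=; first by move=> x _; exact: cvg_cst.
split=> [x _|v]; first exact: differentiable_cst.
suff -> : (fun x : V => 'D_v (fun=> c : W) x) = (fun=> 0) by exact: IH.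
by apply/funext => x; rewrite derive_cst.
Qed.

Lemma CkD V W k (U : set V) (f g : V -> W) : open U ->
  Ck k U f -> Ck k U g -> Ck k U (fun x => f x + g x).
Proof.
move=> oU; elim: k f g => [|k IH] f g /=.
  by move=> cf cg x Ux; apply: continuousD; [exact: cf|exact: cg].
move=> [df Df] [dg Dg]; split=> [x Ux|v].
  by apply: differentiableD; [exact: df|exact: dg].
apply: (@Ck_eq _ _ _ _ (fun x => 'D_v f x + 'D_v g x)) => //; last by apply: IH.
by move=> x Ux; rewrite deriveD//; apply: diff_derivable; [exact: df|exact: dg].
Qed.

Lemma Ck_linear V W W' k (U : set V) (L : {linear W -> W'}) (f : V -> W) :
  open U -> continuous L -> Ck k U f -> Ck k U (fun x => L (f x)).
Proof.
move=> oU cL; elim: k f => [|k IH] f /=.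
  by move=> cf x Ux; apply: continuous_comp; [exact: cf|exact: cL].
move=> [df Df]; split=> [x Ux|v].
  apply: (@differentiable_comp _ _ _ _ f L); first exact: df.
  exact: linear_differentiable.
apply: (@Ck_eq _ _ _ _ (fun x => L ('D_v f x))) => //; last by apply: IH.
by move=> x Ux; rewrite (derive_linear_comp _ cL)//; exact: df.
Qed.

Lemma Ck_comp_linear V V' W k (U : set V') (L : {linear V -> V'}) (f : V' -> W) :
  continuous L -> Ck k U f -> Ck k (L @^-1` U) (fun x => f (L x)).
Proof.
move=> cL; elim: k f => [|k IH] f /=.
  by move=> cf x Ux; apply: continuous_comp; [exact: cL|exact: cf].
move=> [df Df]; split=> [x Ux|v].
  apply: (@differentiable_comp _ _ _ _ L f); first exact: linear_differentiable.
  exact: df.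
suff -> : (fun x => 'D_v (fun x => f (L x)) x) = (fun x => 'D_(L v) f (L x)).
  exact: IH (Df _).
by apply/funext => x; rewrite -derive_comp_linear.
Qed.

Lemma deriveMx V (f g : V -> R^o) x v : differentiable f x -> differentiable g x ->
  'D_v (fun y => f y * g y : R^o) x = f x * 'D_v g x + g x * 'D_v f x.
Proof.
by move=> df dg; rewrite deriveM//; apply: diff_derivable.
Qed.

Lemma CkM V k (U : set V) (f g : V -> R^o) : open U ->
  Ck k U f -> Ck k U g -> Ck k U (fun x => f x * g x : R^o).
Proof.
move=> oU; elim: k f g => [|k IH] f g /=.
  by move=> cf cg x Ux; apply: continuousM; [exact: cf|exact: cg].
move=> [df Df] [dg Dg]; split=> [x Ux|v].
  by apply: (@differentiableM _ _ f g); [exact: df|exact: dg].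
apply: (@Ck_eq _ _ _ _ (fun x => f x * 'D_v g x + g x * 'D_v f x : R^o)) => //.
  by move=> x Ux; rewrite deriveMx//; [exact: df|exact: dg].
by apply: CkD => //; apply: IH => //; apply: Ck_pred.
Qed.

Lemma Ck_sum V W k (U : set V) n (f : 'I_n -> V -> W) : open U ->
  (forall i, Ck k U (f i)) -> Ck k U (fun x => \sum_(i < n) f i x).
Proof.
move=> oU; elim: n f => [|n IH] f cf.
  by under eq_fun do rewrite big_ord0; exact: Ck_cst.
under eq_fun do rewrite big_ord_recr/=.
by apply: CkD => //; apply: IH.
Qed.

Lemma is_diff_rsqrt (a : R) : 0 < a ->
  is_derive (a : R^o) (1 : R^o) (fun x : R^o => (Num.sqrt x)^-1 : R^o)
    (- 2^-1 * (Num.sqrt a)^-1 ^+ 3).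
Proof.
move=> a0; have s0 : Num.sqrt a != 0 by rewrite gt_eqF// sqrtr_gt0.
have h := is_derive1_sqrt a0.
apply: is_derive_eq (is_deriveV s0 h) _.
by rewrite /GRing.scale/=; field.
Qed.

Lemma differentiable_rsqrt V (q : V -> R^o) x : 0 < q x -> differentiable q x ->
  differentiable (fun y => (Num.sqrt (q y))^-1 : R^o) x.
Proof.
move=> q0 dq; have [h _] := is_diff_rsqrt q0.
apply: (@differentiable_comp _ _ _ _ q (fun x : R^o => (Num.sqrt x)^-1 : R^o)) => //.
exact/derivable1_diffP.
Qed.

Lemma derive_comp1 V (q : V -> R^o) (f : R^o -> R^o) df x v :
  differentiable q x -> is_derive (q x) (1 : R^o) f df ->
  'D_v (fun y => f (q y)) x = df * 'D_v q x.
Proof.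
move=> dq [dF <-]; have dF' : differentiable f (q x) by exact/derivable1_diffP.
rewrite !deriveE//; last exact: (@differentiable_comp _ _ _ _ q f).
rewrite (@diff_comp _ _ _ _ q f)//=.
by rewrite -[X in 'd f _ X = _]mulr1 [LHS]linearZ mulrC.
Qed.

Lemma derive_rsqrt V (q : V -> R^o) x v : 0 < q x -> differentiable q x ->
  'D_v (fun y => (Num.sqrt (q y))^-1 : R^o) x =
  - 2^-1 * (Num.sqrt (q x))^-1 ^+ 3 * 'D_v q x.
Proof. by move=> q0 dq; apply: (@derive_comp1 _ q (fun x : R^o => (Num.sqrt x)^-1 : R^o)) => //; exact: is_diff_rsqrt. Qed.

(** The reciprocal square root r is the convenient primitive operation, because its derivative - 1/2
    r^3 q' is a polynomial in r and q', so the induction on k closes. Inverse and square root are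
    then r^2 and q r. *)
Lemma Ck_rsqrt V k (U : set V) (q : V -> R^o) : open U -> (forall x, U x -> 0 < q x) ->
  Ck k U q -> Ck k U (fun x => (Num.sqrt (q x))^-1 : R^o).
Proof.
move=> oU q0; elim: k => [|k IH] /=.
  move=> cq x Ux; have [h _] := is_diff_rsqrt (q0 _ Ux).
  apply: (@continuous_comp _ _ _ q (fun x : R^o => (Num.sqrt x)^-1 : R^o)).
    exact: cq.
  exact/differentiable_continuous/derivable1_diffP.
move=> [dq Dq]; split=> [x Ux|v].
  by apply: (@differentiable_rsqrt _ q); [exact: q0|exact: dq].
pose r x := (Num.sqrt (q x))^-1 : R^o.
apply: (@Ck_eq _ _ _ _ (fun x => - 2^-1 * (r x * (r x * r x)) * 'D_v q x : R^o)) => //.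
  move=> x Ux; rewrite (derive_rsqrt _ (q0 _ Ux) (dq _ Ux)).
  by rewrite !exprS expr0 mulr1.
have cr : Ck k U r by apply: IH; apply: Ck_pred.
by do 2! apply: CkM => //; [exact: Ck_cst|do 2! apply: CkM => //].
Qed.

Lemma is_derive_line V W (h : V -> W) y u (t : R) : differentiable h (y + t *: u) ->
  is_derive (t : R^o) (1 : R^o) (fun r : R^o => h (y + r *: u)) ('D_u h (y + t *: u)).
Proof.
move=> dh.
have E : (fun k : R^o => k^-1 *: (((fun r : R^o => h (y + r *: u)) \o shift (t : R^o)) (k *: (1 : R^o))
      - h (y + t *: u))) =
    (fun k : R => k^-1 *: ((h \o shift (y + t *: u)) (k *: u) - h (y + t *: u))).
  apply/funext => k /=; congr (_ *: (h _ - _)).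
  by rewrite -[k *: (1 : R^o)]/(k * 1) mulr1 scalerDl addrCA.
apply: DeriveDef; last by rewrite /derive E.
by rewrite /derivable E; exact: diff_derivable.
Qed.

Lemma MVT_line V (h : V -> R^o) y u (s : R) : 0 < s ->
  (forall t : R, 0 <= t <= s -> differentiable h (y + t *: u)) ->
  exists2 t : R, 0 < t < s & h (y + s *: u) - h y = s * 'D_u h (y + t *: u).
Proof.
move=> s0 dh.
have dl (t : R) : t \in `[0, s] ->
    is_derive (t : R^o) (1 : R^o) (fun r : R^o => h (y + r *: u)) ('D_u h (y + t *: u)).
  by rewrite in_itv/= => /dh; exact: is_derive_line.
pose g : R -> R := fun r => h (y + r *: u).
pose dg : R -> R := fun t => 'D_u h (y + t *: u).
have dgP (t : R) : t \in `[0, s] -> is_derive t (1 : R) g (dg t) by exact: dl.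
have dgo (t : R) : t \in `]0, s[ -> is_derive t (1 : R) g (dg t).
  by move=> /subset_itv_oo_cc; exact: dgP.
have cg : {within `[0, s], continuous g}.
  by apply: derivable_within_continuous => t /dgP[].
have [t t0s] := MVT s0 dgo cg.
rewrite /g /dg subr0 scale0r addr0 mulrC => ->.
by exists t => //; move: t0s; rewrite in_itv.
Qed.

(** The mean value theorem is applied twice: in the direction v to g(y) = f(y + s w) - f(y), then in
    the direction w to the derivative of f along v. *)
Lemma second_difference V (U : set V) (f : V -> R^o) x (v w : V) (s : R) :
  open U -> 0 < s ->
  (forall a b : R, 0 <= a <= s -> 0 <= b <= s -> U (x + a *: v + b *: w)) ->
  Ck 2 U f ->
  exists a b : R, [/\ 0 < a < s, 0 < b < s &
    f (x + s *: v + s *: w) - f (x + s *: v) - f (x + s *: w) + f x =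
    s ^+ 2 * 'D_w ('D_v f) (x + a *: v + b *: w)].
Proof.
move=> oU s0 sU [df Df].
have ss : 0 <= s <= s by apply/andP; split => //; exact: ltW.
have s00 : (0 <= 0 :> R) && (0 <= s) by rewrite lexx ltW.
pose g y := f (y + s *: w) - f y.
have dshift (y : V) : differentiable f (y + s *: w) ->
    differentiable (fun z => f (z + s *: w)) y.
  move=> dfy; have d1 : differentiable (id + cst (s *: w) : V -> V) y.
    by apply: differentiableD; [exact: ex_diff|exact: differentiable_cst].
  exact: (@differentiable_comp _ _ _ _ (id + cst (s *: w) : V -> V) f).
have U1 a : 0 <= a <= s -> U (x + a *: v).
  by move=> /sU /(_ s00); rewrite scale0r addr0.
have [t ts|a as_ Ea] := @MVT_line V g x v s s0.
  apply: differentiableB; first by apply: dshift; apply: df; exact: sU.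
  by apply: df; exact: U1.
have as' : 0 <= a <= s by case/andP: as_ => ? ?; rewrite !ltW.
have Dg : 'D_v g (x + a *: v) =
    'D_v f (x + a *: v + s *: w) - 'D_v f (x + a *: v).
  have d1 : derivable (fun y => f (y + s *: w)) (x + a *: v) v.
    by apply: diff_derivable; apply: dshift; apply: df; exact: sU.
  have d2 : derivable f (x + a *: v) v.
    by apply: diff_derivable; apply: df; exact: U1.
  rewrite (deriveB d1 d2).
  congr (_ - _).
  suff E : (fun h : R => h^-1 *: (((fun y => f (y + s *: w)) \o shift (x + a *: v)) (h *: v) -
      f (x + a *: v + s *: w))) =
    (fun h => h^-1 *: ((f \o shift (x + a *: v + s *: w)) (h *: v) -
      f (x + a *: v + s *: w))) by rewrite /derive E.
  by apply/funext => h /=; rewrite -!addrA.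
have [t ts|b bs Eb] := @MVT_line V ('D_v f) (x + a *: v) w s s0.
  by have [d _] := Df v; apply: d; exact: sU.
exists a, b; split => //.
rewrite expr2 -mulrA -Eb -Dg -Ea /g.
by rewrite opprB addrA [in RHS]addrAC.
Qed.

Lemma eq_of_close W (a b : W) :
  (forall e : R, 0 < e -> exists2 c, `|a - c| < e & `|b - c| < e) -> a = b.
Proof.
move=> ab; apply/eqP; rewrite -subr_eq0 -normr_le0; apply/ler_addgt0Pl => e e0.
rewrite addr0; have [c ac bc] := ab _ (divr_gt0 e0 (ltr0Sn R 1)).
rewrite -[_ - _](subrKA c) (splitr e).
apply: le_trans (ler_normD _ _) _; apply: lerD; first exact: ltW.
by rewrite distrC ltW.
Qed.

(* Schwarz's theorem: both mixed derivatives are limits of the second difference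
   of f on the parallelogram spanned by s v and s w, divided by s^2. *)
Lemma derive_swap V (U : set V) (f : V -> R^o) x (v w : V) : open U -> U x ->
  Ck 2 U f -> 'D_w ('D_v f) x = 'D_v ('D_w f) x.
Proof.
move=> oU Ux Cf.
have [_ Df] := Cf; have [_ /(_ w) cvw] := Df v; have [_ /(_ v) cwv] := Df w.
apply: (@eq_of_close R^o) => e e2.
have := cvw x Ux; move=> /cvgrPdist_lt/(_ _ e2) n1.
have := cwv x Ux; move=> /cvgrPdist_lt/(_ _ e2) n2.
have n3 : \forall y \near x, U y by apply: open_nbhs_nbhs.
have [r /= r0 Hr] := (nbhs_ballP x _).1 (filterI n3 (filterI n1 n2)).
(* With this s the parallelogram stays within distance r/2 of x; the summand 1 keeps the denominator
   positive when v and w are both 0. *)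
pose s := r / 2 / (`|v| + `|w| + 1).
have D0 : 0 < `|v| + `|w| + 1 by rewrite ltr_pwDr// addr_ge0.
have s0 : 0 < s by rewrite !divr_gt0.
have inb a b : 0 <= a <= s -> 0 <= b <= s -> ball x r (x + a *: v + b *: w).
  move=> /andP[a0 as_] /andP[b0 bs]; rewrite -ball_normE /=.
  rewrite -addrA opprD addNKr normrN.
  apply: le_lt_trans (ler_normD _ _) _; rewrite !normrZ !ger0_norm//.
  apply: (@le_lt_trans _ _ (s * (`|v| + `|w| + 1))).
    rewrite !mulrDr mulr1; apply: ler_wpDr; first exact: ltW.
    by apply: lerD; apply: ler_wpM2r.
  by rewrite /s divfK ?gt_eqF// ltr_pdivrMr// ltr_pMr// ltr1n.
have inb' a b : 0 < a < s -> 0 < b < s -> ball x r (x + a *: v + b *: w).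
  by move=> /andP[? ?] /andP[? ?]; apply: inb; rewrite !ltW.
have [a [b [as_ bs E1]]] : exists a b : R, [/\ 0 < a < s, 0 < b < s &
    f (x + s *: v + s *: w) - f (x + s *: v) - f (x + s *: w) + f x =
    s ^+ 2 * 'D_w ('D_v f) (x + a *: v + b *: w)].
  apply: second_difference Cf => // a b as_ bs.
  by have [] := Hr _ (inb _ _ as_ bs).
have [b' [a' [bs' as' E2]]] : exists a b : R, [/\ 0 < a < s, 0 < b < s &
    f (x + s *: w + s *: v) - f (x + s *: w) - f (x + s *: v) + f x =
    s ^+ 2 * 'D_v ('D_w f) (x + a *: w + b *: v)].
  apply: second_difference Cf => // a2 b2 as2 bs2.
  by rewrite addrAC; have [] := Hr _ (inb _ _ bs2 as2).
(* The second difference is symmetric in v and w, so the two mixed derivatives share a value, taken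
   at two points of the ball. It is the common approximant that [eq_of_close] asks for. *)
have E : 'D_w ('D_v f) (x + a *: v + b *: w) = 'D_v ('D_w f) (x + b' *: w + a' *: v).
  apply: (@mulfI _ (s ^+ 2)); first by rewrite expf_neq0// gt_eqF.
  apply: etrans (esym E1) _; apply: etrans E2.
  by rewrite [x + s *: w + s *: v]addrAC [f _ - _ - _]addrAC.
have [_ [H1 _]] := Hr _ (inb' _ _ as_ bs).
have [_ [_]] := Hr _ (inb' _ _ as' bs').
rewrite [x + _ + _]addrAC -E => H2.
set C := (C in 'D_w ('D_v f) x - C) in H1; exists C; [exact: H1|exact: H2].
Qed.
End differentiation.

Section row_vectors.
Context {R : realType} {n : nat}.
Implicit Types V W : normedModType R.

Let coord_linear (j : 'I_n) : linear (fun x : 'rV[R]_n => x 0 j : R^o).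
Proof. by move=> a u v; rewrite !mxE. Qed.

Definition coord_fun (j : 'I_n) (x : 'rV[R]_n) : R^o := x 0 j.

HB.instance Definition _ j :=
  GRing.isLinear.Build R 'rV[R]_n R^o _ (coord_fun j) (coord_linear j).

Lemma coord_fun_continuous j : continuous (coord_fun j).
Proof. exact: coord_continuous. Qed.

Let scalel_linear W (u : W) : linear (fun c : R^o => c *: u : W).
Proof. by move=> a b c; rewrite scalerDl -scalerA. Qed.

Definition scalel_fun W (u : W) (c : R^o) : W := c *: u.

HB.instance Definition _ W (u : W) :=
  GRing.isLinear.Build R R^o W _ (scalel_fun u) (scalel_linear u).

Lemma scalel_fun_continuous W (u : W) : continuous (scalel_fun u).
Proof. exact: scalel_continuous. Qed.

Lemma derive_coord V (f : V -> 'rV[R]_n) x v j : differentiable f x ->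
  'D_v (fun y => f y 0 j : R^o) x = 'D_v f x 0 j.
Proof.
move=> df.
exact: (@derive_linear_comp R V _ _ (coord_fun j) f x v (@coord_fun_continuous j) df).
Qed.

Lemma Ck_coord V k (U : set V) (f : V -> 'rV[R]_n) j :
  open U -> Ck k U f -> Ck k U (fun x => f x 0 j : R^o).
Proof. by move=> oU; exact: (@Ck_linear R V _ _ k U (coord_fun j) f oU (@coord_fun_continuous j)). Qed.

Lemma Ck_scalel V W k (U : set V) (f : V -> R^o) (u : W) :
  open U -> Ck k U f -> Ck k U (fun x => f x *: u).
Proof. by move=> oU; exact: (@Ck_linear R V _ _ k U (scalel_fun u) f oU (@scalel_fun_continuous _ u)). Qed.

Lemma derive_sum_delta W (f : 'rV[R]_n -> W) x v : differentiable f x ->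
  'D_v f x = \sum_j v 0 j *: 'D_(delta_mx 0 j) f x.
Proof.
move=> df; rewrite deriveE// {1}(row_sum_delta v) linear_sum.
by apply: eq_bigr => j _; rewrite linearZ deriveE.
Qed.

End row_vectors.

(** * Calculus of real-valued functions *)

Section scalar_functions.
Context {R : realType}.
Implicit Types V W : normedModType R.

(** Functions are kept with values in [R], whereas [Ck] and the directional derivative want the
    normed module [R^o]; [Ckr] and [dird] confine this change of type. *)
Definition Ckr V k (U : set V) (f : V -> R) : Prop := @Ck R V R^o k U f.

Definition dird V (v : V) (f : V -> R) (x : V) : R := 'D_v (f : V -> R^o) x.

Lemma Ckr_eq V k (U : set V) (f g : V -> R) :
  open U -> (forall y, U y -> f y = g y) -> Ckr k U f -> Ckr k U g.
Proof. exact: Ck_eq. Qed.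

Lemma Ckr_pred V k (U : set V) (f : V -> R) : Ckr k.+1 U f -> Ckr k U f.
Proof. exact: Ck_pred. Qed.

Lemma Ckr_sub V k (U U' : set V) (f : V -> R) : U' `<=` U -> Ckr k U f -> Ckr k U' f.
Proof. exact: Ck_sub. Qed.

Lemma Ckr_dird V k (U : set V) (f : V -> R) v : Ckr k.+1 U f -> Ckr k U (dird v f).
Proof. by move=> [_]; apply. Qed.

Lemma Ckr_differentiable V k (U : set V) (f : V -> R) x :
  Ckr k.+1 U f -> U x -> differentiable (f : V -> R^o) x.
Proof. by move=> [df _]; exact: df. Qed.

Lemma Ckr_continuous V k (U : set V) (f : V -> R) x :
  Ckr k U f -> U x -> {for x, continuous (f : V -> R^o)}.
Proof. by move=> cf; exact: (Ck_continuous cf). Qed.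

Lemma Ckr_cst V k (U : set V) (c : R) : Ckr k U (fun=> c).
Proof. exact: Ck_cst. Qed.

Lemma Ckr_add V k (U : set V) (f g : V -> R) : open U ->
  Ckr k U f -> Ckr k U g -> Ckr k U (fun x => f x + g x).
Proof. exact: CkD. Qed.

Lemma Ckr_mul V k (U : set V) (f g : V -> R) : open U ->
  Ckr k U f -> Ckr k U g -> Ckr k U (fun x => f x * g x).
Proof. exact: CkM. Qed.

Lemma Ckr_opp V k (U : set V) (f : V -> R) : open U ->
  Ckr k U f -> Ckr k U (fun x => - f x).
Proof.
move=> oU cf; apply: (Ckr_eq (f := fun x => (-1) * f x)) => //.
  by move=> x _; rewrite mulN1r.
by apply: Ckr_mul => //; exact: Ckr_cst.
Qed.

Lemma Ckr_sqr V k (U : set V) (f : V -> R) : open U ->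
  Ckr k U f -> Ckr k U (fun x => f x ^+ 2).
Proof. by move=> oU cf; exact: (Ckr_mul oU cf cf). Qed.

Lemma Ckr_sum V k (U : set V) n (f : 'I_n -> V -> R) : open U ->
  (forall i, Ckr k U (f i)) -> Ckr k U (fun x => \sum_(i < n) f i x).
Proof. exact: Ck_sum. Qed.

Lemma Ckr_rsqrt V k (U : set V) (q : V -> R) : open U -> (forall x, U x -> 0 < q x) ->
  Ckr k U q -> Ckr k U (fun x => (Num.sqrt (q x))^-1).
Proof. exact: Ck_rsqrt. Qed.

Lemma Ckr_inv V k (U : set V) (q : V -> R) : open U -> (forall x, U x -> 0 < q x) ->
  Ckr k U q -> Ckr k U (fun x => (q x)^-1).
Proof.
move=> oU q0 cq; have cr := Ckr_rsqrt oU q0 cq.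
apply: (Ckr_eq oU _ (Ckr_mul oU cr cr)) => x /q0 qx.
by rewrite -invfM -expr2 sqr_sqrtr// ltW.
Qed.

Lemma Ckr_sqrt V k (U : set V) (q : V -> R) : open U -> (forall x, U x -> 0 < q x) ->
  Ckr k U q -> Ckr k U (fun x => Num.sqrt (q x)).
Proof.
move=> oU q0 cq; apply: (Ckr_eq oU _ (Ckr_mul oU cq (Ckr_rsqrt oU q0 cq))) => x /q0 qx.
rewrite -{1}(sqr_sqrtr (ltW qx)) expr2 -mulrA divff ?mulr1//.
by rewrite gt_eqF// sqrtr_gt0.
Qed.

Lemma Ckr_exp V k (U : set V) (f : V -> R) n : open U ->
  Ckr k U f -> Ckr k U (fun x => f x ^+ n).
Proof.
move=> oU cf; elim: n => [|n IH]; first exact: Ckr_cst.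
by under eq_fun do rewrite exprS; exact: Ckr_mul.
Qed.

Lemma Ckr_coord V k (U : set V) n (f : V -> 'rV[R]_n) j :
  open U -> Ck k U f -> Ckr k U (fun x => f x 0 j).
Proof. exact: Ck_coord. Qed.

Lemma Ck_row V k (U : set V) n (f : V -> 'rV[R]_n) : open U ->
  (forall j, Ckr k U (fun x => f x 0 j)) -> Ck k U f.
Proof.
move=> oU cf.
have -> : f = fun x => \sum_(j < n) f x 0 j *: delta_mx 0 j.
  by apply/funext => x; exact: row_sum_delta.
by apply: Ck_sum => // j; apply: (@Ck_scalel _ V _ k U (fun x => f x 0 j : R^o)) => //; exact: cf.
Qed.

Lemma dird_eq V (U : set V) (f g : V -> R) x v :
  open U -> U x -> (forall y, U y -> f y = g y) -> dird v f x = dird v g x.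
Proof. exact: derive_eq_open. Qed.

Lemma dird_cst V (c : R) (x v : V) : dird v (fun=> c) x = 0.
Proof. exact: derive_cst. Qed.

Lemma dirdD V (U : set V) (f g : V -> R) x v : Ckr 1 U f -> Ckr 1 U g -> U x ->
  dird v (fun y => f y + g y) x = dird v f x + dird v g x.
Proof.
move=> cf cg Ux; apply: deriveD; apply: diff_derivable.
  exact: Ckr_differentiable cf Ux.
exact: Ckr_differentiable cg Ux.
Qed.

Lemma dirdB V (U : set V) (f g : V -> R) x v : Ckr 1 U f -> Ckr 1 U g -> U x ->
  dird v (fun y => f y - g y) x = dird v f x - dird v g x.
Proof.
move=> cf cg Ux; apply: deriveB; apply: diff_derivable.
  exact: Ckr_differentiable cf Ux.
exact: Ckr_differentiable cg Ux.
Qed.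

Lemma dirdM V (U : set V) (f g : V -> R) x v : Ckr 1 U f -> Ckr 1 U g -> U x ->
  dird v (fun y => f y * g y) x = f x * dird v g x + g x * dird v f x.
Proof.
move=> cf cg Ux; apply: deriveMx.
  exact: Ckr_differentiable cf Ux.
exact: Ckr_differentiable cg Ux.
Qed.

Lemma dird_sqr V (U : set V) (f : V -> R) x v : Ckr 1 U f -> U x ->
  dird v (fun y => f y ^+ 2) x = 2 * (f x * dird v f x).
Proof. by move=> cf Ux; rewrite (dirdM v cf cf Ux); ring. Qed.

Lemma dird_sum V (U : set V) n (f : 'I_n -> V -> R) x v : open U ->
  (forall j, Ckr 1 U (f j)) -> U x ->
  dird v (fun y => \sum_j f j y) x = \sum_j dird v (f j) x.
Proof.
move=> oU; elim: n f => [|n IH] f cf Ux.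
  by under eq_fun do rewrite big_ord0; rewrite big_ord0 dird_cst.
under eq_fun do rewrite big_ord_recr /=.
by rewrite (@dirdD _ U)//; [rewrite IH// big_ord_recr|exact: Ckr_sum].
Qed.

Lemma dird_rsqrt V (U : set V) (q : V -> R) x v : Ckr 1 U q -> U x -> 0 < q x ->
  dird v (fun y => (Num.sqrt (q y))^-1) x =
  - 2^-1 * (Num.sqrt (q x))^-1 ^+ 3 * dird v q x.
Proof.
move=> cq Ux q0; apply: derive_rsqrt => //; exact: Ckr_differentiable cq Ux.
Qed.

Lemma dird_swap V (U : set V) (f : V -> R) x (v w : V) : open U -> U x ->
  Ckr 2 U f -> dird w (dird v f) x = dird v (dird w f) x.
Proof. exact: derive_swap. Qed.

Lemma dird_coord V n (f : V -> 'rV[R]_n) x v j : differentiable f x ->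
  dird v (fun y => f y 0 j) x = 'D_v f x 0 j.
Proof. exact: derive_coord. Qed.

Lemma Ck_id V k (U : set V) : Ck k U (id : V -> V).
Proof.
case: k => [|k] /=; first by move=> x _; exact: cvg_id.
split=> [x _|v]; first exact: ex_diff.
suff -> : (fun x : V => 'D_v (id : V -> V) x) = (fun=> v) by exact: Ck_cst.
by apply/funext => x; rewrite derive_id.
Qed.

End scalar_functions.

(** * Lebesgue measure and the sphere *)

Section product_invariance.
Context d1 d2 (T1 : measurableType d1) (T2 : measurableType d2) (R : realType).
Variable m1 : {sigma_finite_measure set T1 -> \bar R}.
Variable m2 : {sigma_finite_measure set T2 -> \bar R}.

Lemma product_measure12 (A : set (T1 * T2)) : measurable A ->
  (m1 \x m2)%E A = (m1 \x^ m2)%E A.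
Proof.
move=> mA; apply: (@product_measure_unique _ _ _ _ _ m1 m2 (m1 \x^ m2)%E _ A mA) => B C mB mC.
exact: product_measure2E.
Qed.

(** Cavalieri's principle: the product measure integrates the measures of the sections, and each
    section is moved by a measure-preserving map. *)
Lemma product_measure_fiber2 (S : T1 -> T2 -> T2) (A : set (T1 * T2)) :
  (forall x B, measurable B -> m2 (S x @^-1` B) = m2 B) -> measurable A ->
  (m1 \x m2)%E ((fun z => (z.1, S z.1 z.2)) @^-1` A) = (m1 \x m2)%E A.
Proof.
move=> mS mA; rewrite /product_measure1; apply: eq_integral => x _ /=.
rewrite -[RHS](mS x); last exact: measurable_xsection.
by congr (m2 _); apply/seteqP; split => y; rewrite /xsection /= !inE.
Qed.

(** The same principle for sections in the other direction, hence the passage to the product measure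
    defined by the other order of integration. *)
Lemma product_measure_fiber1 (S : T2 -> T1 -> T1) (A : set (T1 * T2)) :
  (forall y B, measurable B -> m1 (S y @^-1` B) = m1 B) ->
  measurable_fun setT (fun z : T1 * T2 => (S z.2 z.1, z.2)) -> measurable A ->
  (m1 \x m2)%E ((fun z => (S z.2 z.1, z.2)) @^-1` A) = (m1 \x m2)%E A.
Proof.
move=> mS mf mA; rewrite !product_measure12//; last first.
  by rewrite -[X in measurable X]setTI; exact: mf.
rewrite /product_measure2; apply: eq_integral => y _ /=.
rewrite -[RHS](mS y); last exact: measurable_ysection.
by congr (m1 _); apply/seteqP; split => x; rewrite /ysection /= !inE.
Qed.
End product_invariance.

(** * Shears and boxes for Lebesgue measure on tuples *)

Section lebesgue_tuple_theory.
Context {R : realType}.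
Local Notation mR := (measurableTypeR R).

Lemma lebesgue_measure_translation (c : R) (A : set mR) : measurable A ->
  lebesgue_measure ((fun x : mR => x + c : mR) @^-1` A) = lebesgue_measure A.
Proof.
move=> mA.
have mf : measurable_fun setT (fun x : mR => x + c : mR).
  by apply: measurable_funD => //; exact: measurable_cst.
rewrite -/(pushforward (@lebesgue_measure R) (fun x : mR => x + c : mR) A).
apply/esym/lebesgue_measure_unique => //= _ [[a b]] _ <-; rewrite /pushforward /=.
have -> : (fun x : mR => x + c) @^-1` [set` `]a, b]] = [set` `]a - c, b - c]].
  by apply/seteqP; split => x /=; rewrite !in_itv/= ltrBlDr lerBrDr.
rewrite !lebesgue_measure_itv/= !lte_fin ltrD2r.
by case: ifP => // _; rewrite -!EFinB opprB addrA subrK.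
Qed.

Definition tuple_shift n (k : 'I_n) (c : R) (t : n.-tuple mR) : n.-tuple mR :=
  [tuple tnth t i + c *+ (i == k) | i < n].

Lemma measurable_tuple_shift n (k : 'I_n) (a : n.-tuple mR -> mR) :
  measurable_fun setT a -> measurable_fun setT (fun t => tuple_shift k (a t) t).
Proof.
move=> ma; apply/measurable_fun_tnthP => i.
rewrite (_ : _ \o _ = fun t => tnth t i + a t *+ (i == k)); last first.
  by apply/funext => t /=; rewrite tnth_mktuple.
apply: measurable_funD; first exact: measurable_tnth.
by case: (i == k); [exact: ma|exact: measurable_cst].
Qed.

Lemma tnth_tuple_cons0 n (z : mR * n.-tuple mR) : tnth (tuple_cons z) ord0 = z.1.
Proof. by rewrite tnth0. Qed.

Lemma tnth_tuple_consS n (z : mR * n.-tuple mR) i :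
  tnth (tuple_cons z) (lift ord0 i) = tnth z.2 i.
Proof. by rewrite tnthS. Qed.

Lemma eq_tuple_cons n (t : n.+1.-tuple mR) (z : mR * n.-tuple mR) :
  tnth t ord0 = z.1 -> (forall i, tnth t (lift ord0 i) = tnth z.2 i) ->
  t = tuple_cons z.
Proof.
move=> t0 tS; apply: eq_from_tnth => i; case: (unliftP ord0 i) => [j ->|->].
  by rewrite tS tnth_tuple_consS.
by rewrite t0 tnth_tuple_cons0.
Qed.

(** A shear translates one coordinate by an amount that depends on the others. By induction on n,
    with the first coordinate split off: either k is a later coordinate and the map acts in the
    fibres as a shear of smaller dimension, or k is the first one and the map translates each line
    parallel to that axis. *)
Lemma lebesgue_tuple_shift n (k : 'I_n) (a : n.-tuple mR -> mR) :
  measurable_fun setT a -> (forall c t, a (tuple_shift k c t) = a t) ->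
  forall A, measurable A ->
  lebesgue_tuple R n ((fun t => tuple_shift k (a t) t) @^-1` A) =
  lebesgue_tuple R n A.
Proof.
elim: n k a => [[]//|n IH] k a ma ak A mA.
have mc := @measurable_tuple_cons R n.
have mA' : measurable (@tuple_cons R n @^-1` A).
  by rewrite -[X in measurable X]setTI; exact: mc.
rewrite /= /lebesgue_cons /pushforward.
case: (unliftP ord0 k) => [k' ek|ek].
  pose S x (y : n.-tuple mR) := tuple_shift k' (a (tuple_cons (x, y))) y.
  rewrite -(@product_measure_fiber2 _ _ _ _ _ (@lebesgue_measure R) (lebesgue_tuple R n) S (@tuple_cons R n @^-1` A))//.
    have E z : tuple_shift k (a (tuple_cons z)) (tuple_cons z) =
        tuple_cons (z.1, S z.1 z.2).
      case: z => x y; apply: eq_tuple_cons => [|i];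
        rewrite tnth_mktuple ?tnth_tuple_cons0 ?tnth_tuple_consS ek ?addr0//=.
      by rewrite tnth_mktuple (inj_eq (@lift_inj _ _)).
    by congr (_ _); apply/seteqP; split => z /=; rewrite E.
  move=> x B mB; apply: IH mB.
    exact: measurableT_comp ma (measurableT_comp mc (pair1_measurable x)).
  move=> c y; rewrite -[RHS](ak c); congr a; apply/esym/eq_tuple_cons => [|i];
    rewrite tnth_mktuple ?tnth_tuple_cons0 ?tnth_tuple_consS ek ?addr0//.
  by rewrite tnth_mktuple (inj_eq (@lift_inj _ _)).
(* Since [a] does not depend on the coordinate k, here the first one, it may be evaluated with 0 in
   that place. *)
pose S (y : n.-tuple mR) (x : mR) : mR := x + a (tuple_cons (0, y)).
rewrite -(@product_measure_fiber1 _ _ _ _ _ (@lebesgue_measure R) (lebesgue_tuple R n) S (@tuple_cons R n @^-1` A))//.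
- congr (_ _).
  have E z : tuple_shift k (a (tuple_cons z)) (tuple_cons z) =
      tuple_cons (S z.2 z.1, z.2).
    case: z => x y /=.
    have -> : a (tuple_cons (x, y)) = a (tuple_cons (0, y)).
      rewrite -[RHS](ak x); congr a; apply/esym/eq_tuple_cons => [|i];
        rewrite tnth_mktuple ?tnth_tuple_cons0 ?tnth_tuple_consS ek ?add0r//=.
      by rewrite addr0.
    apply: eq_tuple_cons => [|i];
        rewrite tnth_mktuple ?tnth_tuple_cons0 ?tnth_tuple_consS ek//=.
    by rewrite addr0.
  by apply/seteqP; split => z /=; rewrite E.
- by move=> y B mB; exact: lebesgue_measure_translation.
- apply: measurable_fun_pair => //; apply: measurable_funD => //.
  apply: measurableT_comp => //; apply: measurableT_comp => //.
  by apply: measurable_fun_pair => //; exact: measurable_cst.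
Qed.

Lemma measurable_box n (B : 'I_n -> set mR) : (forall i, measurable (B i)) ->
  measurable [set t : n.-tuple mR | forall i, B i (tnth t i)].
Proof.
move=> mB.
rewrite (_ : [set t | _] = \bigcap_(i in [set: 'I_n]) ((fun t => tnth t i) @^-1` B i)); last first.
  by apply/seteqP; split => t Bt i => [_|]; exact: Bt.
apply: fin_bigcap_measurable => // i _.
by rewrite -[X in measurable X]setTI; apply: measurable_tnth.
Qed.

Lemma lebesgue_tuple_box n (B : 'I_n -> set mR) : (forall i, measurable (B i)) ->
  lebesgue_tuple R n [set t | forall i, B i (tnth t i)] =
  (\prod_(i < n) lebesgue_measure (B i))%E.
Proof.
elim: n B => [|n IH] B mB.
  rewrite big_ord0 /= diracE mem_set//= => i; by case: i.
rewrite big_ord_recl -IH// /= /lebesgue_cons /pushforward.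
have mbox := @measurable_box n _ (fun i => mB (lift ord0 i)).
rewrite -product_measure1E//.
congr (_ _); apply/seteqP; split => -[x y] /=.
  move=> Bt; split => [|i]; first by have := Bt ord0; rewrite tnth_tuple_cons0.
  by have := Bt (lift ord0 i); rewrite tnth_tuple_consS.
move=> [Bx By] i; case: (unliftP ord0 i) => [j ->|->].
  by rewrite tnth_tuple_consS.
by rewrite tnth_tuple_cons0.
Qed.

End lebesgue_tuple_theory.

(** * The scalar product and the punctured ball *)

Section sphere_integral.
Context {R : realType} {m : nat}.
Local Notation mR := (measurableTypeR R).
Local Notation E := 'rV[R]_m.+1.
Local Notation mT := (m.+1.-tuple mR).
Local Notation mu := (lebesgue_tuple R m.+1).

Lemma dotC (u v : E) : dot u v = dot v u.
Proof. by apply: eq_bigr => i _; rewrite mulrC. Qed.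

Lemma dotDl (u v w : E) : dot (u + v) w = dot u w + dot v w.
Proof. by rewrite -big_split; apply: eq_bigr => i _; rewrite mxE mulrDl. Qed.

Lemma dotZl c (u v : E) : dot (c *: u) v = c * dot u v.
Proof. by rewrite mulr_sumr; apply: eq_bigr => i _; rewrite mxE mulrA. Qed.

Lemma dotDr (u v w : E) : dot u (v + w) = dot u v + dot u w.
Proof. by rewrite dotC dotDl ![dot _ u]dotC. Qed.

Lemma dotZr c (u v : E) : dot u (c *: v) = c * dot u v.
Proof. by rewrite dotC dotZl dotC. Qed.

Lemma dot_ge0 (u : E) : 0 <= dot u u.
Proof. by apply: sumr_ge0 => i _; rewrite -expr2 sqr_ge0. Qed.

Lemma dot_eq0 (u : E) : (dot u u == 0) = (u == 0).
Proof.
apply/idP/eqP => [|->]; last by rewrite /dot big1// => i _; rewrite mxE mul0r.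
rewrite psumr_eq0 => [/allP u0|i _]; last by rewrite -expr2 sqr_ge0.
apply/rowP => i; rewrite mxE; apply/eqP.
by have /implyP/(_ isT) := u0 i (mem_index_enum i); rewrite -expr2 sqrf_eq0.
Qed.

Lemma dot_gt0 (u : E) : (0 < dot u u) = (u != 0).
Proof. by rewrite lt_def dot_ge0 andbT dot_eq0. Qed.

Lemma enorm_gt0 (u : E) : (0 < enorm u) = (u != 0).
Proof. by rewrite sqrtr_gt0 dot_gt0. Qed.

Lemma enorm_sqr (u : E) : enorm u ^+ 2 = dot u u.
Proof. by rewrite sqr_sqrtr// dot_ge0. Qed.

Lemma sphere_neq0 (x : E) : sphere x -> x != 0.
Proof. by move=> sx; rewrite -dot_gt0 sx. Qed.

Lemma sphere_enorm (x : E) : sphere x -> enorm x = 1.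
Proof. by move=> sx; rewrite /enorm sx sqrtr1. Qed.

Lemma radial_sphere (x : E) : x != 0 -> sphere (radial x).
Proof.
move=> x0; rewrite /sphere /radial /= dotZl dotZr -enorm_sqr.
have : enorm x != 0 by rewrite gt_eqF// enorm_gt0.
by move=> ?; field.
Qed.

Lemma radial_id (x : E) : sphere x -> radial x = x.
Proof. by move=> sx; rewrite /radial sphere_enorm// invr1 scale1r. Qed.

Definition row_of (t : mT) : E := \row_i tnth t i.

Lemma dot_row_of t : dot (row_of t) (row_of t) = \sum_i tnth t i ^+ 2.
Proof. by apply: eq_bigr => i _; rewrite mxE expr2. Qed.

Definition tball : set mT := [set t | \sum_i tnth t i ^+ 2 <= 1].

(** The origin is removed because [hext f] is controlled by the values of f on the sphere everywhere
    except there, where [radial] takes the value 0. *)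
Definition pball : set mT := [set t | tball t /\ row_of t != 0].

(** Tuples carry the product sigma-algebra, rows the topology of the sup norm. The link is that an
    open set is the union of the boxes with rational end points that it contains; [F p] is the box p
    if it lies in O and is empty otherwise, so that the union may run over all p. *)
Lemma measurable_open_row (O : set E) : open O -> measurable (row_of @^-1` O).
Proof.
move=> oO.
pose box (p : {ffun 'I_m.+1 -> rat * rat}) (i : 'I_m.+1) : set mR :=
  [set` `](ratr (p i).1 : R), ratr (p i).2[].
pose F p := [set t : mT | (forall x : E, (forall i, box p i (x 0 i)) -> O x) /\
                          forall i, box p i (tnth t i)].
have -> : row_of @^-1` O = \bigcup_p F p.
  apply/seteqP; split => [t Ot|t [p _ [pO pt]]]; last first.
    by apply: pO => i; rewrite mxE.
  have [e /= e0 eO] := (nbhs_ballP _ _).1 (open_nbhs_nbhs (conj oO Ot)).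
  have /choice[f fP] : forall i, exists p : rat * rat,
      (tnth t i - e < ratr p.1 < tnth t i) && (tnth t i < ratr p.2 < tnth t i + e) :> Prop.
    move=> i; move: (tnth t i : R) => a.
    have /rat_in_itvoo[q] : a - e < a by rewrite ltrBlDr ltrDl.
    have /rat_in_itvoo[r] : a < a + e by rewrite ltrDl.
    by rewrite !in_itv/= => r1 q1; exists (q, r); rewrite /= q1 r1.
  exists (finfun f) => //; split => [x xp|i]; last first.
    rewrite /box /= ffunE /= in_itv/=.
    by have /andP[/andP[_ ->] /andP[-> _]] := fP i.
  apply: eO; split => // i j; rewrite [i]ord1 mxE; move: (xp j).
  rewrite /box /= ffunE /= in_itv/=.
  have /andP[/andP[h1 _] /andP[_ h4]] := fP j.
  move=> /andP[h5 h6]; rewrite /ball /= ltr_distlC; apply/andP; split.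
    exact: lt_trans h1 h5.
  exact: lt_trans h6 h4.
apply: countable_bigcupT_measurable => [|p]; first exact: countableP.
have [pO|npO] := pselect (forall x : E, (forall i, box p i (x 0 i)) -> O x).
  rewrite (_ : F p = [set t | forall i, box p i (tnth t i)]).
    by apply: measurable_box => i; exact: measurable_itv.
  by apply/seteqP; split => t; [case|].
rewrite (_ : F p = set0); first exact: measurable0.
by apply/seteqP; split => t //; case.
Qed.

Lemma measurable_tball : measurable tball.
Proof.
have mf : measurable_fun setT (fun t : mT => \sum_i tnth t i ^+ 2 : R).
  apply: measurable_sum => i; apply: measurable_funX; exact: measurable_tnth.
rewrite (_ : tball = setT `&` (fun t : mT => \sum_i tnth t i ^+ 2) @^-1` `]-oo, 1%R]).
  exact: mf.
by apply/seteqP; split => t; rewrite /tball /= in_itv/= => // -[].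
Qed.

Lemma measurable_row0 : measurable [set t | row_of t = 0].
Proof.
rewrite (_ : [set t | row_of t = 0] = [set t | forall i, [set 0] (tnth t i)]).
  by apply: (@measurable_box R m.+1 (fun=> [set 0])) => i; exact: measurable_set1.
apply/seteqP; split => t /=; first by move=> /rowP + i => /(_ i); rewrite !mxE.
by move=> t0; apply/rowP => i; rewrite !mxE.
Qed.

Lemma lebesgue_row0 : mu [set t | row_of t = 0] = 0%E.
Proof.
rewrite (_ : [set t | row_of t = 0] = [set t | forall i, [set (0 : mR)] (tnth t i)]).
  rewrite (@lebesgue_tuple_box R m.+1 (fun=> [set 0]))//.
  by rewrite big_ord_recl lebesgue_measure_set1 mul0e.
apply/seteqP; split => t /=; first by move=> /rowP + i => /(_ i); rewrite !mxE.
by move=> t0; apply/rowP => i; rewrite !mxE.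
Qed.

Lemma pballE : pball = tball `\` [set t | row_of t = 0].
Proof. by apply/seteqP; split => t [bt /eqP]. Qed.

Lemma measurable_pball : measurable pball.
Proof. by rewrite pballE; apply: measurableD; [exact: measurable_tball|exact: measurable_row0]. Qed.

Lemma lebesgue_tball_lty : (mu tball < +oo)%E.
Proof.
pose B (i : 'I_m.+1) : set mR := [set` `[(-1 : R), 1]].
have mB i : measurable (B i) by exact: measurable_itv.
apply: (@le_lt_trans _ _ (mu [set t | forall i, B i (tnth t i)])).
  apply: le_measure; rewrite ?inE; [exact: measurable_tball|exact: (@measurable_box R m.+1 B)|].
  move=> t bt i; rewrite /B /= in_itv/=.
  have : tnth t i ^+ 2 <= 1.
    apply: le_trans bt; rewrite (bigD1 i)//= lerDl.
    by apply: sumr_ge0 => j _; exact: sqr_ge0.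
  move: (tnth t i : R) => a a1; apply/andP; split; nra.
rewrite (@lebesgue_tuple_box R m.+1 B)// -ge0_fin_numE; last by apply: prode_ge0.
apply: (big_ind (fun x => x \is a fin_num)) => //.
  by move=> x y; exact: fin_numM.
by move=> i _; rewrite lebesgue_measure_itv/= lte_fin; case: ifP.
Qed.

End sphere_integral.

(** * Integration on the sphere *)

Section sphere_integral_theory.
Context {R : realType} {m : nat}.
Local Notation mR := (measurableTypeR R).
Local Notation E := 'rV[R]_m.+1.
Local Notation mT := (m.+1.-tuple mR).
Local Notation mu := (lebesgue_tuple R m.+1).
Local Notation E0 := [set x : E | x != 0].

Lemma open_neq0 : open E0.
Proof.
rewrite (_ : E0 = ~` [set 0]); last by apply/seteqP; split => x /= /eqP.
apply: closed_openC; apply: accessible_closed_set1; apply: hausdorff_accessible; exact: norm_hausdorff.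
Qed.

Lemma Ckr_dot (V : normedModType R) k (U : set V) (f g : V -> E) : open U ->
  Ck k U f -> Ck k U g -> Ckr k U (fun x => dot (f x) (g x)).
Proof.
by move=> oU cf cg; apply: Ckr_sum => // i; apply: Ckr_mul => //; apply: Ckr_coord.
Qed.

Lemma CkZ (V : normedModType R) k (U : set V) (c : V -> R) (f : V -> E) : open U ->
  Ckr k U c -> Ck k U f -> Ck k U (fun x => c x *: f x).
Proof.
move=> oU cc cf; apply: Ck_row => // j.
apply: (Ckr_eq (f := fun x => c x * f x 0 j)) => //.
  by move=> x _; rewrite mxE.
by apply: Ckr_mul => //; exact: Ckr_coord.
Qed.

Lemma Ck_radial k : Ck k E0 (@radial R m).
Proof.
have oE := open_neq0.
apply: CkZ => //; last exact: Ck_id.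
apply: Ckr_rsqrt => // [x|]; first by rewrite dot_gt0.
by apply: Ckr_dot => //; exact: Ck_id.
Qed.

Lemma continuous_hext (T : topologicalType) (f : E -> T) (x : E) :
  (forall x, x != 0 -> {for x, continuous f}) -> x != 0 -> {for x, continuous (hext f)}.
Proof.
move=> cf x0; apply: (@continuous_comp _ _ _ (@radial R m) f).
  exact: (@Ck_radial 0).
by apply: cf; apply: sphere_neq0; exact: radial_sphere.
Qed.

Lemma measurable_fun_pball (f : E -> R) : Ckr 0 E0 f ->
  measurable_fun (@pball R m) (fun t => f (row_of t) : R).
Proof.
move=> cf mD; apply: (measurability _ (RGenOInfty.measurableE R)) => //.
move=> _ [_ [a ->] <-]; rewrite preimage_itvoy.
pose O := [set x : E | x != 0 /\ a < f x].
have oO : open O.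
  rewrite openE => x [x0 ax]; rewrite /interior.
  have h1 : \forall y \near x, y != 0.
    by apply: open_nbhs_nbhs; split => //; exact: open_neq0.
  have h2 : \forall y \near x, a < f y by apply: (cvgr_gt _ (cf x x0)).
  by near=> y; split; near: y.
rewrite (_ : _ `&` _ = pball `&` row_of @^-1` O).
  by apply: measurableI => //; exact: measurable_open_row.
by apply/seteqP; split => t /= [bt]; have [_ t0] := bt => // -[].
Unshelve. all: by end_near. Qed.

Lemma compact_sphere : compact (@sphere R m).
Proof.
apply: bounded_closed_compact.
  exists 1; split => // M M1 x sx.
  rewrite /Num.Def.normr /= mx_normrE; apply: bigmax_le; first by rewrite ltW// (lt_trans ltr01).
  move=> [i j] _ /=; rewrite [i]ord1 ltW//; apply: le_lt_trans M1.
  have : x 0 j ^+ 2 <= 1.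
    rewrite -sx /dot (bigD1 j)//= -expr2 lerDl.
    by apply: sumr_ge0 => k _; rewrite -expr2 sqr_ge0.
  by move: (x 0 j) => a a1; rewrite ler_norml; apply/andP; split; nra.
have cd : continuous (fun x : E => dot x x : R^o).
  move=> x; apply: (@Ckr_dot E 0 setT id id openT) => //; exact: Ck_id.
rewrite (_ : @sphere R m = (fun x : E => dot x x : R^o) @^-1` [set 1]) //.
by apply: preimage_closed => [x _|]; [exact: cd|exact: closed_eq].
Qed.

Lemma bounded_sphere (f : E -> R) : Ckr 0 E0 f ->
  exists2 M : R, 0 <= M & forall x, sphere x -> `|f x| <= M.
Proof.
move=> cf.
have cw : {within @sphere R m, continuous f}.
  by apply: continuous_in_subspaceT => x /set_mem sx; apply: cf; exact: sphere_neq0.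
have [M [_ MP]] := compact_bounded (continuous_compact cw compact_sphere).
exists (`|M| + 1) => [|x sx]; first by rewrite addr_ge0.
by apply: (MP (`|M| + 1)); [rewrite ltr_pwDr// ler_norm|exists x].
Qed.

Lemma Ckr_hext (f : E -> R) : Ckr 0 E0 f -> Ckr 0 E0 (hext f).
Proof. by move=> cf x x0; exact: continuous_hext. Qed.

Lemma integrable_pball (f : E -> R) : Ckr 0 E0 f ->
  mu.-integrable (@pball R m) (EFin \o (fun t => hext f (row_of t) : R)).
Proof.
move=> cf; apply: measurable_bounded_integrable => //.
- exact: measurable_pball.
- apply: le_lt_trans (@lebesgue_tball_lty R m); apply: le_measure; rewrite ?inE.
  + exact: measurable_pball.
  + exact: measurable_tball.
  + by move=> t [].
- exact: measurable_fun_pball (Ckr_hext cf).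
- have [M M0 fM] := bounded_sphere cf.
  exists M; split; [exact: num_real|] => N MN t [_ t0]; apply: le_trans (ltW MN).
  by apply: fM; exact: radial_sphere.
Qed.

(* The value of f at the origin, which hext picks up, is negligible. *)
Lemma sphere_int_pball (f g : E -> R) : Ckr 0 E0 g -> (forall x, sphere x -> f x = g x) ->
  sphere_int f = m.+1%:R * \int[mu]_(t in @pball R m) hext g (row_of t).
Proof.
move=> cg fg; rewrite /sphere_int; congr (_ * _); rewrite /Rintegral; congr fine.
have hfg t : pball t -> hext f (row_of t) = hext g (row_of t).
  by move=> [_ t0]; apply: fg; exact: radial_sphere.
transitivity (\int[mu]_(t in @pball R m) (hext f (row_of t))%:E)%E; last first.
  by apply: eq_integral => t /set_mem pt; rewrite hfg.
rewrite pballE; apply: negligible_integral.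
- exact: measurable_row0.
- exact: measurable_tball.
- have mtb := @measurable_tball R m.
  have bE : tball = pball `|` (tball `&` [set t : mT | row_of t = 0]).
    apply/seteqP; split => [t bt|t [[]|[]]//].
    by have [t0|/eqP t0] := pselect (row_of t = 0); [right|left].
  have mfb : measurable_fun (@tball R m) (fun t => hext f (row_of t)).
    rewrite bE; apply/measurable_funU.
    - exact: measurable_pball.
    - by apply: measurableI => //; exact: measurable_row0.
    split.
      apply: eq_measurable_fun (measurable_fun_pball (Ckr_hext cg)) => t /set_mem pt.
      by rewrite hfg.
    apply: (eq_measurable_fun (cst (hext f 0 : R))); last exact: measurable_cst.
    by move=> t /set_mem[_ /= ->].
  apply: measurable_bounded_integrable => //; first exact: lebesgue_tball_lty.
  have [M M0 gM] := bounded_sphere cg.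
  exists (M + `|hext f 0|); split; [exact: num_real|] => N MN t _; apply: le_trans (ltW MN).
  rewrite -/(row_of t).
  have [->|t0] := eqVneq (row_of t) 0; first by rewrite lerDr.
  have st := radial_sphere t0.
  by rewrite /hext /= fg// (le_trans (gM _ st))// lerDl.
- exact: lebesgue_row0.
Qed.

Lemma sphere_intE (f : E -> R) : Ckr 0 E0 f ->
  sphere_int f = m.+1%:R * \int[mu]_(t in @pball R m) hext f (row_of t).
Proof. by move=> cf; exact: sphere_int_pball. Qed.

Lemma eq_sphere_int (f g : E -> R) : Ckr 0 E0 g ->
  (forall x, sphere x -> f x = g x) -> sphere_int f = sphere_int g.
Proof. by move=> cg fg; rewrite (sphere_int_pball cg fg) sphere_intE. Qed.

Lemma sphere_intD (f g : E -> R) : Ckr 0 E0 f -> Ckr 0 E0 g ->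
  sphere_int (fun x => f x + g x) = sphere_int f + sphere_int g.
Proof.
move=> cf cg; have oE := open_neq0; rewrite !sphere_intE//; last exact: Ckr_add.
by rewrite -mulrDr -(RintegralD (@measurable_pball R m) (integrable_pball cf) (integrable_pball cg)).
Qed.

Lemma sphere_intZ (c : R) (f : E -> R) : Ckr 0 E0 f ->
  sphere_int (fun x => c * f x) = c * sphere_int f.
Proof.
move=> cf; have oE := open_neq0.
rewrite !sphere_intE//; last by apply: Ckr_mul => //; exact: Ckr_cst.
by rewrite mulrCA -(RintegralZl c (@measurable_pball R m) (integrable_pball cf)).
Qed.

Lemma sphere_int_ge0 (f : E -> R) : Ckr 0 E0 f ->
  (forall x, sphere x -> 0 <= f x :> R) -> 0 <= sphere_int f.
Proof.
move=> cf f0; rewrite sphere_intE//; apply: mulr_ge0 => //; apply: Rintegral_ge0 => t.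
by move=> [_ t0]; apply: f0; exact: radial_sphere.
Qed.

End sphere_integral_theory.

(** * Differentiation under the integral, and rotations *)

Section sphere_integral_calculus.
Context {R : realType} {m : nat}.
Local Notation mR := (measurableTypeR R).
Local Notation E := 'rV[R]_m.+1.
Local Notation mT := (m.+1.-tuple mR).
Local Notation mu := (lebesgue_tuple R m.+1).
Local Notation E0 := [set x : E | x != 0].

Lemma lebesgue_open_row_gt0 (O : set E) x : open O -> O x ->
  (0 < mu (row_of @^-1` O))%E.
Proof.
move=> oO Ox; have [e /= e0 eO] := (nbhs_ballP _ _).1 (open_nbhs_nbhs (conj oO Ox)).
pose B (i : 'I_m.+1) : set mR := [set` `]x 0 i - e, x 0 i + e[].
have mB i : measurable (B i) by exact: measurable_itv.
apply: (@lt_le_trans _ _ (mu [set t | forall i, B i (tnth t i)])).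
  rewrite (@lebesgue_tuple_box R m.+1 B)//.
  apply: (big_ind (fun y => (0 < y)%E)) => //; first exact: mule_gt0.
  move=> i _; rewrite lebesgue_measure_itv/= lte_fin.
  have h : x 0 i - e < x 0 i + e by rewrite ltrD2l gtrN.
  by rewrite h -EFinB lte_fin subr_gt0.
apply: le_measure; rewrite ?inE.
- exact: (@measurable_box R m.+1 B).
- exact: measurable_open_row.
move=> t /= Bt; apply: eO; split => // i j; rewrite [i]ord1 mxE.
by have := Bt j; rewrite /B /= in_itv/= /ball/= ltr_distlC.
Qed.

Lemma radialZ (c : R) (x : E) : 0 < c -> radial (c *: x) = radial x.
Proof.
move=> c0; rewrite /radial /enorm dotZl dotZr mulrA -expr2 sqrtrM ?sqr_ge0//.
rewrite sqrtr_sqr gtr0_norm// invfM scalerA mulrAC mulVf ?mul1r// gt_eqF//.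
Qed.

Lemma sphere_int_eq0 (f : E -> R) : Ckr 0 E0 f ->
  (forall x, sphere x -> 0 <= f x :> R) -> sphere_int f = 0 ->
  forall x, sphere x -> f x = 0.
Proof.
move=> cf f0 If x sx; apply/eqP; apply: contraTT isT => fx0.
have fx : 0 < f x :> R by rewrite lt_def fx0 f0.
have ci := integrable_pball cf.
have mp := @measurable_pball R m.
have mf : measurable_fun (@pball R m) (fun t => (hext f (row_of t) : R)%:E).
  by have /integrableP[] := ci.
have I0 : (\int[mu]_(t in @pball R m) (hext f (row_of t) : R)%:E = 0)%E.
  move: If; rewrite sphere_intE// => /eqP; rewrite mulf_eq0 pnatr_eq0/= => /eqP If.
  by rewrite -[LHS]fineK; [congr (_%:E)|exact: integrable_fin_num].
have [N [mN N0 NP]] : ae_eq mu (@pball R m) (fun t => (hext f (row_of t) : R)%:E) (cst 0%E).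
  apply/ae_eq_integral_abs => //; rewrite -[RHS]I0; apply: eq_integral => t.
  by move=> /set_mem[_ t0]; rewrite gee0_abs// lee_fin; apply: f0; exact: radial_sphere.
pose O := [set y : E | y != 0 /\ (dot y y < 1 /\ 0 < (hext f y : R))].
have cd (y : E) : {for y, continuous (fun x : E => dot x x : R^o)}.
  by apply: (@Ckr_dot R m E 0 setT id id openT) => //; exact: Ck_id.
have oO : open O.
  rewrite openE => y [y0 [y1 fy]]; rewrite /interior.
  have h1 : \forall z \near y, z != 0.
    by apply: open_nbhs_nbhs; split => //; exact: open_neq0.
  have h2 : \forall z \near y, 0 < (hext f z : R) by apply: (cvgr_gt _ (Ckr_hext cf y0)).
  have h3 : \forall z \near y, dot z z < 1 by apply: (cvgr_lt _ (cd y)).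
  by near=> z; split; [|split]; near: z.
(* The point x lies on the boundary of the ball; the middle of its ray is interior, and [hext f] has
   the same value there. *)
have O2 : O (2^-1 *: x).
  split; first by rewrite scaler_eq0 invr_eq0 pnatr_eq0/= sphere_neq0.
  rewrite /hext /= radialZ ?invr_gt0// radial_id// dotZl dotZr sx; split => //.
  by rewrite mulr1 -invfM invf_lt1// -natrM ltr1n.
have := lebesgue_open_row_gt0 oO O2.
suff : (mu (row_of @^-1` O) <= mu N)%E by rewrite N0 leNgt => /negbTE ->.
apply: le_measure; rewrite ?inE//; first exact: measurable_open_row.
move=> t [t0 [t1 ft]]; apply: NP => /= H.
have : pball t by split => //; rewrite /tball /= -dot_row_of ltW.
by move=> /H [] /eqP; rewrite gt_eqF.
Unshelve. all: by end_near. Qed.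

(** Dominated differentiation: [w] is jointly continuous, hence bounded on the product of a closed
    time interval with the compact sphere, and a bound on the sphere is a bound on the punctured
    ball for the homogeneous extension. *)
Lemma derive_sphere_int (G w : R^o -> E -> R) (e : R) :
  (forall t : R, `|t| < e -> Ckr 0 E0 (G t)) ->
  (forall (t : R) x, `|t| < e -> sphere x -> is_derive (t : R^o) (1 : R^o) (fun t => G t x : R^o) (w t x)) ->
  Ckr 0 [set u : R^o * E | `|u.1| < e /\ u.2 != 0] (fun u => w u.1 u.2) ->
  forall t : R, `|t| < e ->
    is_derive (t : R^o) (1 : R^o) (fun t => sphere_int (G t) : R^o) (sphere_int (w t)).
Proof.
move=> cG dG cw t te.
have cw' (s : R) x : `|s| < e -> x != 0 ->
    {for ((s, x) : R^o * E), continuous (fun u : R^o * E => w u.1 u.2 : R^o)}.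
  move=> se x0; have cw0 : forall u : R^o * E, `|u.1| < e /\ u.2 != 0 ->
    {for u, continuous (fun u : R^o * E => w u.1 u.2 : R^o)} := cw.
  by have := cw0 (s, x) (conj se x0).
(* Half of the distance to the end of the time interval, so that the closed interval of radius d
   around t stays inside and is compact. *)
pose d := (e - `|t|) / 2.
have d0 : 0 < d by rewrite divr_gt0// subr_gt0.
have dP (s : R) : t - d <= s <= t + d -> `|s| < e.
  rewrite -ler_distlC => /= sd; rewrite -(subrK t s).
  apply: le_lt_trans (ler_normD _ _) _; rewrite distrC in sd.
  apply: le_lt_trans (lerD sd (lexx _)) _.
  by move: te; rewrite /d; move: `|t| => a ae; lra.
have ct (s : R) : `|s| < e -> Ckr 0 E0 (w s).
  move=> se x x0.
  apply: (@continuous_comp _ _ _ (fun x => (s, x) : R^o * E) (fun u => w u.1 u.2)).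
    apply: differentiable_continuous; apply: (@differentiable_pair R E R^o E (cst s) id).
      exact: differentiable_cst.
    exact: ex_diff.
  exact: cw'.
pose K : set (R^o * E) := [set` `[t - d, t + d]] `*` @sphere R m.
have cK : compact K by apply: compact_setX; [exact: segment_compact|exact: compact_sphere].
have cwK : {within K, continuous (fun u : R^o * E => w u.1 u.2 : R^o)}.
  apply: continuous_in_subspaceT => -[s x] /set_mem[/= st sx]; apply: cw' => /=.
    by apply: dP; move: st; rewrite in_itv.
  exact: sphere_neq0.
have [M [_ MP]] := compact_bounded (continuous_compact cwK cK).
pose M1 := `|M| + 1.
have M10 : 0 <= M1 by rewrite addr_ge0.
have wM (s : R) x : t - d <= s <= t + d -> sphere x -> `|w s x : R| <= M1.
  move=> sd sx; apply: (MP M1); first by rewrite ltr_pwDr// ler_norm.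
  by exists (s, x) => //; split => //=; rewrite in_itv.
pose f (s : R) (y : mT) : R := G s (radial (row_of y)).
have mp := @measurable_pball R m.
have It : t \in `]t - d, t + d[ by rewrite in_itv/= ltrBlDr !ltrDl d0.
have sI (s : R) : s \in `]t - d, t + d[ -> t - d <= s <= t + d.
  by rewrite in_itv/= => /andP[? ?]; rewrite !ltW.
have intf (s : R) : [set` `]t - d, t + d[] s -> mu.-integrable (@pball R m) (EFin \o f s).
  by move=> /sI/dP se; apply: (integrable_pball (cG s se)).
have derf (s : R) y : [set` `]t - d, t + d[] s -> pball y -> derivable (f ^~ y) s 1.
  by move=> /sI/dP se [_ y0]; have [] := dG s _ se (radial_sphere y0).
have valf (s : R) y : [set` `]t - d, t + d[] s -> pball y ->
    partial1of2 f s y = w s (radial (row_of y)).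
  move=> /sI/dP se [_ y0]; rewrite partial1of2E.
  by have [_ <-] := dG s _ se (radial_sphere y0).
have intM : mu.-integrable (@pball R m) (EFin \o (fun=> M1)).
  by apply: (@integrable_pball R m (fun=> M1)); exact: Ckr_cst.
have ubM (s : R) y : [set` `]t - d, t + d[] s -> pball y -> `|partial1of2 f s y| <= M1.
  move=> Is py; rewrite valf//; apply: wM; first exact: sI.
  by apply: radial_sphere; case: py.
have H1 := derivable_under_integral mp It intf derf (fun=> M10) intM ubM.
have H2 := differentiation_under_integral mp It intf derf (fun=> M10) intM ubM.
pose F (s : R) := \int[mu]_(y in @pball R m) f s y.
have HF : is_derive (t : R) (1 : R) F (\int[mu]_(y in @pball R m) hext (w t) (row_of y)).
  apply: DeriveDef => //; rewrite -derive1E H2; apply: eq_Rintegral => y /set_mem py.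
  by rewrite valf.
rewrite (sphere_intE (ct t te)).
apply: (near_eq_is_derive (f := fun s : R^o => m.+1%:R * F s : R^o)).
  have : \forall s \near t, s \in `]t - d, t + d[.
    by apply: near_in_itvoo.
  by apply: filterS => s /sI/dP se; rewrite (sphere_intE (cG s se)).
Qed.

(* The rotation of the plane of the coordinates i and j with half-angle tangent t,
   written as a product of three shears so as to preserve the Lebesgue measure. *)
Definition shear (i j : 'I_m.+1) (c : R) (x : E) : E :=
  x + (c * x 0 j) *: delta_mx 0 i.

Definition plane_rot (i j : 'I_m.+1) (t : R) (x : E) : E :=
  shear i j (- t) (shear j i (2 * t / (1 + t ^+ 2)) (shear i j (- t) x)).

Definition tuple_shear (i j : 'I_m.+1) (c : R) (t : mT) : mT :=
  tuple_shift i (c * tnth t j) t.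

Lemma row_of_shear i j c t : row_of (tuple_shear i j c t) = shear i j c (row_of t).
Proof.
apply/rowP => k; rewrite !mxE tnth_mktuple eqxx /=.
by rewrite -[in RHS]mulr_natr; case: (k == i); rewrite ?mulr1 ?mulr0.
Qed.

Lemma measurable_tuple_shear i j c : measurable_fun setT (tuple_shear i j c).
Proof.
apply: measurable_tuple_shift; apply: measurable_funM; first exact: measurable_cst.
exact: measurable_tnth.
Qed.

Lemma lebesgue_tuple_shear i j c (A : set mT) : i != j -> measurable A ->
  mu (tuple_shear i j c @^-1` A) = mu A.
Proof.
move=> ij mA; apply: lebesgue_tuple_shift => //.
  by apply: measurable_funM; [exact: measurable_cst|exact: measurable_tnth].
by move=> d t; rewrite tnth_mktuple eq_sym (negbTE ij) addr0.
Qed.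

Definition tuple_rot (i j : 'I_m.+1) (t : R) (x : mT) : mT :=
  tuple_shear i j (- t) (tuple_shear j i (2 * t / (1 + t ^+ 2)) (tuple_shear i j (- t) x)).

Lemma row_of_rot i j c t : row_of (tuple_rot i j c t) = plane_rot i j c (row_of t).
Proof. by rewrite !row_of_shear. Qed.

Lemma measurable_tuple_rot i j c : measurable_fun setT (tuple_rot i j c).
Proof.
apply: measurableT_comp; first exact: measurable_tuple_shear.
apply: measurableT_comp; first exact: measurable_tuple_shear.
exact: measurable_tuple_shear.
Qed.

Lemma lebesgue_tuple_rot i j c (A : set mT) : i != j -> measurable A ->
  mu (tuple_rot i j c @^-1` A) = mu A.
Proof.
move=> ij mA; have ji : j != i by rewrite eq_sym.
have mS i' j' c' B : measurable B -> measurable (tuple_shear i' j' c' @^-1` B).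
  by move=> mB; rewrite -[X in measurable X]setTI; exact: measurable_tuple_shear.
have m1 := mS i j (- c) A mA; have m2 := mS j i (2 * c / (1 + c ^+ 2)) _ m1.
rewrite -(lebesgue_tuple_shear (- c) ij mA).
rewrite -(lebesgue_tuple_shear (2 * c / (1 + c ^+ 2)) ji m1).
by rewrite -[RHS](lebesgue_tuple_shear (- c) ij m2).
Qed.

(** (1 - t^2)/(1 + t^2) and 2 t/(1 + t^2) are the cosine and the sine of the angle whose half has
    tangent t. This rational parametrization leaves every later computation to field arithmetic. *)
Lemma rotE i j (t : R) x k : i != j -> plane_rot i j t x 0 k =
  if k == i then ((1 - t ^+ 2) * x 0 i - 2 * t * x 0 j) / (1 + t ^+ 2) else
  if k == j then (2 * t * x 0 i + (1 - t ^+ 2) * x 0 j) / (1 + t ^+ 2) else x 0 k.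
Proof.
move=> ij; have ji : (j == i) = false by rewrite eq_sym (negbTE ij).
have t0 : 1 + t ^+ 2 != 0 by rewrite gt_eqF// ltr_pwDl// sqr_ge0.
rewrite /plane_rot /shear !mxE !eqxx /= ?(negbTE ij) ?ji /=.
have [->|ki] := eqVneq k i; first by rewrite (negbTE ij) /=; field.
have [->|kj] := eqVneq k j; rewrite /= ?mulr0 ?mulr1 ?addr0//.
by field.
Qed.

Lemma dot_rot i j t x : i != j -> dot (plane_rot i j t x) (plane_rot i j t x) = dot x x.
Proof.
move=> ij; have ji : j != i by rewrite eq_sym.
have t0 : 1 + t ^+ 2 != 0 by rewrite gt_eqF// ltr_pwDl// sqr_ge0.
rewrite /dot (bigD1 i)//= (bigD1 j)//= [RHS](bigD1 i)//= [X in _ = _ + X](bigD1 j)//=.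
rewrite !addrA; congr (_ + _); last first.
  by apply: eq_bigr => k /andP[/negbTE ki /negbTE kj]; rewrite rotE// ki kj.
by rewrite !rotE// !eqxx (negbTE ji); field.
Qed.

Lemma radial_rot i j t x : i != j -> radial (plane_rot i j t x) = plane_rot i j t (radial x).
Proof.
move=> ij; apply/rowP => k; rewrite mxE !rotE// /enorm dot_rot//.
rewrite /radial !mxE; case: ifP => _; first by rewrite mulrA; congr (_ / _); ring.
by case: ifP => _ //; rewrite mulrA; congr (_ / _); ring.
Qed.

(** The rotation preserves Lebesgue measure, maps the punctured ball onto itself and commutes with
    [radial], hence with homogeneous extension. *)
Lemma sphere_int_rot i j t (f : E -> R) : i != j -> Ckr 0 E0 f ->
  Ckr 0 E0 (fun x => f (plane_rot i j t x)) ->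
  sphere_int (fun x => f (plane_rot i j t x)) = sphere_int f.
Proof.
move=> ij cf cfr; rewrite !sphere_intE//; congr (_ * _).
have mr := measurable_tuple_rot i j t.
have pE : tuple_rot i j t @^-1` (@pball R m) = @pball R m.
  apply/seteqP; split => x; rewrite /pball /tball /= -!dot_row_of -!dot_gt0 row_of_rot dot_rot//.
rewrite /Rintegral; congr fine.
have mp := @measurable_pball R m.
pose g (x : mT) := (hext f (row_of x) : R)%:E.
have mg : measurable_fun (@pball R m) g.
  by have /integrableP[] := integrable_pball cf.
(* The change of variables by push-forward wants an integrand measurable on the whole space, so g is
   extended by 0 outside the punctured ball. *)
pose g' := g \_ (@pball R m).
have mg' : measurable_fun setT g' by exact/(measurable_restrictT _ mp).
have gE x : pball x -> g' (tuple_rot i j t x) = (hext (fun x => f (plane_rot i j t x)) (row_of x) : R)%:E.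
  move=> px; have pTx : pball (tuple_rot i j t x) by move: px; rewrite -{1}pE.
  by rewrite /g' patchE mem_set// /g row_of_rot /hext /= radial_rot.
transitivity (\int[mu]_(x in tuple_rot i j t @^-1` (@pball R m)) (g' \o tuple_rot i j t) x)%E.
  by rewrite pE; apply: eq_integral => x /set_mem px /=; rewrite gE.
have ig : mu.-integrable (tuple_rot i j t @^-1` (@pball R m)) (g' \o tuple_rot i j t).
  rewrite pE; apply: eq_integrable (integrable_pball cfr) => // x /set_mem px.
  by rewrite /= gE.
rewrite -(integral_pushforward mr mg' ig mp).
transitivity (\int[mu]_(y in @pball R m) g' y)%E.
  by apply: eq_measure_integral => //= A mA _; exact: lebesgue_tuple_rot.
by apply: eq_integral => x xp; rewrite /g' patchE xp.
Qed.

End sphere_integral_calculus.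

(** * The divergence theorem *)

Notation partial i := (dird (delta_mx 0 i)).

Section divergence.
Context {R : realType} {m : nat}.
Local Notation E := 'rV[R]_m.+1.
Local Notation E0 := [set x : E | x != 0].

Lemma Ck_fst (V W : normedModType R) k (U : set (V * W)) : Ck k U fst.
Proof.
apply: (@Ck_sub _ _ _ _ setT) => //.
have cf : continuous (fst : V * W -> V) by move=> ?; exact: cvg_fst.
exact: (@Ck_comp_linear R (V * W)%type V V k setT fst id cf (Ck_id _ _)).
Qed.

Lemma Ck_snd (V W : normedModType R) k (U : set (V * W)) : Ck k U snd.
Proof.
apply: (@Ck_sub _ _ _ _ setT) => //.
have cf : continuous (snd : V * W -> W) by move=> ?; exact: cvg_snd.
exact: (@Ck_comp_linear R (V * W)%type W W k setT snd id cf (Ck_id _ _)).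
Qed.

Lemma Ck_rot k i j : i != j -> Ck k [set: R^o * E] (fun u => plane_rot i j u.1 u.2).
Proof.
move=> ij; have oT := @openT (R^o * E)%type.
have c1 : Ckr k setT (fun u : R^o * E => u.1 : R) by exact: Ck_fst.
have c2 l : Ckr k setT (fun u : R^o * E => u.2 0 l).
  by apply: Ckr_coord => //; exact: Ck_snd.
have ci : Ckr k setT (fun u : R^o * E => (1 + (u.1 : R) ^+ 2)^-1).
  apply: Ckr_inv => // [u _|]; first by rewrite ltr_pwDl// sqr_ge0.
  by apply: Ckr_add => //; [exact: Ckr_cst|exact: Ckr_sqr].
have cm : Ckr k setT (fun u : R^o * E => 1 - (u.1 : R) ^+ 2).
  by apply: Ckr_add => //; [exact: Ckr_cst|apply: Ckr_opp => //; exact: Ckr_sqr].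
have c21 : Ckr k setT (fun u : R^o * E => 2 * (u.1 : R)).
  by apply: Ckr_mul => //; exact: Ckr_cst.
apply: Ck_row => // l.
pose r (u : R^o * E) : R :=
  if l == i then ((1 - (u.1 : R) ^+ 2) * u.2 0 i - 2 * (u.1 : R) * u.2 0 j) * (1 + (u.1 : R) ^+ 2)^-1 else
  if l == j then (2 * (u.1 : R) * u.2 0 i + (1 - (u.1 : R) ^+ 2) * u.2 0 j) * (1 + (u.1 : R) ^+ 2)^-1
  else u.2 0 l.
apply: (Ckr_eq (f := r)) => //; first by move=> u _; rewrite rotE.
rewrite /r; case: (l == i).
  by apply: Ckr_mul => //; apply: Ckr_add; [|exact: Ckr_mul|apply: Ckr_opp => //; exact: Ckr_mul].
by case: (l == j) => //; apply: Ckr_mul => //; apply: Ckr_add => //; exact: Ckr_mul.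
Qed.

Lemma rot_neq0 i j t (x : E) : i != j -> x != 0 -> plane_rot i j t x != 0.
Proof. by move=> ij; rewrite -!dot_gt0 dot_rot. Qed.

(** The rotation angle is 2 arctan t, whose derivative 2/(1 + t^2) multiplies the infinitesimal
    rotation of the plane of i and j. *)
Lemma is_derive_rot i j (t : R) (x : E) : i != j ->
  is_derive (t : R^o) (1 : R^o) (fun t : R^o => plane_rot i j t x)
    ((2 / (1 + t ^+ 2)) *:
     (plane_rot i j t x 0 i *: delta_mx 0 j - plane_rot i j t x 0 j *: delta_mx 0 i)).
Proof.
move=> ij; have ji : (j == i) = false by rewrite eq_sym (negbTE ij).
have t0 : 1 + t ^+ 2 != 0 by rewrite gt_eqF// ltr_pwDl// sqr_ge0.
have dq : is_derive (t : R^o) (1 : R^o) (cst 1 + id * id : R^o -> R^o) (2 * t).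
  apply: is_derive_eq (is_deriveD (is_derive_cst _ _ _) (is_deriveM (is_derive_id _ _) (is_derive_id _ _))) _.
  by rewrite /GRing.scale /= add0r !mulr1 mulr_natl mulr2n.
have qE (r : R) : (cst 1 + id * id : R^o -> R^o) r = 1 + r ^+ 2 by [].
have t0' : (cst 1 + id * id : R^o -> R^o) t != 0 by rewrite qE.
have dphi : is_derive (t : R^o) (1 : R^o) (fun r => ((cst 1 + id * id : R^o -> R^o) r)^-1 : R^o) (- (2 * t) / (1 + t ^+ 2) ^+ 2).
  apply: is_derive_eq (is_deriveV t0' dq) _.
  by rewrite qE /GRing.scale /=; field.
pose phi : R^o -> R^o := fun r => ((cst 1 + id * id : R^o -> R^o) r)^-1.
have phiE (r : R) : phi r = (1 + r ^+ 2)^-1 by rewrite /phi qE.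
pose M : R^o -> R^o := id * phi.
have ME (r : R) : M r = r / (1 + r ^+ 2) by rewrite -phiE.
have dM : is_derive (t : R^o) (1 : R^o) M ((1 - t ^+ 2) / (1 + t ^+ 2) ^+ 2).
  apply: is_derive_eq (is_deriveM (is_derive_id _ _) dphi) _.
  by rewrite /GRing.scale /= -/(phi t) phiE; field.
(* As (1 - t^2)/(1 + t^2) = -1 + 2/(1 + t^2), the coordinates i and j of the rotated point are
   combinations of 1, 1/(1 + t^2) and t/(1 + t^2). *)
have comb (a b c : R) : is_derive (t : R^o) (1 : R^o) (fun r : R^o => a + b * phi r + c * M r : R^o)
    (b * (- (2 * t) / (1 + t ^+ 2) ^+ 2) + c * ((1 - t ^+ 2) / (1 + t ^+ 2) ^+ 2)).
  have : is_derive (t : R^o) (1 : R^o) (cst a + b \*: phi + c \*: M) 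
    (0 + b *: (- (2 * t) / (1 + t ^+ 2) ^+ 2 : R^o) + c *: ((1 - t ^+ 2) / (1 + t ^+ 2) ^+ 2 : R^o)).
    by apply: is_deriveD.
  by rewrite add0r.
set v : E := (X in is_derive _ _ _ X).
have dk k : is_derive (t : R^o) (1 : R^o) (fun t : R^o => plane_rot i j t x 0 k : R^o) (v 0 k).
  rewrite /v.
  have t1 (r : R) : 1 + r ^+ 2 != 0 by rewrite gt_eqF// ltr_pwDl// sqr_ge0.
  have [->|ki] := eqVneq k i.
    rewrite (_ : (fun _ => _) = fun r : R^o => - x 0 i + 2 * x 0 i * phi r + (- 2 * x 0 j) * M r : R^o).
      apply: is_derive_eq (comb _ _ _) _.
      by rewrite !rotE// !mxE !eqxx ji ?(negbTE ij) /=; field.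
    by apply/funext => r; rewrite rotE// eqxx ME phiE; field; exact: t1.
  have [->|kj] := eqVneq k j.
    rewrite (_ : (fun _ => _) = fun r : R^o => - x 0 j + 2 * x 0 j * phi r + (2 * x 0 i) * M r : R^o).
      apply: is_derive_eq (comb _ _ _) _.
      by rewrite !rotE// !mxE !eqxx ji ?(negbTE ij) /=; field.
    by apply/funext => r; rewrite rotE// ji eqxx ME phiE; field; exact: t1.
  rewrite (_ : (fun _ => _) = cst (x 0 k)).
    apply: is_derive_eq.
    by rewrite !rotE// !mxE (negbTE ki) (negbTE kj) /= !mulr0 subr0 mulr0.
  by apply/funext => r; rewrite rotE// (negbTE ki) (negbTE kj).
have dr : derivable (fun t : R^o => plane_rot i j t x) t 1.
  by apply/derivable_mxP => a k; rewrite [a]ord1; by have [] := dk k.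
apply: DeriveDef => //; rewrite derive_mx//; apply/rowP => k; rewrite mxE.
by have [_ ->] := dk k.
Qed.

Lemma is_derive_comp_curve (V W : normedModType R) (c : R^o -> V) (f : V -> W) (t : R^o) v :
  is_derive t (1 : R^o) c v -> differentiable f (c t) ->
  is_derive t (1 : R^o) (f \o c) ('D_v f (c t)).
Proof.
move=> [dc <-] df; have dc' : differentiable c t by exact/derivable1_diffP.
apply: DeriveDef; first by apply: diff_derivable; exact: differentiable_comp.
by rewrite !deriveE//; [rewrite diff_comp|exact: differentiable_comp].
Qed.

Definition rotation_field (i j : 'I_m.+1) (f : E -> R) (x : E) : R :=
  x 0 i * partial j f x - x 0 j * partial i f x.

Lemma is_derive_plane_rot_comp i j (t : R) (x : E) (f : E -> R) : i != j ->
  differentiable (f : E -> R^o) (plane_rot i j t x) ->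
  is_derive (t : R^o) (1 : R^o) (fun t => f (plane_rot i j t x) : R^o)
    (2 / (1 + t ^+ 2) * rotation_field i j f (plane_rot i j t x)).
Proof.
move=> ij df.
apply: is_derive_eq (@is_derive_comp_curve E R^o _ f t _ (is_derive_rot t x ij) df) _.
rewrite deriveE// linearZ_LR linearB !linearZ_LR /rotation_field /dird !deriveE//=.
by rewrite /GRing.scale /= mulrN.
Qed.

Lemma Ckr_coordinate k (U : set E) i : open U -> Ckr k U (fun x : E => x 0 i).
Proof. by move=> oU; apply: Ckr_coord => //; exact: Ck_id. Qed.

Lemma Ckr_rotation_field k i j (f : E -> R) : Ckr k.+1 E0 f ->
  Ckr k E0 (rotation_field i j f).
Proof.
have oE := @open_neq0 R m => cf; apply: Ckr_add => //.
  by apply: Ckr_mul => //; [exact: Ckr_coordinate|exact: Ckr_dird].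
apply: Ckr_opp => //.
by apply: Ckr_mul => //; [exact: Ckr_coordinate|exact: Ckr_dird].
Qed.

Lemma sphere_int_rotation_field i j (f : E -> R) : Ckr 1 E0 f ->
  sphere_int (rotation_field i j f) = 0.
Proof.
move=> cf; have cK := @Ckr_rotation_field 0 i j f cf.
have [<-|ij] := eqVneq i j.
  rewrite (_ : rotation_field i i f = fun=> 0 * 0).
    by rewrite (@sphere_intZ R m 0 (fun=> 0)) ?mul0r//; exact: Ckr_cst.
  by apply/funext => x; rewrite mul0r /rotation_field subrr.
have cf0 := Ckr_pred cf.
have cjoint (g : E -> R) : Ckr 0 E0 g -> forall u : R^o * E, u.2 != 0 ->
    {for u, continuous (fun u : R^o * E => g (plane_rot i j u.1 u.2) : R^o)}.
  move=> cg u u0.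
  apply: (@continuous_comp _ _ _ (fun u : R^o * E => plane_rot i j u.1 u.2) (g : E -> R^o)).
    exact: (@Ck_rot 0 i j ij u).
  by apply: cg; exact: rot_neq0.
have crot (g : E -> R) t : Ckr 0 E0 g -> Ckr 0 E0 (fun x => g (plane_rot i j t x)).
  move=> cg x x0.
  apply: (@continuous_comp _ _ _ (fun x => (t, x) : R^o * E)
    (fun u : R^o * E => g (plane_rot i j u.1 u.2) : R^o)).
    apply: differentiable_continuous; apply: (@differentiable_pair R E R^o E (cst t) id).
      exact: differentiable_cst.
    exact: ex_diff.
  exact: cjoint.
have HD : is_derive (0 : R^o) (1 : R^o)
    (fun t : R^o => sphere_int (fun x => f (plane_rot i j t x)) : R^o)
    (sphere_int (fun x => 2 / (1 + (0 : R) ^+ 2) * rotation_field i j f (plane_rot i j 0 x))).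
  apply: (@derive_sphere_int R m (fun t x => f (plane_rot i j t x))
    (fun t x => 2 / (1 + (t : R) ^+ 2) * rotation_field i j f (plane_rot i j t x)) 1).
  - by move=> t _; exact: crot.
  - move=> t x _ sx; apply: is_derive_plane_rot_comp => //.
    apply: (Ckr_differentiable cf); apply: rot_neq0 => //; exact: sphere_neq0.
  - move=> u [_ u0]; apply: (@continuousM _ _ (fun u : R^o * E => 2 / (1 + (u.1 : R) ^+ 2) : R)
        (fun u : R^o * E => rotation_field i j f (plane_rot i j u.1 u.2) : R)); last exact: cjoint.
    have h : Ckr 0 [set: R^o * E] (fun u : R^o * E => 2 * (1 + (u.1 : R) ^+ 2)^-1).
      have oT := @openT (R^o * E)%type.
      have c1 : Ckr 0 setT (fun u : R^o * E => u.1 : R) by exact: Ck_fst.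
      apply: Ckr_mul => //; [exact: Ckr_cst|apply: Ckr_inv => // [v _|]].
        by rewrite ltr_pwDl// sqr_ge0.
      by apply: Ckr_add => //; [exact: Ckr_cst|exact: Ckr_sqr].
    exact: (h u).
  - by rewrite normr0.
have rot0 x : plane_rot i j 0 x = x.
  apply/rowP => k; rewrite rotE// expr0n /= !mulr0 subr0 addr0 !mul0r !mul1r subr0 add0r !divr1.
  by have [->|] := eqVneq k i => //; have [->|] := eqVneq k j.
have Ic : (fun t : R^o => sphere_int (fun x => f (plane_rot i j t x)) : R^o) = cst (sphere_int f).
  by apply/funext => t; apply: sphere_int_rot => //; exact: crot.
have [_] := HD; rewrite Ic derive_cst.
rewrite (_ : (fun x => _) = fun x => 2 * rotation_field i j f x); last first.
  by apply/funext => x; rewrite rot0 expr0n /= addr0 divr1.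
rewrite sphere_intZ// => /esym/eqP; rewrite mulf_eq0 pnatr_eq0 /=.
by move/eqP.
Qed.

Lemma sphere_int_sum n (f : 'I_n -> E -> R) : (forall i, Ckr 0 E0 (f i)) ->
  sphere_int (fun x => \sum_i f i x) = \sum_i sphere_int (f i).
Proof.
have oE := @open_neq0 R m.
elim: n f => [|n IH] f cf.
  under eq_fun do rewrite big_ord0.
  rewrite big_ord0 (_ : (fun=> 0) = fun=> 0 * 0); last by apply/funext => x; rewrite mul0r.
  by rewrite (@sphere_intZ R m 0 (fun=> 0)) ?mul0r//; exact: Ckr_cst.
under eq_fun do rewrite big_ord_recr /=.
rewrite sphere_intD//; last exact: Ckr_sum.
by rewrite IH// big_ord_recr.
Qed.

Lemma dird_coordinate i j (x : E) :
  dird (delta_mx 0 i : E) (fun y => y 0 j) x = (i == j)%:R.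
Proof.
rewrite (@dird_coord R E m.+1 id) ?derive_id; last exact: ex_diff.
by rewrite mxE eqxx eq_sym.
Qed.

(* Summing the vanishing integrals of the rotation fields applied to x_i a_j. *)
Lemma sphere_int_div (a : 'I_m.+1 -> E -> R) : (forall j, Ckr 1 E0 (a j)) ->
  sphere_int (fun x => \sum_j partial j (a j) x
    - \sum_i \sum_j x 0 i * x 0 j * partial i (a j) x
    - m%:R * \sum_j x 0 j * a j x) = 0.
Proof.
have oE := @open_neq0 R m => ca.
pose g i j (x : E) : R := x 0 i * a j x.
have cx i : Ckr 1 E0 (fun x : E => x 0 i) by exact: Ckr_coordinate.
have cg i j : Ckr 1 E0 (g i j) by exact: Ckr_mul.
pose F (x : E) : R := \sum_i \sum_j rotation_field i j (g i j) x.
have cK i j : Ckr 0 E0 (rotation_field i j (g i j)) by exact: Ckr_rotation_field.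
have cpa i j : Ckr 0 E0 (partial i (a j)) by exact: Ckr_dird.
have ca0 j : Ckr 0 E0 (a j) by exact: Ckr_pred.
have cx0 i : Ckr 0 E0 (fun x : E => x 0 i) by exact: Ckr_coordinate.
rewrite (@eq_sphere_int R m _ F); first last.
- move=> x sx; rewrite /F.
  have x0 := sphere_neq0 sx.
  (* The Kronecker symbol comes from D_j x_i. After summation the first term gives the sum of the
     x_j a_j once and the third removes it m + 1 times, whence the factor m; in the second, the
     squares of the x_i add up to 1 and leave the divergence. *)
  have E1 i j : rotation_field i j (g i j) x =
    (i == j)%:R * x 0 i * a j x + x 0 i * x 0 i * partial j (a j) x - x 0 j * a j x
    - x 0 i * x 0 j * partial i (a j) x.
    rewrite /rotation_field /g !(dirdM _ (cx i) (ca j) x0) !dird_coordinate eqxx.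
    rewrite eq_sym mulr1n.
    by move: (partial j (a j) x) (partial i (a j) x) => p q; ring.
  under [in RHS]eq_bigr => i _ do under eq_bigr => j _ do rewrite E1.
  under [in RHS]eq_bigr => i _ do rewrite !sumrB big_split /=.
  rewrite !sumrB big_split /= sumr_const card_ord.
  have -> : \sum_i \sum_j (i == j)%:R * x 0 i * a j x = \sum_j x 0 j * a j x.
    apply: eq_bigr => i _; rewrite (bigD1 i)//= eqxx mul1r big1 ?addr0// => j.
    by rewrite eq_sym => /negbTE ->; rewrite !mul0r.
  have S : \sum_i \sum_j x 0 i * x 0 i * partial j (a j) x = \sum_j partial j (a j) x.
    under eq_bigr do rewrite -mulr_sumr.
    by rewrite -mulr_suml -[X in X * _]/(dot x x) sx mul1r.
  rewrite [X in _ = _ + X - _ - _]S mulrSr -mulr_natl.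
  by move: (\sum_j _) (\sum_i _) (\sum_j _) => A B C; ring.
- by apply: Ckr_sum => // i; exact: Ckr_sum.
rewrite sphere_int_sum => [|i]; last exact: Ckr_sum.
rewrite big1// => i _; rewrite sphere_int_sum// big1// => j _.
exact: sphere_int_rotation_field.
Qed.

End divergence.

(** * Functions of time and position *)

Section slices.
Context {R : realType} {m : nat}.
Local Notation E := 'rV[R]_m.+1.
Local Notation E0 := [set x : E | x != 0].
Local Notation TE := (R^o * E)%type.
Implicit Types W : normedModType R.

Lemma open_tube (T : normedModType R) (e : R) :
  open [set u : T * E | `|u.1| < e /\ u.2 != 0].
Proof.
rewrite (_ : [set u : T * E | _] = (fst @^-1` [set t : T | `|t| < e]) `&` (snd @^-1` E0)) //.
apply: openI; apply: open_comp => //.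
- by move=> ? _; exact: cvg_fst.
- rewrite (_ : [set t : T | `|t| < e] = ball (0 : T) e); first exact: ball_open.
  by rewrite -ball_normE; apply/seteqP; split => t; rewrite /= sub0r normrN.
- by move=> ? _; exact: cvg_snd.
- exact: open_neq0.
Qed.

Definition cylinder (e : R) : set TE := [set u : TE | `|u.1| < e /\ u.2 != 0].

Lemma open_cylinder e : open (cylinder e).
Proof. exact: open_tube. Qed.

Lemma derive_slice_x W (f : TE -> W) (t : R^o) (x v : E) :
  'D_v (fun y => f (t, y)) x = 'D_((0, v) : TE) f (t, x).
Proof.
suff H : (fun h : R => h^-1 *: (((fun y => f (t, y)) \o shift x) (h *: v) - f (t, x))) =
    (fun h => h^-1 *: ((f \o shift ((t, x) : TE)) (h *: ((0, v) : TE)) - f (t, x))).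
  by rewrite /derive H.
by apply/funext => h /=; congr (_ *: (f (_, _) - _)); rewrite /= ?scaler0 ?mulr0 ?add0r.
Qed.

Lemma derive_slice_t W (f : TE -> W) (t : R^o) (x : E) :
  'D_(1 : R^o) (fun s : R^o => f (s, x)) t = 'D_((1, 0) : TE) f (t, x).
Proof.
suff H : (fun h : R => h^-1 *: (((fun s : R^o => f (s, x)) \o shift t) (h *: (1 : R^o)) - f (t, x))) =
    (fun h => h^-1 *: ((f \o shift ((t, x) : TE)) (h *: ((1, 0) : TE)) - f (t, x))).
  by rewrite /derive H.
by apply/funext => h /=; congr (_ *: (f (_, _) - _)); rewrite /= ?scaler0 ?mulr0 ?add0r.
Qed.

Lemma is_derive_slice_t e (f : TE -> R) (t : R^o) (x : E) :
  Ckr 1 (cylinder e) f -> cylinder e (t, x) ->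
  is_derive t (1 : R^o) (fun s : R^o => f (s, x) : R^o) (dird ((1, 0) : TE) f (t, x)).
Proof.
move=> cf tx; have df := Ckr_differentiable cf tx.
rewrite /dird -derive_slice_t; apply: DeriveDef => //.
apply: diff_derivable.
by apply: (@differentiable_comp _ _ _ _ (fun s : R^o => (s, x) : TE) (f : TE -> R^o)).
Qed.

Lemma partial_slice (f : TE -> R) (t : R^o) (x : E) i :
  partial i (fun y => f (t, y)) x = dird ((0, delta_mx 0 i) : TE) f (t, x).
Proof. exact: derive_slice_x. Qed.

Lemma dird_slice_t (f : TE -> R) (t : R^o) (x : E) :
  'D_(1 : R^o) (fun s : R^o => f (s, x) : R^o) t = dird ((1, 0) : TE) f (t, x).
Proof. exact: derive_slice_t. Qed.

Lemma Ck_slice_x W k e (f : TE -> W) (t : R) : `|t| < e ->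
  Ck k (cylinder e) f -> Ck k E0 (fun x => f (t, x)).
Proof.
move=> te; elim: k f => [|k IH] f.
  move=> cf x x0; apply: (@continuous_comp _ _ _ (fun x => (t, x) : TE) f).
    apply: differentiable_continuous; apply: (@differentiable_pair _ E R^o E (cst t) id).
      exact: differentiable_cst.
    exact: ex_diff.
  by apply: cf.
move=> [df Df]; split=> [x x0|v].
  apply: (@differentiable_comp _ _ _ _ (fun x => (t, x) : TE) f); last exact: df.
  apply: (@differentiable_pair _ E R^o E (cst t) id); first exact: differentiable_cst.
  exact: ex_diff.
suff -> : (fun x => 'D_v (fun y => f (t, y)) x) = (fun x => 'D_((0, v) : TE) f (t, x)).
  exact: IH (Df _).
by apply/funext => x; exact: derive_slice_x.
Qed.

Lemma Ckr_slice_x k e (f : TE -> R) (t : R) : `|t| < e ->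
  Ckr k (cylinder e) f -> Ckr k E0 (fun x => f (t, x)).
Proof. exact: Ck_slice_x. Qed.

Lemma radialK (x : E) : radial (radial x) = radial x.
Proof.
have [->|x0] := eqVneq x 0; last by rewrite radial_id//; exact: radial_sphere.
by rewrite /radial !scaler0.
Qed.

Lemma sphere_int_hext (f : E -> R) : sphere_int (hext f) = sphere_int f.
Proof.
rewrite /sphere_int; congr (_ * _); apply: eq_Rintegral => t _.
by rewrite /hext /= radialK.
Qed.

Lemma continuous_radial_snd e (H : R^o -> E -> R) (t : R) (x : E) : `|t| < e -> x != 0 ->
  {for ((t, radial x) : TE), continuous (fun u : TE => H u.1 u.2 : R^o)} ->
  {for ((t, x) : TE), continuous (fun u : TE => hext (H u.1) u.2 : R^o)}.
Proof.
move=> te x0 cH.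
apply: (@continuous_comp _ _ _ (fun u : TE => (u.1, radial u.2) : TE) (fun u => H u.1 u.2 : R^o)) => //.
have cr : Ck 1 (cylinder e) (fun u : TE => radial u.2).
  apply: (@Ck_sub _ _ _ _ (snd @^-1` E0)) => [u []//|].
  apply: (@Ck_comp_linear R TE E E 1 E0 snd (@radial R m)); last exact: Ck_radial.
  by move=> ?; exact: cvg_snd.
have [dr _] := cr; apply: differentiable_continuous.
apply: (@differentiable_pair _ TE R^o E fst (fun u => radial u.2)); last by apply: dr.
by have [d _] := @Ck_fst R R^o E 1 setT; exact: d.
Qed.

(* Only the values at the points of the sphere matter for the integrals. *)
Lemma derive_sphere_int_on (G w : R^o -> E -> R) (e : R) :
  (forall (t : R) x, `|t| < e -> sphere x ->
     {for ((t, x) : TE), continuous (fun u : TE => G u.1 u.2 : R^o)}) ->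
  (forall (t : R) x, `|t| < e -> sphere x ->
     is_derive (t : R^o) (1 : R^o) (fun t => G t x : R^o) (w t x)) ->
  (forall (t : R) x, `|t| < e -> sphere x ->
     {for ((t, x) : TE), continuous (fun u : TE => w u.1 u.2 : R^o)}) ->
  forall t : R, `|t| < e ->
    is_derive (t : R^o) (1 : R^o) (fun t => sphere_int (G t) : R^o) (sphere_int (w t)).
Proof.
move=> cG dG cw t te.
have crad (H : R^o -> E -> R) : (forall (t : R) x, `|t| < e -> sphere x ->
     {for ((t, x) : TE), continuous (fun u : TE => H u.1 u.2 : R^o)}) ->
    Ckr 0 (cylinder e) (fun u => hext (H u.1) u.2).
  move=> cH [s x] [/= se x0]; apply: (continuous_radial_snd se x0).
  by apply: cH => //; exact: radial_sphere.
rewrite -sphere_int_hext.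
rewrite (_ : (fun t => sphere_int (G t) : R^o) = fun t => sphere_int (hext (G t)) : R^o); last first.
  by apply/funext => s; rewrite sphere_int_hext.
apply: (@derive_sphere_int R m (fun t => hext (G t)) (fun t => hext (w t)) e) => //.
- by move=> s se; apply: (@Ckr_slice_x 0 e (fun u => hext (G u.1) u.2) s se); exact: crad.
- by move=> s x se sx; rewrite /hext /= radial_id//; exact: dG.
- exact: crad.
Qed.

(** Dividing by [q t] replaces the exponent p - 2, which would be truncated for small natural
    numbers p. *)
Lemma is_derive_sqrtX (q : R^o -> R) (t : R^o) (q' : R) (p : nat) : 0 < q t ->
  is_derive t (1 : R^o) (q : R^o -> R^o) q' ->
  is_derive t (1 : R^o) (fun s => Num.sqrt (q s) ^+ p : R^o)
    (p%:R / 2 * Num.sqrt (q t) ^+ p * q' / q t).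
Proof.
move=> q0 dq.
have s0 : Num.sqrt (q t) != 0 by rewrite gt_eqF// sqrtr_gt0.
have ds : is_derive t (1 : R^o) (fun s => Num.sqrt (q s) : R^o) (q' / (2 * Num.sqrt (q t))).
  have h : is_derive (q t : R^o) (1 : R^o) (fun x : R^o => Num.sqrt x : R^o) (2 * Num.sqrt (q t))^-1.
    exact: is_derive1_sqrt.
  have [dq1 dq2] := dq; have [h1 _] := h.
  have dq3 : differentiable (q : R^o -> R^o) t by exact/derivable1_diffP.
  apply: DeriveDef.
    apply: diff_derivable; apply: (@differentiable_comp _ _ _ _ (q : R^o -> R^o) (fun x : R^o => Num.sqrt x : R^o)) => //.
    exact/derivable1_diffP.
  by rewrite (derive_comp1 _ dq3 h) dq2 mulrC.
have -> : (fun s => Num.sqrt (q s) ^+ p : R^o) = ((fun s => Num.sqrt (q s)) : R^o -> R^o) ^+ p.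
  by rewrite exprfctE.
apply: is_derive_eq (is_deriveX p ds) _.
have -> : p%:R / 2 * Num.sqrt (q t) ^+ p * q' / q t =
    p%:R / 2 * Num.sqrt (q t) ^+ p * q' / Num.sqrt (q t) ^+ 2.
  by rewrite sqr_sqrtr// ltW.
rewrite /GRing.scale /=; move: (Num.sqrt (q t)) s0 => s s0.
case: p => [|p]; first by rewrite !mul0r.
by rewrite /= exprS; field.
Qed.

Lemma is_derive_quotient (a b c : R^o -> R) (t : R^o) (l a' b' c' : R) : c t != 0 ->
  is_derive t (1 : R^o) (a : R^o -> R^o) a' ->
  is_derive t (1 : R^o) (b : R^o -> R^o) b' ->
  is_derive t (1 : R^o) (c : R^o -> R^o) c' ->
  is_derive t (1 : R^o) (fun s => l * a s * b s / c s : R^o)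
    (l * ((a' * b t + a t * b') * c t - a t * b t * c') / c t ^+ 2).
Proof.
move=> c0 da db dc.
have dab : is_derive t (1 : R^o) ((a : R^o -> R^o) * (b : R^o -> R^o))
    (a t *: (b' : R^o) + b t *: (a' : R^o)) by exact: is_deriveM.
have dci := is_deriveV c0 dc.
have dlab := is_deriveM (is_deriveZ l dab) dci.
have -> : (fun s => l * a s * b s / c s : R^o) =
    (l \*: ((a : R^o -> R^o) * (b : R^o -> R^o))) * (fun s => (c s)^-1 : R^o).
  by apply/funext => s; rewrite -[RHS]/(l * (a s * b s) * (c s)^-1) mulrA.
apply: is_derive_eq dlab _.
rewrite -[LHS]/((l * (a t * b t)) * (- (c t) ^- 2 * c') +
  (c t)^-1 * (l * (a t * b' + b t * a'))).
by field.
Qed.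

(** Euler's relation in degree 0: g is constant along the ray through x, so its derivative in the
    direction x vanishes. *)
Lemma homogeneous_partial (g : E -> R) (x : E) : Ckr 1 E0 g ->
  (forall (c : R) y, 0 < c -> g (c *: y) = g y) -> x != 0 ->
  \sum_i x 0 i * partial i g x = 0.
Proof.
move=> cg gh x0; have dg := Ckr_differentiable cg x0.
transitivity ('D_x (g : E -> R^o) x).
  by rewrite (derive_sum_delta x dg).
have dg0 : differentiable (g : E -> R^o) (x + (0 : R) *: x) by rewrite scale0r addr0.
have [_] := is_derive_line dg0; rewrite scale0r addr0 => <-.
rewrite (@near_eq_derive _ _ _ _ (cst (g x) : R^o -> R^o)) ?derive_cst//.
near=> r; rewrite /cst -{1}[x]scale1r -scalerDl gh//.
rewrite -ltrBlDl sub0r; near: r.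
by apply: open_nbhs_nbhs; split; [exact: open_gt|rewrite /= ltrN10].
Unshelve. all: by end_near. Qed.

End slices.

(** * Yano's formula *)

Section pointwise_identity.
Context {R : realFieldType} {m : nat}.
Local Notation n := m.+1.
(** The values at a point x of the sphere: v is a tangent field extended with degree 0 and b i j
    stands for D_i v_j. Then [xb] is Euler's relation, and [bx] is the derivative of the tangency
    condition [xv]. *)
Variables (b : 'I_n -> 'I_n -> R) (x v : 'I_n -> R).
Hypothesis m0 : m%:R != 0 :> R.
Hypothesis xx : \sum_i x i * x i = 1.
Hypothesis xv : \sum_i x i * v i = 0.
Hypothesis xb : forall j, \sum_i x i * b i j = 0.
Hypothesis bx : forall i, \sum_j b i j * x j = - v i.

Let D := \sum_i b i i.
Let P i j := (i == j)%:R - x i * x j.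
Let S i j := b i j + b j i.
Let N i j := x i * v j + v i * x j.

(* The conformal Killing operator, corrected by the normal components N. *)
Definition conformal_part i j : R :=
  (b i j + b j i) + (x i * v j + v i * x j)
  - (2 * (\sum_k b k k) / m%:R) * ((i == j)%:R - x i * x j).

Let vx : \sum_i v i * x i = 0.
Proof. by rewrite -[RHS]xv; apply: eq_bigr => i _; rewrite mulrC. Qed.

Let sum_delta (F : 'I_n -> 'I_n -> R) :
  \sum_i \sum_j F i j * (i == j)%:R = \sum_i F i i.
Proof.
apply: eq_bigr => i _; rewrite (bigD1 i)//= eqxx mulr1 big1 ?addr0// => j.
by rewrite eq_sym => /negbTE ->; rewrite mulr0.
Qed.

Let sumM (f g : 'I_n -> R) : \sum_i \sum_j f i * g j = (\sum_i f i) * (\sum_j g j).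
Proof. by rewrite mulr_suml; apply: eq_bigr => i _; rewrite mulr_sumr. Qed.

Let SS : \sum_i \sum_j S i j ^+ 2 =
  2 * (\sum_i \sum_j b i j ^+ 2 + \sum_i \sum_j b i j * b j i).
Proof.
have -> : \sum_i \sum_j S i j ^+ 2 =
    \sum_i \sum_j b i j ^+ 2 + 2 * (\sum_i \sum_j b i j * b j i)
    + \sum_i \sum_j b j i ^+ 2.
  rewrite mulr_sumr -!big_split; apply: eq_bigr => i _ /=.
  rewrite mulr_sumr -!big_split; apply: eq_bigr => j _ /=.
  by rewrite /S; ring.
rewrite [X in _ + X]exchange_big /=; ring.
Qed.

Let xbv : \sum_i \sum_j x i * b i j * v j = 0.
Proof.
rewrite exchange_big big1// => j _.
by rewrite -mulr_suml xb mul0r.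
Qed.

Let vbx : \sum_i \sum_j v i * b i j * x j = - \sum_i v i ^+ 2.
Proof.
rewrite -sumrN; apply: eq_bigr => i _.
under eq_bigr do rewrite -mulrA.
by rewrite -mulr_sumr bx mulrN expr2.
Qed.

Let SN : \sum_i \sum_j S i j * N i j = - 2 * \sum_i v i ^+ 2.
Proof.
have -> : \sum_i \sum_j S i j * N i j =
    (\sum_i \sum_j x i * b i j * v j + \sum_i \sum_j v i * b i j * x j)
    + (\sum_i \sum_j v j * b j i * x i + \sum_i \sum_j x j * b j i * v i).
  rewrite -!big_split; apply: eq_bigr => i _ /=.
  rewrite -!big_split; apply: eq_bigr => j _ /=.
  by rewrite /S /N; ring.
rewrite xbv vbx (exchange_big_dep xpredT)//= vbx (exchange_big_dep xpredT)//= xbv; ring.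
Qed.

Let NN : \sum_i \sum_j N i j ^+ 2 = 2 * \sum_i v i ^+ 2.
Proof.
have -> : \sum_i \sum_j N i j ^+ 2 =
    \sum_i \sum_j (x i * x i) * v j ^+ 2 + 2 * (\sum_i \sum_j (x i * v i) * (x j * v j))
    + \sum_i \sum_j v i ^+ 2 * (x j * x j).
  rewrite mulr_sumr -!big_split; apply: eq_bigr => i _ /=.
  rewrite mulr_sumr -!big_split; apply: eq_bigr => j _ /=.
  by rewrite /N; ring.
by rewrite !sumM xx xv; ring.
Qed.

Let SP : \sum_i \sum_j S i j * P i j = 2 * D.
Proof.
have -> : \sum_i \sum_j S i j * P i j =
    \sum_i \sum_j S i j * (i == j)%:R
    - (\sum_i \sum_j x i * b i j * x j + \sum_i \sum_j x j * b j i * x i).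
  rewrite -big_split -sumrB; apply: eq_bigr => i _ /=.
  rewrite -big_split -sumrB; apply: eq_bigr => j _ /=.
  by rewrite /S /P; ring.
rewrite sum_delta [X in _ - (_ + X)]exchange_big /=.
have -> : \sum_i \sum_j x i * b i j * x j = 0.
  by rewrite exchange_big big1// => j _; rewrite -mulr_suml xb mul0r.
by rewrite addr0 subr0 /S big_split /= -/D; ring.
Qed.

Let NP : \sum_i \sum_j N i j * P i j = 0.
Proof.
have -> : \sum_i \sum_j N i j * P i j =
    \sum_i \sum_j N i j * (i == j)%:R
    - (\sum_i \sum_j (x i * x i) * (x j * v j) + \sum_i \sum_j (x i * v i) * (x j * x j)).
  rewrite -big_split -sumrB; apply: eq_bigr => i _ /=.
  rewrite -big_split -sumrB; apply: eq_bigr => j _ /=.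
  by rewrite /N /P; ring.
by rewrite sum_delta !sumM /N big_split /= xv vx; ring.
Qed.

(** The matrix is the orthogonal projection onto the tangent space at x; being symmetric and
    idempotent, it has squared norm equal to its trace, the dimension m. *)
Lemma proj_sqr : \sum_i \sum_j ((i == j)%:R - x i * x j) ^+ 2 = m%:R.
Proof.
have -> : \sum_i \sum_j ((i == j)%:R - x i * x j) ^+ 2 =
    \sum_(i < n) \sum_(j < n) 1 * (i == j)%:R - 2 * (\sum_i \sum_j (x i * x j) * (i == j)%:R)
    + \sum_i \sum_j (x i * x i) * (x j * x j).
  rewrite mulr_sumr -sumrB -!big_split; apply: eq_bigr => i _ /=.
  rewrite mulr_sumr -sumrB -!big_split; apply: eq_bigr => j _ /=.
  by case: (i == j) => /=; ring.
rewrite !sum_delta !sumM xx sumr_const card_ord mulrSr; ring.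
Qed.

(** S has the normal component S x = - v, and S + N is its tangential part; subtracting 2 D/m times
    the projection P makes it trace-free. Expanding, half of the square is |b|^2 + tr b^2 - |v|^2 -
    2 D^2/m. The last parenthesis on the right is the integrand of Yano's formula, kept apart
    because its integral vanishes. *)
Lemma conformal_part_sqr (q : R) :
  2^-1 * \sum_i \sum_j conformal_part i j ^+ 2 + (q / m%:R - 1) * D ^+ 2 =
  (q - 2) / m%:R * D ^+ 2 + \sum_i \sum_j b i j ^+ 2 - m%:R * (\sum_i v i ^+ 2)
  + (\sum_i \sum_j b i j * b j i - D ^+ 2 + (m%:R - 1) * \sum_i v i ^+ 2).
Proof.
have expand (c : R) : \sum_i \sum_j (S i j + N i j - c * P i j) ^+ 2 =
    \sum_i \sum_j S i j ^+ 2 + \sum_i \sum_j N i j ^+ 2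
    + c ^+ 2 * (\sum_i \sum_j P i j ^+ 2)
    + 2 * (\sum_i \sum_j S i j * N i j)
    - 2 * c * (\sum_i \sum_j S i j * P i j)
    - 2 * c * (\sum_i \sum_j N i j * P i j).
  rewrite !mulr_sumr -!big_split -!sumrB; apply: eq_bigr => i _ /=.
  rewrite !mulr_sumr -!big_split -!sumrB; apply: eq_bigr => j _ /=.
  by move: (S i j) (N i j) (P i j) => s u w; ring.
have -> : \sum_i \sum_j conformal_part i j ^+ 2 =
    \sum_i \sum_j (S i j + N i j - (2 * D / m%:R) * P i j) ^+ 2 by [].
rewrite expand SS NN proj_sqr SN SP NP.
by move: D (\sum_i \sum_j b i j ^+ 2) (\sum_i \sum_j b i j * b j i) (\sum_i _) => d B C w; field.
Qed.

End pointwise_identity.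

(* Unfolding directional derivatives makes failing conversions diverge. *)
Opaque dird Ckr.

(** * The algebra behind Yano's formula *)

Section yano_algebra.
Context {R : comPzRingType} {n : nat}.
(** A pointwise model: w is the field, p i j stands for D_i w_j and h i k j for D_i D_k w_j. Thus
    [xp] and [xh] are Euler's relations in degrees 0 and -1, [px] is the derivative of tangency, and
    [hC] is Schwarz's theorem. Below, a models the field D_w w - (div w) w, and da i j its
    derivative D_i a_j. *)
Variables (x w : 'I_n -> R) (p : 'I_n -> 'I_n -> R) (h : 'I_n -> 'I_n -> 'I_n -> R).
Hypothesis xp : forall k, \sum_i x i * p i k = 0.
Hypothesis px : forall i, \sum_j p i j * x j = - w i.
Hypothesis xw : \sum_j x j * w j = 0.
Hypothesis xh : forall k j, \sum_i x i * h i k j = - p k j.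
Hypothesis hC : forall i k j, h i k j = h k i j.

Let D := \sum_k p k k.
Let a j := \sum_k w k * p k j - w j * D.
Let da i j := \sum_k (w k * h i k j + p k j * p i k) - (w j * (\sum_k h i k k) + D * p i j).

(** Euler's relation for a, which contains one derivative of a field of degree 0 and so has degree
    -1. *)
Lemma yano_algebra_radial j : \sum_i x i * da i j = - a j.
Proof.
have e i : x i * da i j = \sum_k w k * (x i * h i k j) + \sum_k p k j * (x i * p i k)
      - (\sum_k w j * (x i * h i k k) + D * (x i * p i j)).
  rewrite /da; move: D => d.
  rewrite mulrBr mulrDr big_split mulrDr /= !mulr_sumr.
  congr (_ + _ - (_ + _)); try (apply: eq_bigr => k _); ring.
rewrite (eq_bigr _ (fun i _ => e i)) sumrB !big_split /= -mulr_sumr xp mulr0 addr0.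
rewrite exchange_big /= [X in _ + X - _]exchange_big /= [X in _ - X]exchange_big /=.
under eq_bigr do rewrite -mulr_sumr xh mulrN.
under [X in _ + X - _]eq_bigr do rewrite -mulr_sumr xp mulr0.
under [X in _ - X]eq_bigr do rewrite -mulr_sumr xh mulrN.
rewrite big1_eq addr0 !sumrN -mulr_sumr /a /D.
by rewrite opprB opprK addrC.
Qed.

(** The second derivatives cancel: by symmetry of h, both halves of a contribute the derivative of
    div w along w. *)
Lemma yano_algebra_div : \sum_j da j j = \sum_i \sum_j p i j * p j i - D ^+ 2.
Proof.
rewrite /da; under eq_bigr do rewrite big_split /=.
rewrite sumrB !big_split /= -mulr_sumr -/D -expr2.
have -> : \sum_i \sum_k w k * h i k i = \sum_i w i * (\sum_k h i k k).
  rewrite exchange_big /=; apply: eq_bigr => k _; rewrite mulr_sumr.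
  by apply: eq_bigr => i _; rewrite hC.
rewrite opprD addrACA subrr add0r; congr (_ - _).
by rewrite exchange_big.
Qed.

Lemma yano_algebra_normal : \sum_j x j * a j = - \sum_i w i ^+ 2.
Proof.
rewrite /a; under eq_bigr do rewrite mulrBr mulr_sumr mulrA.
rewrite sumrB -mulr_suml xw mul0r subr0 exchange_big /= -sumrN.
apply: eq_bigr => k _.
under eq_bigr do rewrite mulrCA (mulrC (x _)).
by rewrite -mulr_sumr px mulrN expr2.
Qed.

(** With c = m the right-hand side is the integrand of the divergence theorem for a. The double sum
    is minus the sum of the x_j a_j, since a has degree -1, and this is what lowers c to c - 1. *)
Lemma yano_algebra (c : R) :
  \sum_i \sum_j p i j * p j i - D ^+ 2 + (c - 1) * \sum_i w i ^+ 2 =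
  \sum_j da j j - \sum_i \sum_j x i * x j * da i j - c * \sum_j x j * a j.
Proof.
have -> : \sum_i \sum_j x i * x j * da i j = \sum_i w i ^+ 2.
  rewrite exchange_big /= -[RHS]opprK -yano_algebra_normal -sumrN.
  apply: eq_bigr => j _; under eq_bigr do rewrite mulrAC mulrC.
  by rewrite -mulr_sumr yano_algebra_radial mulrN.
by rewrite yano_algebra_div yano_algebra_normal; ring.
Qed.

End yano_algebra.

Section yano.
Context {R : realType} {m : nat}.
Local Notation E := 'rV[R]_m.+1.
Local Notation E0 := [set x : E | x != 0].

Lemma partial_swap i j (f : E -> R) x : Ckr 2 E0 f -> x != 0 ->
  partial i (partial j f) x = partial j (partial i f) x.
Proof. by move=> cf x0; exact: (dird_swap _ _ open_neq0 x0 cf). Qed.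

Variable v : 'I_m.+1 -> E -> R.
Hypothesis cv : forall j, Ckr 2 E0 (v j).
Hypothesis v_homog : forall (x : E) j, x != 0 -> \sum_i x 0 i * partial i (v j) x = 0.
Hypothesis v_tangent : forall x : E, x != 0 -> \sum_j x 0 j * v j x = 0.

Let oE := @open_neq0 R m.
Let cv1 j : Ckr 1 E0 (v j). Proof. exact: Ckr_pred. Qed.
Let cp i j : Ckr 1 E0 (partial i (v j)). Proof. exact: Ckr_dird. Qed.
Let cx i : Ckr 1 E0 (fun x : E => x 0 i). Proof. exact: Ckr_coordinate. Qed.

Let sum_delta (F : 'I_m.+1 -> R) k : \sum_i F i * (k == i)%:R = F k.
Proof.
rewrite (bigD1 k)//= eqxx mulr1 big1 ?addr0// => i.
by rewrite eq_sym => /negbTE ->; rewrite mulr0.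
Qed.

(** Differentiate the tangency condition in the direction i. *)
Lemma partial_normal i (x : E) : x != 0 -> \sum_j partial i (v j) x * x 0 j = - v i x.
Proof.
move=> x0.
have H : partial i (fun y => \sum_j y 0 j * v j y) x = 0.
  by rewrite (dird_eq _ oE x0 v_tangent) dird_cst.
have S := @dird_sum R E E0 m.+1 (fun j y => y 0 j * v j y) x (delta_mx 0 i) oE
  (fun j => Ckr_mul oE (cx j) (cv1 j)) x0.
have e j : partial i (fun y => y 0 j * v j y) x =
    partial i (v j) x * x 0 j + v j x * (i == j)%:R.
  by rewrite (dirdM _ (cx j) (cv1 j) x0) dird_coordinate mulrC.
move: H; rewrite S (eq_bigr _ (fun j _ => e j)) big_split /= sum_delta.
by move/eqP; rewrite addr_eq0 => /eqP.
Qed.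

(** Differentiate Euler's relation in the direction k and exchange the two derivatives. *)
Lemma partial2_radial k j (x : E) : x != 0 ->
  \sum_i x 0 i * partial i (partial k (v j)) x = - partial k (v j) x.
Proof.
move=> x0.
have H : partial k (fun y => \sum_i y 0 i * partial i (v j) y) x = 0.
  rewrite (@dird_eq _ _ E0 _ (fun=> 0) _ _ oE x0) ?dird_cst// => y y0.
  exact: v_homog.
have S := @dird_sum R E E0 m.+1 (fun i y => y 0 i * partial i (v j) y) x (delta_mx 0 k) oE
  (fun i => Ckr_mul oE (cx i) (cp i j)) x0.
have e i : partial k (fun y => y 0 i * partial i (v j) y) x =
    x 0 i * partial i (partial k (v j)) x + partial i (v j) x * (k == i)%:R.
  by rewrite (dirdM _ (cx i) (cp i j) x0) dird_coordinate (partial_swap k i (cv j) x0).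
move: H; rewrite S (eq_bigr _ (fun i _ => e i)) big_split /= sum_delta.
by move/eqP; rewrite addr_eq0 => /eqP.
Qed.

(* Yano's formula: the divergence theorem for the field nabla_v v - (div v) v. *)
Lemma sphere_int_yano :
  sphere_int (fun x => \sum_i \sum_j partial i (v j) x * partial j (v i) x
    - (\sum_i partial i (v i) x) ^+ 2 + (m%:R - 1) * \sum_i v i x ^+ 2) = 0.
Proof.
pose D (x : E) : R := \sum_k partial k (v k) x.
pose a i (x : E) : R := \sum_k v k x * partial k (v i) x - v i x * D x.
have cD : Ckr 1 E0 D := Ckr_sum oE (fun k => cp k k).
have cvp k i : Ckr 1 E0 (fun y => v k y * partial k (v i) y) := Ckr_mul oE (cv1 k) (cp k i).
have ca i : Ckr 1 E0 (a i) :=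
  Ckr_add oE (Ckr_sum oE (fun k => cvp k i)) (Ckr_opp oE (Ckr_mul oE (cv1 i) cD)).
have pa l i (x : E) : x != 0 -> partial l (a i) x =
    \sum_k (v k x * partial l (partial k (v i)) x + partial k (v i) x * partial l (v k) x)
    - (v i x * (\sum_k partial l (partial k (v k)) x) + D x * partial l (v i) x).
  move=> x0.
  rewrite [LHS](@dirdB _ _ _ _ _ x _ (Ckr_sum oE (fun k => cvp k i)) (Ckr_mul oE (cv1 i) cD) x0).
  rewrite (dirdM _ (cv1 i) cD x0) (dird_sum _ oE (fun k => cvp k i) x0).
  rewrite (dird_sum _ oE (fun k => cp k k) x0); congr (_ - _).
  by apply: eq_bigr => k _; rewrite (dirdM _ (cv1 k) (cp k i) x0).
have ca0 j : Ckr 0 E0 (a j) := Ckr_pred (ca j).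
have cpa i j : Ckr 0 E0 (partial i (a j)) := Ckr_dird _ (ca j).
have cx0 i : Ckr 0 E0 (fun x : E => x 0 i) := Ckr_pred (cx i).
rewrite -[RHS](sphere_int_div ca); apply: eq_sphere_int => [|x /sphere_neq0 x0].
  exact: (Ckr_add oE (Ckr_add oE (Ckr_sum oE (fun j => cpa j j))
    (Ckr_opp oE (Ckr_sum oE (fun i => Ckr_sum oE (fun j =>
       Ckr_mul oE (Ckr_mul oE (cx0 i) (cx0 j)) (cpa i j))))))
    (Ckr_opp oE (Ckr_mul oE (Ckr_cst 0 _ m%:R)
       (Ckr_sum oE (fun j => Ckr_mul oE (cx0 j) (ca0 j)))))).
have := @yano_algebra R m.+1 (fun i => x 0 i) (fun i => v i x) (fun i j => partial i (v j) x)
  (fun i k j => partial i (partial k (v j)) x) (fun k => v_homog k x0)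
  (fun i => partial_normal i x0) (v_tangent x0) (fun k j => partial2_radial k j x0)
  (fun i k j => partial_swap i k (cv j) x0) m%:R.
move=> ->; congr (_ - _ - _).
  by apply: eq_bigr => j _; rewrite (pa _ _ _ x0).
by apply: eq_bigr => i _; apply: eq_bigr => j _; rewrite (pa _ _ _ x0).
Qed.
End yano.

Section conformal_energy.
Context {R : realType} {m : nat}.
Local Notation E := 'rV[R]_m.+1.
Local Notation E0 := [set x : E | x != 0].

(* The integrand of the second variation, up to a positive factor and a
   divergence: nonnegative for p > m, and zero only for Killing fields. *)
Definition conformal_energy (p : nat) (v : 'I_m.+1 -> E -> R) (x : E) : R :=
  2^-1 * (\sum_i \sum_j conformal_part (fun i j => partial i (v j) x)
            (fun i => x 0 i) (fun i => v i x) i j ^+ 2)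
  + (p%:R / m%:R - 1) * (\sum_i partial i (v i) x) ^+ 2.

Lemma Ckr_conformal_energy p (v : 'I_m.+1 -> E -> R) : (forall j, Ckr 1 E0 (v j)) ->
  Ckr 0 E0 (conformal_energy p v).
Proof.
move=> cv; have oE := @open_neq0 R m.
have cp i j : Ckr 0 E0 (partial i (v j)) := Ckr_dird _ (cv j).
have cx i : Ckr 0 E0 (fun x : E => x 0 i) := Ckr_coordinate 0 i oE.
have cv0 i : Ckr 0 E0 (v i) := Ckr_pred (cv i).
have cD : Ckr 0 E0 (fun x => \sum_i partial i (v i) x) := Ckr_sum oE (fun i => cp i i).
have cT i j : Ckr 0 E0 (fun x => conformal_part (fun i j => partial i (v j) x)
    (fun i => x 0 i) (fun i => v i x) i j) :=
  Ckr_add oE (Ckr_add oE (Ckr_add oE (cp i j) (cp j i))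
      (Ckr_add oE (Ckr_mul oE (cx i) (cv0 j)) (Ckr_mul oE (cv0 i) (cx j))))
    (Ckr_opp oE (Ckr_mul oE
      (Ckr_mul oE (Ckr_mul oE (Ckr_cst 0 _ 2) cD) (Ckr_cst 0 _ m%:R^-1))
      (Ckr_add oE (Ckr_cst 0 _ (i == j)%:R) (Ckr_opp oE (Ckr_mul oE (cx i) (cx j)))))).
exact: (Ckr_add oE
  (Ckr_mul oE (Ckr_cst 0 _ 2^-1)
    (Ckr_sum oE (fun i => Ckr_sum oE (fun j => Ckr_sqr oE (cT i j)))))
  (Ckr_mul oE (Ckr_cst 0 _ (p%:R / m%:R - 1)) (Ckr_sqr oE cD))).
Qed.

(** For a field of degree 0, Euler's relation removes the radial term of the divergence theorem.
    What remains is the mean curvature term m <x, a>, which vanishes for tangent fields but not for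
    the acceleration. *)
Lemma sphere_int_div_homog (a : 'I_m.+1 -> E -> R) : (forall j, Ckr 1 E0 (a j)) ->
  (forall (x : E) j, x != 0 -> \sum_i x 0 i * partial i (a j) x = 0) ->
  sphere_int (fun x => \sum_j partial j (a j) x - m%:R * \sum_j x 0 j * a j x) = 0.
Proof.
move=> ca ah; have oE := @open_neq0 R m.
have cp i j : Ckr 0 E0 (partial i (a j)) := Ckr_dird _ (ca j).
have cx i : Ckr 0 E0 (fun x : E => x 0 i) := Ckr_coordinate 0 i oE.
have ca0 i : Ckr 0 E0 (a i) := Ckr_pred (ca i).
have cxa : Ckr 0 E0 (fun x => m%:R * \sum_j x 0 j * a j x) :=
  Ckr_mul oE (Ckr_cst 0 _ m%:R) (Ckr_sum oE (fun j => Ckr_mul oE (cx j) (ca0 j))).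
have cD : Ckr 0 E0 (fun x => \sum_i partial i (a i) x) := Ckr_sum oE (fun i => cp i i).
rewrite -[RHS](sphere_int_div ca); apply: eq_sphere_int => [|x /sphere_neq0 x0].
  exact: (Ckr_add oE (Ckr_add oE cD (Ckr_opp oE (Ckr_sum oE (fun i => Ckr_sum oE (fun j =>
       Ckr_mul oE (Ckr_mul oE (cx i) (cx j)) (cp i j))))))
    (Ckr_opp oE cxa)).
congr (_ - _).
suff -> : \sum_i \sum_j x 0 i * x 0 j * partial i (a j) x = 0 by rewrite subr0.
rewrite exchange_big big1//= => j _.
under eq_bigr do rewrite mulrAC mulrC.
by rewrite -mulr_sumr ah// mulr0.
Qed.

End conformal_energy.

(** * Variations of the energy *)

Section energy_variation.
Context {R : realType} {m : nat}.
Local Notation E := 'rV[R]_m.+1.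
Local Notation E0 := [set x : E | x != 0].
Local Notation TE := (R^o * E)%type.
Local Notation dt := (dird ((1, 0) : TE)).
Local Notation dx i := (dird ((0, delta_mx 0 i) : TE)).

Let oE := @open_neq0 R m.

Lemma partial_radial i j (x : E) : sphere x ->
  partial i (fun y => radial y 0 j) x = (i == j)%:R - x 0 i * x 0 j.
Proof.
move=> sx; have x0 := sphere_neq0 sx.
have cx k : Ckr 1 E0 (fun y : E => y 0 k) := Ckr_coordinate 1 k oE.
have cq : Ckr 1 E0 (fun y : E => dot y y) := Ckr_dot oE (Ck_id 1 E0) (Ck_id 1 E0).
have q0 (y : E) : E0 y -> 0 < dot y y by rewrite dot_gt0.
have cr := Ckr_rsqrt oE q0 cq.
have -> : (fun y : E => radial y 0 j) = fun y => (Num.sqrt (dot y y))^-1 * y 0 j.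
  by apply/funext => y; rewrite mxE.
rewrite (dirdM _ cr (cx j) x0) dird_coordinate (dird_rsqrt _ cq x0 (q0 _ x0)).
have -> : partial i (fun y : E => dot y y) x = 2 * x 0 i.
  rewrite (dird_sum _ oE (fun k => Ckr_mul oE (cx k) (cx k)) x0).
  rewrite (eq_bigr (fun k => 2 * x 0 k * (i == k)%:R)); last first.
    by move=> k _; rewrite (dirdM _ (cx k) (cx k) x0) dird_coordinate; ring.
  rewrite (bigD1 i)//= eqxx mulr1 big1 ?addr0// => k.
  by rewrite eq_sym => /negbTE ->; rewrite mulr0.
by rewrite sx sqrtr1 invr1 expr1n !mul1r; field.
Qed.

Variables (e : R) (f : 'I_m.+1 -> TE -> R) (p : nat).
Hypothesis m0 : (0 < m)%N.
Hypothesis e0 : 0 < e.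
Hypothesis cf : forall k j, Ckr k (cylinder e) (f j).
Hypothesis f0 : forall (y : E) j, y != 0 -> f j (0, y) = radial y 0 j.
Hypothesis f1 : forall t (x : E), `|t| < e -> x != 0 -> \sum_j f j (t, x) ^+ 2 = 1.
Hypothesis fZ : forall t (c : R) (x : E) j, 0 < c -> f j (t, c *: x) = f j (t, x).

Let oU := @open_cylinder R m e.
Let U0 (x : E) : x != 0 -> cylinder e ((0, x) : TE).
Proof. by move=> x0; split; rewrite /= ?normr0. Qed.

(** In h and k the time derivatives are taken first, so that at time 0 they are the space
    derivatives of the velocity and of the acceleration; Schwarz's theorem in [dtg] and [dth] brings
    the derivatives of g into this form. *)
Let g i j := dx i (f j).
Let h i j := dx i (dt (f j)).
Let k i j := dx i (dt (dt (f j))).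

Let cg l i j : Ckr l (cylinder e) (g i j) := Ckr_dird _ (cf l.+1 j).
Let cft l j : Ckr l (cylinder e) (dt (f j)) := Ckr_dird _ (cf l.+1 j).
Let cftt l j : Ckr l (cylinder e) (dt (dt (f j))) := Ckr_dird _ (cft l.+1 j).
Let ch l i j : Ckr l (cylinder e) (h i j) := Ckr_dird _ (cft l.+1 j).

(* The squared norm of the differential, on the sphere. *)
Definition energy_density (u : TE) : R := \sum_i \sum_j dx i (f j) u ^+ 2.
Local Notation Q := energy_density.

Let cQ l : Ckr l (cylinder e) Q :=
  Ckr_sum oU (fun i => Ckr_sum oU (fun j => Ckr_sqr oU (cg l i j))).

Let dtg i j u : cylinder e u -> dt (g i j) u = h i j u.
Proof. by move=> Uu; exact: (dird_swap _ _ oU Uu (cf 2 j)). Qed.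

Let dth i j u : cylinder e u -> dt (h i j) u = k i j u.
Proof. by move=> Uu; exact: (dird_swap _ _ oU Uu (cft 2 j)). Qed.

Let dtQ u : cylinder e u -> dt Q u = 2 * \sum_i \sum_j g i j u * h i j u.
Proof.
move=> Uu.
rewrite (dird_sum _ oU (fun i => Ckr_sum oU (fun j => Ckr_sqr oU (cg 1 i j))) Uu).
rewrite mulr_sumr; apply: eq_bigr => i _.
rewrite (dird_sum _ oU (fun j => Ckr_sqr oU (cg 1 i j)) Uu) mulr_sumr.
by apply: eq_bigr => j _; rewrite (dird_sqr _ (cg 1 i j) Uu) (dtg i j Uu).
Qed.

Let dttQ u : cylinder e u ->
  dt (dt Q) u = 2 * \sum_i \sum_j (h i j u ^+ 2 + g i j u * k i j u).
Proof.
move=> Uu; rewrite (dird_eq _ oU Uu dtQ).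
have cgh i j : Ckr 1 (cylinder e) (fun u => g i j u * h i j u) :=
  Ckr_mul oU (cg 1 i j) (ch 1 i j).
have cS : Ckr 1 (cylinder e) (fun u => \sum_i \sum_j g i j u * h i j u) :=
  Ckr_sum oU (fun i => Ckr_sum oU (fun j => cgh i j)).
rewrite (dirdM _ (Ckr_cst 1 _ (2 : R)) cS Uu) dird_cst mulr0 addr0; congr (_ * _).
rewrite (dird_sum _ oU (fun i => Ckr_sum oU (fun j => cgh i j)) Uu).
apply: eq_bigr => i _; rewrite (dird_sum _ oU (fun j => cgh i j) Uu).
apply: eq_bigr => j _; rewrite (dirdM _ (cg 1 i j) (ch 1 i j) Uu) (dtg i j Uu) (dth i j Uu).
by move: (g i j u) (h i j u) (k i j u) => a b c; rewrite addrC expr2.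
Qed.

Definition velocity j (y : E) : R := dt (f j) (0, y).
Definition acceleration j (y : E) : R := dt (dt (f j)) (0, y).
Local Notation v := velocity.
Local Notation z := acceleration.

Let normr0e : `|0 : R| < e. Proof. by rewrite normr0. Qed.

Lemma Ckr_velocity l j : Ckr l E0 (v j).
Proof. exact: (Ckr_slice_x normr0e (cft l j)). Qed.

Lemma Ckr_acceleration l j : Ckr l E0 (z j).
Proof. exact: (Ckr_slice_x normr0e (cftt l j)). Qed.

Let dtZ (q : TE -> R) : (forall t (c : R) (x : E), 0 < c -> q (t, c *: x) = q (t, x)) ->
  forall t (c : R) (x : E), 0 < c -> dt q (t, c *: x) = dt q (t, x).
Proof.
move=> qZ t c x c0; rewrite -!dird_slice_t.
have -> : (fun s : R^o => q (s, c *: x) : R^o) = (fun s => q (s, x)).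
  by apply/funext => s; rewrite qZ.
by [].
Qed.

Lemma velocity_homog (x : E) j : x != 0 -> \sum_i x 0 i * partial i (v j) x = 0.
Proof.
move=> x0; apply: (homogeneous_partial (Ckr_velocity 1 j) _ x0) => c y c0.
by apply: dtZ => // t c' y'; exact: fZ.
Qed.

Lemma acceleration_homog (x : E) j : x != 0 -> \sum_i x 0 i * partial i (z j) x = 0.
Proof.
move=> x0; apply: (homogeneous_partial (Ckr_acceleration 1 j) _ x0) => c y c0.
by apply: dtZ => //; apply: dtZ => t c' y'; exact: fZ.
Qed.

Let f_dtf u : cylinder e u -> \sum_j f j u * dt (f j) u = 0.
Proof.
move=> Uu.
have H : dt (fun u => \sum_j f j u ^+ 2) u = 0.
  rewrite (@dird_eq _ _ (cylinder e) _ (fun=> 1) _ _ oU Uu) ?dird_cst// => -[t x] [te x0].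
  exact: f1.
move: H; rewrite (dird_sum _ oU (fun j => Ckr_sqr oU (cf 1 j)) Uu).
rewrite (eq_bigr _ (fun j _ => dird_sqr _ (cf 1 j) Uu)) -mulr_sumr => /eqP.
by rewrite mulf_eq0 pnatr_eq0 => /eqP.
Qed.

Lemma velocity_tangent (x : E) : x != 0 -> \sum_j x 0 j * v j x = 0.
Proof.
move=> x0; have := f_dtf (U0 x0).
rewrite (eq_bigr (fun j => (enorm x)^-1 * (x 0 j * v j x))); last first.
  by move=> j _; rewrite f0// mxE mulrA.
rewrite -mulr_sumr => /eqP; rewrite mulf_eq0 invr_eq0 gt_eqF ?enorm_gt0//=.
by move/eqP.
Qed.

(** The second time derivative of |f|^2 = 1, read at time 0 where f is x. The acceleration is thus
    not tangent, and this normal part carries the curvature of the sphere. *)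
Lemma acceleration_normal (x : E) : sphere x ->
  \sum_j x 0 j * z j x = - \sum_j v j x ^+ 2.
Proof.
move=> sx; have x0 := sphere_neq0 sx; have Uu := U0 x0.
have cff j : Ckr 1 (cylinder e) (fun u => f j u * dt (f j) u) :=
  Ckr_mul oU (cf 1 j) (cft 1 j).
have H : dt (fun u => \sum_j f j u * dt (f j) u) (0, x) = 0.
  by rewrite (dird_eq _ oU Uu f_dtf) dird_cst.
move: H; rewrite (dird_sum _ oU (fun j => cff j) Uu).
rewrite (eq_bigr (fun j => x 0 j * z j x + v j x ^+ 2)); last first.
  by move=> j _; rewrite (dirdM _ (cf 1 j) (cft 1 j) Uu) f0// radial_id// expr2.
by rewrite big_split /= => /eqP; rewrite addr_eq0 => /eqP.
Qed.

Let g0 i j x : sphere x -> g i j (0, x) = (i == j)%:R - x 0 i * x 0 j.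
Proof.
move=> sx; have x0 := sphere_neq0 sx.
rewrite -partial_radial// /g -partial_slice.
exact: (dird_eq _ oE x0 (fun y => f0 j)).
Qed.

(** At time 0 the differential of the map is the tangential projection. Contracting it with b leaves
    only the trace, because the radial derivatives b kills are exactly the normal part of the
    projection. *)
Let sum_proj (x : E) (b : 'I_m.+1 -> 'I_m.+1 -> R) : (forall j, \sum_i x 0 i * b i j = 0) ->
  \sum_i \sum_j ((i == j)%:R - x 0 i * x 0 j) * b i j = \sum_i b i i.
Proof.
move=> xb.
have -> : \sum_i \sum_j ((i == j)%:R - x 0 i * x 0 j) * b i j =
    \sum_i \sum_j (i == j)%:R * b i j - \sum_j \sum_i x 0 j * (x 0 i * b i j).
  rewrite [X in _ - X]exchange_big /= -sumrB; apply: eq_bigr => i _.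
  by rewrite -sumrB; apply: eq_bigr => j _; ring.
rewrite [X in _ - X]big1 ?subr0 => [|j _]; last by rewrite -mulr_sumr xb mulr0.
apply: eq_bigr => i _; rewrite (bigD1 i)//= eqxx mul1r big1 ?addr0// => j.
by rewrite eq_sym => /negbTE ->; rewrite mul0r.
Qed.

Lemma energy_density0 (x : E) : sphere x -> Q (0, x) = m%:R.
Proof.
move=> sx; rewrite -(@proj_sqr _ m (fun i => x 0 i))//.
by apply: eq_bigr => i _; apply: eq_bigr => j _; rewrite -/(g i j) (g0 _ _ sx).
Qed.

Lemma energy_density1 (x : E) : sphere x ->
  dt Q (0, x) = 2 * \sum_i partial i (v i) x.
Proof.
move=> sx; have x0 := sphere_neq0 sx; rewrite (dtQ (U0 x0)).
congr (_ * _); rewrite -(@sum_proj x (fun i j => partial i (v j) x)) => [|j].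
  apply: eq_bigr => i _; apply: eq_bigr => j _.
  by rewrite (g0 _ _ sx) /velocity partial_slice.
exact: velocity_homog.
Qed.

Lemma energy_density2 (x : E) : sphere x ->
  dt (dt Q) (0, x) =
  2 * (\sum_i \sum_j partial i (v j) x ^+ 2 + \sum_i partial i (z i) x).
Proof.
move=> sx; have x0 := sphere_neq0 sx; rewrite (dttQ (U0 x0)).
congr (_ * _); rewrite -(@sum_proj x (fun i j => partial i (z j) x)) => [|j]; last first.
  exact: acceleration_homog.
rewrite -big_split; apply: eq_bigr => i _; rewrite -big_split; apply: eq_bigr => j _ /=.
by rewrite (g0 _ _ sx) /velocity /acceleration !partial_slice.
Qed.

(** The density is m > 0 at time 0 and continuous; compactness of the sphere makes the time of
    positivity uniform. Beyond it the p-th power of the square root might fail to be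
    differentiable. *)
Lemma energy_density_near : exists2 d : R, 0 < d <= e &
  forall (t : R) (x : E), `|t| < d -> sphere x -> 0 < Q (t, x).
Proof.
have H : \forall t \near (0 : R^o), @sphere R m `<=` [set x | 0 < Q (t, x)].
  have [nc _] := compact_near_coveringP (@sphere R m).
  apply: (nc (@compact_sphere R m) R^o (nbhs (0 : R^o)) (fun t x => 0 < Q (t, x))) => x sx.
  have cQx := Ckr_continuous (cQ 0) (U0 (sphere_neq0 sx)).
  have Q0 : 0 < Q (0, x) by rewrite energy_density0// ltr0n.
  have [[A B] /= [nA nB] AB] : \forall u \near ((0, x) : TE), 0 < Q u.
    exact: (cvgr_gt _ cQx).
  by exists (B, A) => // -[y t] [/= By At]; exact: (AB (t, y)).
have [d /= d0 dP] := (nbhs_ballP _ _).1 H.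
exists (Num.min d e) => [|t x]; first by rewrite lt_min d0 e0/= ge_min lexx orbT.
rewrite lt_min => /andP[td _] sx; apply: (dP t) => //.
by rewrite -ball_normE /= sub0r normrN.
Qed.

(** The first two time derivatives of the p-th power of the norm of the differential, where Q > 0.
    They are left in the shape that [is_derive_sqrtX] and [is_derive_quotient] produce. *)
Definition energy1 (u : TE) : R :=
  p%:R / 2 * Num.sqrt (Q u) ^+ p * dt Q u / Q u.

Definition energy2 (u : TE) : R :=
  p%:R / 2 * ((p%:R / 2 * Num.sqrt (Q u) ^+ p * dt Q u / Q u * dt Q u
     + Num.sqrt (Q u) ^+ p * dt (dt Q) u) * Q u
    - Num.sqrt (Q u) ^+ p * dt Q u * dt Q u) / Q u ^+ 2.

Let continuous_eta (q : TE -> R) u : {for u, continuous (q : TE -> R^o)} ->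
  {for u, continuous (fun w : TE => q (w.1, w.2) : R^o)}.
Proof. by have -> : q = (fun w : TE => q (w.1, w.2)) by apply/funext => -[]. Qed.

Lemma derive_energy : exists2 d : R, 0 < d <= e &
  (forall t : R, `|t| < d -> is_derive (t : R^o) (1 : R^o)
    (fun t => sphere_int (fun x => Num.sqrt (Q (t, x)) ^+ p) : R^o)
    (sphere_int (fun x => energy1 (t, x)))) /\
  (forall t : R, `|t| < d -> is_derive (t : R^o) (1 : R^o)
    (fun t => sphere_int (fun x => energy1 (t, x)) : R^o)
    (sphere_int (fun x => energy2 (t, x)))).
Proof.
have [d /andP[d0 de] dQ] := energy_density_near.
pose U := cylinder e `&` [set u : TE | 0 < Q u].
have oUQ : open U.
  rewrite openE => u [Uu Qu]; rewrite /interior.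
  have h1 : \forall w \near u, cylinder e w by apply: open_nbhs_nbhs; split.
  have h2 : \forall w \near u, 0 < Q w.
    exact: (cvgr_gt _ (Ckr_continuous (cQ 0) Uu)).
  exact: filterI h1 h2.
have UQ u : U u -> 0 < Q u by case.
have sU : U `<=` cylinder e by move=> u [].
have inU (t : R) x : `|t| < d -> sphere x -> U (t, x).
  move=> td sx; split; last exact: dQ.
  by split; [exact: lt_le_trans de|exact: sphere_neq0].
have cQ' l := Ckr_sub sU (cQ l).
have cQt l : Ckr l U (dt Q) := Ckr_dird _ (cQ' l.+1).
have cQtt l : Ckr l U (dt (dt Q)) := Ckr_dird _ (cQt l.+1).
have cL l : Ckr l U (fun u => Num.sqrt (Q u) ^+ p) :=
  Ckr_exp p oUQ (Ckr_sqrt oUQ UQ (cQ' l)).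
have cQi l : Ckr l U (fun u => (Q u)^-1) := Ckr_inv oUQ UQ (cQ' l).
have c1 l : Ckr l U energy1 := Ckr_mul oUQ
  (Ckr_mul oUQ (Ckr_mul oUQ (Ckr_cst l U (p%:R / 2)) (cL l)) (cQt l)) (cQi l).
have cQ2i l : Ckr l U (fun u => (Q u ^+ 2)^-1).
  apply: (Ckr_inv oUQ _ (Ckr_exp 2 oUQ (cQ' l))) => u /UQ Qu; exact: exprn_gt0.
have c2 l : Ckr l U energy2 := Ckr_mul oUQ
  (Ckr_mul oUQ (Ckr_cst l U (p%:R / 2)) (Ckr_add oUQ
     (Ckr_mul oUQ (Ckr_add oUQ (Ckr_mul oUQ (c1 l) (cQt l)) (Ckr_mul oUQ (cL l) (cQtt l)))
       (cQ' l))
     (Ckr_opp oUQ (Ckr_mul oUQ (Ckr_mul oUQ (cL l) (cQt l)) (cQt l))))) (cQ2i l).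
have dQt (t : R) x : `|t| < d -> sphere x ->
    is_derive (t : R^o) (1 : R^o) (fun s : R^o => Q (s, x) : R^o) (dt Q (t, x)).
  by move=> td sx; exact: (is_derive_slice_t (cQ 1) (sU _ (inU _ _ td sx))).
have dQtt (t : R) x : `|t| < d -> sphere x ->
    is_derive (t : R^o) (1 : R^o) (fun s : R^o => dt Q (s, x) : R^o) (dt (dt Q) (t, x)).
  move=> td sx.
  exact: (is_derive_slice_t (Ckr_dird _ (cQ 2)) (sU _ (inU _ _ td sx))).
have dL (t : R) x : `|t| < d -> sphere x -> is_derive (t : R^o) (1 : R^o)
    (fun s : R^o => Num.sqrt (Q (s, x)) ^+ p : R^o) (energy1 (t, x)).
  by move=> td sx; exact: (@is_derive_sqrtX R (fun s => Q (s, x)) t _ p (dQ _ _ td sx) (dQt _ _ td sx)).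
exists d; first by rewrite d0.
split => t td.
- apply: (@derive_sphere_int_on R m (fun t x => Num.sqrt (Q (t, x)) ^+ p)
    (fun t x => energy1 (t, x)) d _ _ _ t td).
  + move=> s x sd sx; exact: (continuous_eta (Ckr_continuous (cL 0) (inU _ _ sd sx))).
  + move=> s x sd sx; exact: (continuous_eta (Ckr_continuous (c1 0) (inU _ _ sd sx))).
- apply: (@derive_sphere_int_on R m (fun t x => energy1 (t, x))
    (fun t x => energy2 (t, x)) d _ _ _ t td).
  + move=> s x sd sx; exact: (continuous_eta (Ckr_continuous (c1 0) (inU _ _ sd sx))).
  + move=> s x sd sx.
    have Qn0 : Q (s, x) != 0 by rewrite gt_eqF// dQ.
    exact: (@is_derive_quotient R (fun s => Num.sqrt (Q (s, x)) ^+ p) (fun s => dt Q (s, x))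
      (fun s => Q (s, x)) s (p%:R / 2) _ _ _ Qn0 (dL _ _ sd sx) (dQtt _ _ sd sx) (dQt _ _ sd sx)).
  + move=> s x sd sx; exact: (continuous_eta (Ckr_continuous (c2 0) (inU _ _ sd sx))).
Qed.

Let mN0 : m%:R != 0 :> R. Proof. by rewrite pnatr_eq0 -lt0n. Qed.

Local Notation kappa := (p%:R / m%:R * Num.sqrt (m%:R : R) ^+ p).

Let cdiv (a : 'I_m.+1 -> E -> R) : (forall l j, Ckr l E0 (a j)) ->
  Ckr 0 E0 (fun x => \sum_j partial j (a j) x - m%:R * \sum_j x 0 j * a j x).
Proof.
move=> ca; have cp i j : Ckr 0 E0 (partial i (a j)) := Ckr_dird _ (ca 1 j).
have ca0 j := ca 0 j.
have cx i : Ckr 0 E0 (fun x : E => x 0 i) := Ckr_coordinate 0 i oE.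
have cD : Ckr 0 E0 (fun x => \sum_j partial j (a j) x) := Ckr_sum oE (fun j => cp j j).
have cxa : Ckr 0 E0 (fun x => m%:R * \sum_j x 0 j * a j x) :=
  Ckr_mul oE (Ckr_cst 0 _ m%:R) (Ckr_sum oE (fun j => Ckr_mul oE (cx j) (ca0 j))).
exact: (Ckr_add oE cD (Ckr_opp oE cxa)).
Qed.

(** The density being constant, the integrand is a constant times div v; the missing term m <x, v>
    of the divergence theorem is 0 because v is tangent. *)
Lemma first_variation : sphere_int (fun x => energy1 (0, x)) = 0.
Proof.
have cG := cdiv Ckr_velocity.
have H := sphere_int_div_homog (Ckr_velocity 1) velocity_homog.
rewrite -[RHS](mulr0 kappa) -[X in _ * X]H -(sphere_intZ _ cG).
apply: eq_sphere_int => [|x sx]; first exact: (Ckr_mul oE (Ckr_cst 0 _ kappa) cG).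
rewrite /energy1 (energy_density0 sx) (energy_density1 sx) (velocity_tangent (sphere_neq0 sx)).
by move: (\sum_i _) (Num.sqrt _ ^+ p) => d s; field.
Qed.

(** On the sphere the integrand is kappa times the conformal energy plus Z - Y. Z integrates to 0 by
    the divergence theorem for the acceleration, Y by Yano's formula. *)
Lemma second_variation :
  sphere_int (fun x => energy2 (0, x)) = kappa * sphere_int (conformal_energy p v).
Proof.
pose Z (x : E) : R := \sum_j partial j (z j) x - m%:R * \sum_j x 0 j * z j x.
pose Y (x : E) : R := \sum_i \sum_j partial i (v j) x * partial j (v i) x
    - (\sum_i partial i (v i) x) ^+ 2 + (m%:R - 1) * \sum_i v i x ^+ 2.
have cZ : Ckr 0 E0 Z := cdiv Ckr_acceleration.
have cp i j : Ckr 0 E0 (partial i (v j)) := Ckr_dird _ (Ckr_velocity 1 j).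
have cY : Ckr 0 E0 Y :=
  Ckr_add oE (Ckr_add oE
    (Ckr_sum oE (fun i => Ckr_sum oE (fun j => Ckr_mul oE (cp i j) (cp j i))))
    (Ckr_opp oE (Ckr_sqr oE (Ckr_sum oE (fun i => cp i i)))))
  (Ckr_mul oE (Ckr_cst 0 _ (m%:R - 1)) (Ckr_sum oE (fun i => Ckr_sqr oE (Ckr_velocity 0 i)))).
have cC : Ckr 0 E0 (conformal_energy p v) := Ckr_conformal_energy (Ckr_velocity 1).
have cYN : Ckr 0 E0 (fun x => -1 * Y x) := Ckr_mul oE (Ckr_cst 0 _ (-1)) cY.
have cCZ := Ckr_add oE cC cZ.
have cA := Ckr_add oE cCZ cYN.
have IZ : sphere_int Z = 0 := sphere_int_div_homog (Ckr_acceleration 1) acceleration_homog.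
have IY : sphere_int Y = 0 :=
  sphere_int_yano (Ckr_velocity 2) velocity_homog velocity_tangent.
transitivity (sphere_int (fun x => kappa * (conformal_energy p v x + Z x + -1 * Y x))).
  apply: eq_sphere_int => [|x sx]; first exact: (Ckr_mul oE (Ckr_cst 0 _ kappa) cA).
  have x0 := sphere_neq0 sx.
  have bx := partial_normal (Ckr_velocity 2) velocity_tangent.
  rewrite /conformal_energy (conformal_part_sqr mN0 sx (velocity_tangent x0)
    (fun j => velocity_homog j x0) (fun i => bx i x x0)).
  rewrite /energy2 /Z /Y (energy_density0 sx) (energy_density1 sx) (energy_density2 sx).
  (* Here s is the p-th power of the square root of m, D = div v, a = div z, w = |v|^2, B = |Dv|^2,
     C = tr (Dv)^2 and u = <x, z>. *)
  have alg (s D a w B C u : R) : u = - w ->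
      p%:R / 2 * ((p%:R / 2 * s * (2 * D) / m%:R * (2 * D) + s * (2 * (B + a))) * m%:R
        - s * (2 * D) * (2 * D)) / m%:R ^+ 2 =
      p%:R / m%:R * s * (((p%:R - 2) / m%:R * D ^+ 2 + B - m%:R * w
        + (C - D ^+ 2 + (m%:R - 1) * w)) + (a - m%:R * u)
        + -1 * (C - D ^+ 2 + (m%:R - 1) * w)).
    by move=> ->; field.
  exact: (alg _ _ _ _ _ _ _ (acceleration_normal sx)).
rewrite (sphere_intZ _ cA) (sphere_intD cCZ cYN) (sphere_intD cC cZ) (sphere_intZ _ cY).
by rewrite IZ IY mulr0 !addr0.
Qed.

End energy_variation.

(** * The energy along a variation of the identity *)

Section one_parameter_variation.
Context {R : realType} {m : nat}.
Local Notation E := 'rV[R]_m.+1.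
Local Notation E0 := [set x : E | x != 0].
Local Notation TE := (R^o * E)%type.

(** Order 0 only: the energy is to be written as an integral for all |t| < e, where the density may
    vanish and its square root is merely continuous. *)
Lemma Ckr0_sqrt (U : set E) (q : E -> R) : Ckr 0 U q -> Ckr 0 U (fun x => Num.sqrt (q x)).
Proof.
move=> cq x Ux; apply: (@continuous_comp _ R^o R^o (q : E -> R^o) Num.sqrt); first exact: cq.
exact: sqrt_continuous.
Qed.

Variables (Phi : R^o -> E -> E) (e : R) (p : nat).
Hypothesis m0 : (0 < m)%N.
Hypothesis e0 : 0 < e.
Hypothesis cPhi : smooth_on (cylinder e) (fun u : TE => hext (Phi u.1) u.2).
Hypothesis sPhi : forall (t : R) x, `|t| < e -> sphere x -> sphere (Phi t x).
Hypothesis Phi0 : forall x, sphere x -> Phi 0 x = x.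

Let oE := @open_neq0 R m.
Let oU := @open_cylinder R m e.

Definition variation_coord j (u : TE) : R := hext (Phi u.1) u.2 0 j.
Local Notation f := variation_coord.

Let cf k j : Ckr k (cylinder e) (f j).
Proof. exact: (Ckr_coord j oU (cPhi k)). Qed.

Let f0 (y : E) j : y != 0 -> f j (0, y) = radial y 0 j.
Proof. by move=> y0; rewrite /f /hext /= Phi0//; exact: radial_sphere. Qed.

Let f1 (t : R) (x : E) : `|t| < e -> x != 0 -> \sum_j f j (t, x) ^+ 2 = 1.
Proof. by move=> te x0; exact: (sPhi te (radial_sphere x0)). Qed.

Let fZ (t : R) (c : R) (x : E) j : 0 < c -> f j (t, c *: x) = f j (t, x).
Proof. by move=> c0; rewrite /f /hext /= radialZ. Qed.

Let energy_slice (t : R) : `|t| < e -> p_energy p (Phi t) =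
  p%:R^-1 * sphere_int (fun x => Num.sqrt (energy_density f (t, x)) ^+ p).
Proof.
move=> te; have cg i j : Ckr 0 E0 (fun x : E => dird ((0, delta_mx 0 i) : TE) (f j) (t, x)) :=
  Ckr_slice_x te (Ckr_dird _ (cf 1 j)).
have cQ : Ckr 0 E0 (fun x => energy_density f (t, x)) :=
  Ckr_sum oE (fun i => Ckr_sum oE (fun j => Ckr_sqr oE (cg i j))).
rewrite /p_energy; congr (_ * _); apply: eq_sphere_int => [|x sx].
  exact: (Ckr_exp p oE (Ckr0_sqrt cQ)).
have Ux : cylinder e ((t, x) : TE) by split => //; exact: sphere_neq0.
have [dF _] := cPhi 1; congr (Num.sqrt _ ^+ _).
apply: eq_bigr => i _; apply: eq_bigr => j _.
rewrite (derive_slice_x (fun u : TE => hext (Phi u.1) u.2)).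
by rewrite -(dird_coord _ j (dF _ Ux)).
Qed.

Let derive_p_energy : exists2 d : R, 0 < d &
  (forall t : R, `|t| < d -> is_derive (t : R^o) (1 : R^o)
    (fun t => p_energy p (Phi t) : R^o) (p%:R^-1 * sphere_int (fun x => energy1 f p (t, x)))) /\
  is_derive (0 : R^o) (1 : R^o)
    (fun t => p%:R^-1 * sphere_int (fun x => energy1 f p (t, x)) : R^o)
    (p%:R^-1 * sphere_int (fun x => energy2 f p (0, x))).
Proof.
have [d /andP[d0 de] [d1 d2]] := derive_energy p m0 e0 cf f0.
exists d; [exact: d0|split=> [t td|]; last first].
  have H := d2 0; rewrite normr0 in H; have {}H := H d0.
  exact: (is_deriveZ (p%:R^-1)).
have tB : \forall s \near (t : R^o), `|s| < d.
  exact: (@cvgr_norm_lt _ _ _ _ _ (id : R^o -> R^o) t cvg_id _ td).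
apply: (near_eq_is_derive _ (@is_deriveZ _ _ _ _ (p%:R^-1) _ _ _ (d1 t td))).
near=> s; rewrite energy_slice//; apply: lt_le_trans de; near: s; exact: tB.
Unshelve. all: by end_near.
Qed.

Lemma p_energy_first_variation :
  is_derive (0 : R^o) (1 : R^o) (fun t => p_energy p (Phi t) : R^o) 0.
Proof.
have [d d0 [d1 _]] := derive_p_energy; have := d1 0; rewrite normr0 => /(_ d0).
by rewrite (first_variation p m0 e0 cf f0 f1 fZ) mulr0.
Qed.

Lemma p_energy_second_variation :
  'D_(1 : R^o) (fun s : R^o => 'D_(1 : R^o) (fun t : R^o => p_energy p (Phi t) : R^o) s) 0 =
  p%:R^-1 * (p%:R / m%:R * Num.sqrt (m%:R : R) ^+ p *
    sphere_int (conformal_energy p (velocity f))).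
Proof.
have [d d0 [d1 d2]] := derive_p_energy.
have tB : \forall s \near (0 : R^o), `|s| < d.
  by apply: (@cvgr_norm_lt _ _ _ _ _ (id : R^o -> R^o) 0 cvg_id d); rewrite normr0.
rewrite -(second_variation p m0 e0 cf f0 f1 fZ) -(@derive_val _ _ _ _ _ _ _ d2).
apply: near_eq_derive; near=> s.
have sd : `|s| < d by near: s; exact: tB.
exact: (@derive_val _ _ _ _ _ _ _ (d1 s sd)).
Unshelve. all: end_near. Qed.

End one_parameter_variation.

Section id_harmonic.
Context {R : realType} {m : nat}.
Local Notation E := 'rV[R]_m.+1.

Lemma p_harmonic_id (p : nat) : (0 < m)%N -> p_harmonic p (id : E -> E).
Proof.
move=> m0; split; first by split=> // k; exact: Ck_radial.
move=> Phi [e [e0 cPhi sPhi Phi0]].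
exact: (@p_energy_first_variation R m Phi e p m0 e0 cPhi sPhi Phi0).
Qed.

End id_harmonic.

(** * Stability of the identity *)

Section field_variation.
Context {R : realType} {m : nat}.
Local Notation E := 'rV[R]_m.+1.
Local Notation E0 := [set x : E | x != 0].
Local Notation TE := (R^o * E)%type.
Let oE := @open_neq0 R m.

Variables V : E -> E.
Hypothesis fV : field_along id V.

(* The geodesic variation x + r V(x), up to reparametrization. *)
Definition exp_field (r : R) (x : E) : E := radial (x + r *: V x).

Lemma dot_exp_field (r : R) (x : E) : sphere x ->
  dot (x + r *: V x) (x + r *: V x) = 1 + r ^+ 2 * dot (V x) (V x).
Proof.
move=> sx; have [_ /(_ x sx) xV] := fV.
by rewrite dotDl !dotDr !dotZl !dotZr xV (dotC (V x)) xV sx; ring.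
Qed.

Lemma dot_exp_field_gt0 (r : R) (x : E) : sphere x ->
  0 < dot (x + r *: V x) (x + r *: V x).
Proof.
by move=> sx; rewrite dot_exp_field// ltr_pwDl// mulr_ge0 ?sqr_ge0// dot_ge0.
Qed.

Lemma exp_field_sphere (r : R) (x : E) : sphere x -> sphere (exp_field r x).
Proof. by move=> sx; apply: radial_sphere; rewrite -dot_gt0; exact: dot_exp_field_gt0. Qed.

Lemma exp_field0 (x : E) : sphere x -> exp_field 0 x = x.
Proof. by move=> sx; rewrite /exp_field scale0r addr0 radial_id. Qed.

(** The time space [T] and the time function [c] are left general so as to cover both the
    one-parameter family and the family at time s + t. *)
Lemma smooth_exp_field (T : normedModType R) (U : set (T * E)) (c : T * E -> R) :
  open U -> (forall u, U u -> u.2 != 0) -> (forall k, Ckr k U c) ->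
  smooth_on U (fun u => hext (exp_field (c u)) u.2).
Proof.
move=> oU U0 cc k.
have sU : U `<=` (snd : T * E -> E) @^-1` E0 by move=> u Uu; exact: U0.
have csnd : continuous (snd : T * E -> E) by move=> ?; exact: cvg_snd.
have cr : Ck k U (fun u : T * E => radial u.2) :=
  Ck_sub sU (@Ck_comp_linear R (T * E)%type E E k E0 snd (@radial R m) csnd (Ck_radial k)).
have cV : Ck k U (fun u : T * E => hext V u.2) :=
  Ck_sub sU (@Ck_comp_linear R (T * E)%type E E k E0 snd (hext V) csnd (fV.1 k)).
have cg : Ck k U (fun u => radial u.2 + c u *: hext V u.2) := CkD oU cr (CkZ oU (cc k) cV).
have q0 u : U u -> 0 < dot (radial u.2 + c u *: hext V u.2) (radial u.2 + c u *: hext V u.2).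
  by move=> Uu; apply: dot_exp_field_gt0; apply: radial_sphere; exact: U0.
exact: (CkZ oU (Ckr_rsqrt oU q0 (Ckr_dot oU cg cg)) cg).
Qed.

Lemma smooth_exp_field1 (e : R) :
  smooth_on (cylinder e) (fun u : TE => hext (exp_field u.1) u.2).
Proof.
apply: (smooth_exp_field (@open_cylinder R m e) (c := fst)); first by move=> u [].
by move=> k; exact: Ck_fst.
Qed.

(** Since V(x) is orthogonal to x, the squared norm of x + s V(x) is 1 + s^2 |V(x)|^2. The
    normalizing factor is therefore stationary at 0, and the velocity is V itself. *)
Let rsqrt_mul_derive (a b c : R) : 0 <= b ->
  'D_(1 : R^o) (fun s : R^o => (Num.sqrt (1 + s ^+ 2 * b))^-1 * (a + s * c) : R^o) 0 = c.
Proof.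
move=> b0; have oT := @openT R^o.
have ci : Ckr 1 setT (fun s : R^o => s : R) := Ck_id 1 setT.
have cq : Ckr 1 setT (fun s : R^o => 1 + s ^+ 2 * b) :=
  Ckr_add oT (Ckr_cst 1 setT 1) (Ckr_mul oT (Ckr_sqr oT ci) (Ckr_cst 1 setT b)).
have cl : Ckr 1 setT (fun s : R^o => a + s * c) :=
  Ckr_add oT (Ckr_cst 1 setT a) (Ckr_mul oT ci (Ckr_cst 1 setT c)).
have q0 (s : R^o) : setT s -> 0 < 1 + s ^+ 2 * b.
  by move=> _; rewrite ltr_pwDl// mulr_ge0// sqr_ge0.
have di : dird (1 : R^o) (fun s : R^o => s : R) 0 = 1 := derive_id _ _.
have dq : dird (1 : R^o) (fun s : R^o => 1 + s ^+ 2 * b) 0 = 0.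
  rewrite (dirdD _ (Ckr_cst 1 setT 1) (Ckr_mul oT (Ckr_sqr oT ci) (Ckr_cst 1 setT b)) I).
  rewrite (dirdM _ (Ckr_sqr oT ci) (Ckr_cst 1 setT b) I) (dird_sqr _ ci I) !dird_cst.
  by rewrite mul0r !mulr0 !addr0.
have dl : dird (1 : R^o) (fun s : R^o => a + s * c) 0 = c.
  rewrite (dirdD _ (Ckr_cst 1 setT a) (Ckr_mul oT ci (Ckr_cst 1 setT c)) I).
  by rewrite (dirdM _ ci (Ckr_cst 1 setT c) I) !dird_cst di mulr1 mulr0 !add0r.
rewrite -[LHS]/(dird (1 : R^o) (fun s : R^o => (Num.sqrt (1 + s ^+ 2 * b))^-1 * (a + s * c)) 0).
rewrite (dirdM _ (Ckr_rsqrt oT q0 cq) cl I) (dird_rsqrt _ cq I (q0 0 I)) dq dl.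
by rewrite expr2 !mul0r addr0 sqrtr1 invr1 mul1r mulr0 mulr0 addr0.
Qed.

Lemma velocity_exp_field j (x : E) : x != 0 ->
  velocity (variation_coord exp_field) j x = hext V x 0 j.
Proof.
move=> x0; rewrite /velocity -dird_slice_t.
have sx := radial_sphere x0.
have b0 : 0 <= dot (hext V x) (hext V x) by exact: dot_ge0.
rewrite -(@rsqrt_mul_derive (radial x 0 j) _ (hext V x 0 j) b0); congr (derive _ (0 : R^o) (1 : R^o)).
apply/funext => s; rewrite /variation_coord /hext /= /exp_field /radial mxE -/(radial x).
by rewrite /enorm (dot_exp_field _ sx) !mxE.
Qed.

End field_variation.

(** * Eigenvalues of the Jacobi operator of the identity *)

Section id_stable.
Context {R : realType} {m : nat}.
Local Notation E := 'rV[R]_m.+1.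
Local Notation E0 := [set x : E | x != 0].
Local Notation TE := (R^o * E)%type.
Local Notation RR := (R^o * R^o)%type.
Let oE := @open_neq0 R m.

Variables (p : nat) (V : E -> E) (lambda : R).
Hypothesis m0 : (0 < m)%N.
Hypothesis mp : (m < p)%N.
Hypothesis JV : jacobi_eigenfield p id lambda V.

Let fV : field_along id V. Proof. by have [_ []] := JV. Qed.

Let w j (y : E) : R := hext V y 0 j.

Let cw k j : Ckr k E0 (w j).
Proof. exact: (Ckr_coord j oE (fV.1 k)). Qed.

Let Phi2 (u : RR) (x : E) : E := exp_field V (u.1 + u.2) x.

Let smooth_Phi2 : smooth_variation id Phi2.
Proof.
exists 1; split; first exact: ltr01.
- apply: (smooth_exp_field fV (@open_tube R m RR 1) (c := fun u : RR * E => u.1.1 + u.1.2)).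
    by move=> u [].
  move=> k; have oT := @open_tube R m RR 1.
  have cfst : continuous (fst : RR * E -> RR) by move=> ?; exact: cvg_fst.
  have c1 : Ckr k [set u : RR * E | `|u.1| < 1 /\ u.2 != 0] (fun u => u.1.1) :=
    Ck_sub (fun _ _ => I) (@Ck_comp_linear R (RR * E)%type RR R^o k setT fst fst cfst (@Ck_fst R R^o R^o k setT)).
  have c2 : Ckr k [set u : RR * E | `|u.1| < 1 /\ u.2 != 0] (fun u => u.1.2) :=
    Ck_sub (fun _ _ => I) (@Ck_comp_linear R (RR * E)%type RR R^o k setT fst snd cfst (@Ck_snd R R^o R^o k setT)).
  exact: (Ckr_add oT c1 c2).
- by move=> t x _; exact: exp_field_sphere.
- by move=> x sx; rewrite /Phi2 /= addr0 exp_field0.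
Qed.

Let derive_exp_field (x : E) : sphere x ->
  'D_(1 : R^o) (fun s : R^o => exp_field V s x) 0 = V x.
Proof.
move=> sx; have x0 := sphere_neq0 sx.
have Ux : cylinder 1 ((0, x) : TE) by split; rewrite /= ?normr0.
have [dF _] := smooth_exp_field1 fV 1 1.
have -> : (fun s : R^o => exp_field V s x) = fun s => hext (exp_field V s) x.
  by apply/funext => s; rewrite /hext /= radial_id.
rewrite (derive_slice_t (fun u : TE => hext (exp_field V u.1) u.2)).
apply/rowP => j; rewrite -(dird_coord _ j (dF _ Ux)).
have := velocity_exp_field fV j x0; rewrite /velocity => H.
by rewrite [LHS]H /hext /= radial_id.
Qed.

Let derive_shift (F : R^o -> R^o) (s : R^o) :
  'D_(1 : R^o) (fun t : R^o => F (s + t)) 0 = 'D_(1 : R^o) F s.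
Proof.
suff H : (fun h : R => h^-1 *: (((fun t : R^o => F (s + t)) \o shift (0 : R^o)) (h *: (1 : R^o)) - F (s + 0))) =
    (fun h => h^-1 *: ((F \o shift s) (h *: (1 : R^o)) - F s)).
  by rewrite /derive H.
by apply/funext => h /=; rewrite !addr0 (addrC s).
Qed.

Let kappa := p%:R^-1 * (p%:R / m%:R * Num.sqrt (m%:R : R) ^+ p).

Let eigen_identity :
  lambda * sphere_int (fun x => \sum_j w j x ^+ 2) =
  kappa * sphere_int (conformal_energy p w).
Proof.
have cN : Ckr 0 E0 (fun x => \sum_j w j x ^+ 2) :=
  Ckr_sum oE (fun j => Ckr_sqr oE (cw 0 j)).
have [_ [_ _ J]] := JV.
have dV x : sphere x -> 'D_(1 : R^o) (fun s : R^o => Phi2 (s, 0) x) 0 = V x /\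
    'D_(1 : R^o) (fun t : R^o => Phi2 (0, t) x) 0 = V x.
  move=> sx; rewrite -(derive_exp_field sx); split; congr (derive _ (0 : R^o) (1 : R^o)).
    by apply/funext => s; rewrite /Phi2 /= addr0.
  by apply/funext => s; rewrite /Phi2 /= add0r.
have {dV}J := J V Phi2 fV smooth_Phi2 dV.
have I1 : sphere_int (fun x => dot (lambda *: V x) (V x)) =
    lambda * sphere_int (fun x => \sum_j w j x ^+ 2).
  rewrite -(sphere_intZ _ cN).
  apply: eq_sphere_int => [|x sx]; first exact: (Ckr_mul oE (Ckr_cst 0 _ lambda) cN).
  rewrite dotZl; congr (_ * _); apply: eq_bigr => j _.
  by rewrite /w /hext /= radial_id.
rewrite -I1 -J.
(* For a function of s + t the derivative in t at 0 is the derivative at s, so the mixed derivative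
   becomes the second derivative of a one-parameter family. *)
have -> : (fun s : R^o => 'D_(1 : R^o) (fun t : R^o => p_energy p (Phi2 (s, t)) : R^o) 0) =
    fun s : R^o => 'D_(1 : R^o) (fun t : R^o => p_energy p (exp_field V t) : R^o) s.
  apply/funext => s.
  exact: (derive_shift (fun t : R^o => p_energy p (exp_field V t) : R^o) s).
rewrite (@p_energy_second_variation R m (exp_field V) 1 p m0 ltr01 (smooth_exp_field1 fV 1)
  (fun t x _ => @exp_field_sphere _ _ _ fV t x) (exp_field0 V)).
rewrite mulrA -/kappa; apply: (congr1 ( *%R kappa)); apply: eq_sphere_int => [|x sx].
  exact: (Ckr_conformal_energy (cw 1)).
have x0 := sphere_neq0 sx.
have ev j := velocity_exp_field fV j x0.
have eb i j : partial i (velocity (variation_coord (exp_field V)) j) x = partial i (w j) x.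
  exact: (dird_eq _ oE x0 (fun (y : E) (y0 : E0 y) => velocity_exp_field fV j y0)).
rewrite /conformal_energy.
have -> : (fun i j => partial i (velocity (variation_coord (exp_field V)) j) x) =
    fun i j => partial i (w j) x by apply/funext => i; apply/funext => j.
have -> : (fun i => velocity (variation_coord (exp_field V)) i x) = fun i => w i x.
  by apply/funext.
congr (_ + _ * _ ^+ 2); apply: eq_bigr => i _; exact: eb.
Qed.

Let kappa0 : 0 < kappa.
Proof.
have p0 : (0 < p)%N by rewrite (leq_trans _ mp).
by rewrite /kappa !mulr_gt0 ?invr_gt0 ?exprn_gt0 ?sqrtr_gt0 ?ltr0n.
Qed.

Let conformal_energy_ge0 x : 0 <= conformal_energy p w x.
Proof.
apply: addr_ge0; apply: mulr_ge0; rewrite ?sqr_ge0 ?invr_ge0//.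
  by apply: sumr_ge0 => i _; apply: sumr_ge0 => j _; exact: sqr_ge0.
by rewrite subr_ge0 ler_pdivlMr ?ltr0n// mul1r ler_nat ltnW.
Qed.

Let norm_gt0 : 0 < sphere_int (fun x => \sum_j w j x ^+ 2).
Proof.
have cN : Ckr 0 E0 (fun x => \sum_j w j x ^+ 2) :=
  Ckr_sum oE (fun j => Ckr_sqr oE (cw 0 j)).
have N0 x : sphere x -> 0 <= \sum_j w j x ^+ 2.
  by move=> _; apply: sumr_ge0 => j _; exact: sqr_ge0.
rewrite lt_def (sphere_int_ge0 cN N0) andbT; apply/eqP => I0.
have [[x [sx Vx]] _] := JV; move: Vx; rewrite -dot_gt0.
have -> : dot (V x) (V x) = 0; last by rewrite ltxx.
rewrite -[RHS](sphere_int_eq0 cN N0 I0 sx); apply: eq_bigr => j _.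
by rewrite /w /hext /= radial_id.
Qed.

Lemma jacobi_eigenvalue_ge0 : 0 <= lambda.
Proof.
rewrite -(pmulr_lge0 _ norm_gt0) eigen_identity; apply: mulr_ge0; first exact: ltW.
apply: sphere_int_ge0 => [|x _]; last exact: conformal_energy_ge0.
exact: (Ckr_conformal_energy (cw 1)).
Qed.

(** As p > m, both squares in the conformal energy vanish. With zero divergence and zero conformal
    part, the symmetrized derivative D_i V_j + D_j V_i equals - (x_i V_j + V_i x_j), which is 0 when
    contracted with vectors orthogonal to x. *)
Let killing_of_conformal (x u v : E) : sphere x -> conformal_energy p w x = 0 ->
  dot x u = 0 -> dot x v = 0 ->
  dot ('D_u (hext V) x) v + dot ('D_v (hext V) x) u = 0.
Proof.
move=> sx C0 xu xv; have x0 := sphere_neq0 sx.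
have pm : 0 < p%:R / m%:R - 1 :> R.
  by rewrite subr_gt0 ltr_pdivlMr ?ltr0n// mul1r ltr_nat.
have [D0 T0] : \sum_i partial i (w i) x = 0 /\
    forall i j, conformal_part (fun i j => partial i (w j) x) (fun i => x 0 i) (fun i => w i x) i j = 0.
  move/eqP: C0; rewrite /conformal_energy paddr_eq0; first last.
  - by rewrite mulr_ge0 ?sqr_ge0// ltW.
  - rewrite mulr_ge0 ?invr_ge0//; apply: sumr_ge0 => i _; apply: sumr_ge0 => j _; exact: sqr_ge0.
  move=> /andP[]; rewrite !mulf_eq0 invr_eq0 pnatr_eq0 (gt_eqF pm) /= orbb => S0 /eqP D0.
  split=> // i j.
  move: S0; rewrite psumr_eq0 => [/allP/(_ i)|i' _]; last by apply: sumr_ge0 => j' _; exact: sqr_ge0.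
  rewrite mem_index_enum => /(_ isT) /=.
  rewrite psumr_eq0 => [/allP/(_ j)|j' _]; last exact: sqr_ge0.
  by rewrite mem_index_enum => /(_ isT) /=; rewrite sqrf_eq0 => /eqP.
have [dV _] := fV.1 1.
have De (a b : E) : dot ('D_a (hext V) x) b = \sum_i \sum_j a 0 i * b 0 j * partial i (w j) x.
  rewrite exchange_big; apply: eq_bigr => j _.
  rewrite (derive_sum_delta _ (dV x x0)) summxE mulr_suml; apply: eq_bigr => i _.
  by rewrite mxE -(dird_coord _ j (dV x x0)) mulrAC.
rewrite !De [X in _ + X]exchange_big -big_split /=.
rewrite (eq_bigr (fun i => - (u 0 i * x 0 i) * (\sum_j w j x * v 0 j)
  - (u 0 i * w i x) * (\sum_j x 0 j * v 0 j))); last first.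
  move=> i _; rewrite -big_split !mulr_sumr -sumrB; apply: eq_bigr => j _ /=.
  have := T0 i j; rewrite /conformal_part D0.
  move: (partial i (w j) x) (partial j (w i) x) (w i x) (w j x) (x 0 i) (x 0 j) (u 0 i) (v 0 j) ((i == j)%:R : R).
  move=> a b c d e f g h k; rewrite mulr0 !mul0r subr0 => /eqP; rewrite addr_eq0 => /eqP H.
  transitivity (g * h * (a + b)); first ring.
  rewrite H; ring.
rewrite sumrB -!mulr_suml sumrN.
have -> : \sum_j x 0 j * v 0 j = 0 by exact: xv.
have -> : \sum_i u 0 i * x 0 i = 0 by rewrite -[RHS]xu; exact: dotC.
by rewrite oppr0 mul0r mulr0 subr0.
Qed.

Lemma jacobi_eigenvalue_gt0 : ~ killing V -> 0 < lambda.
Proof.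
move=> nK; rewrite lt_def jacobi_eigenvalue_ge0 andbT; apply/eqP => l0; apply: nK.
split; first exact: fV.
have cC : Ckr 0 E0 (conformal_energy p w) := Ckr_conformal_energy (cw 1).
have I0 : sphere_int (conformal_energy p w) = 0.
  have /eqP := eigen_identity; rewrite l0 mul0r eq_sym mulf_eq0 (gt_eqF kappa0) /=.
  by move/eqP.
move=> x u v sx; apply: killing_of_conformal => //.
exact: (sphere_int_eq0 cC (fun y _ => conformal_energy_ge0 y) I0 sx).
Qed.

End id_stable.

Theorem corollary1p5 (R : realType) (p m : nat)
    (hp : (2 <= p)%N) (hm : (0 < m)%N) (hpm : (m < p)%N) :
  [/\ p_harmonic p (id : 'rV[R]_m.+1 -> 'rV[R]_m.+1),
      stable p (id : 'rV[R]_m.+1 -> 'rV[R]_m.+1) &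
      (* the eigenvalue 0 only comes from infinitesimal isometries *)
      forall (lambda : R) (V : 'rV[R]_m.+1 -> 'rV[R]_m.+1),
        jacobi_eigenfield p id lambda V -> ~ killing V -> 0 < lambda].
Proof.
split.
- exact: p_harmonic_id.
- move=> lambda V JV; exact: (jacobi_eigenvalue_ge0 hm hpm JV).
- move=> lambda V JV; exact: (jacobi_eigenvalue_gt0 hm hpm JV).
Qed.
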